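(* Let $\mathbb{X}_\kappa$ be the complete simply connected $n$-dimensional Riemannian manifold of constant curvature $\kappa\leq 0$, and let $C$ be a compact convex polyhedron of $\mathbb{X}_\kappa$. Then $C$ is even if and only if there exist a point $x\in\mathbb{X}_\kappa$, a finite Coxeter system $(W,S)$ and an injective representation $\rho$ of $W$ into the group of isometries of $\mathbb{X}_\kappa$ fixing $x$, sending each element of $S$ to a reflection, such that $C$ is the convex hull of the orbit under $W$ of a point $y$ in the interior of a chamber. Moreover, in this case the $1$-skeleton of $C$ is isomorphic to the Cayley graph of $(W,S)$.
   Context: A compact convex polyhedron $C$ of $\mathbb{X}_\kappa$ is even if for every edge $a$ of $C$ the unique reflection of $\mathbb{X}_\kappa$ exchanging the endpoints of $a$ preserves $C$ and fixes no vertex of $C$. A reflection is the isometry fixing pointwise a totally geodesic hyperplane and not equal to the identity. For a finite group generated by reflections fixing $x$, the walls are the fixed hyperplanes of the reflections of the group, and the chambers are the (closures of the) connected components of the complement of the union of the walls in $\mathbb{X}_\kappa$. The Cayley graph of $(W,S)$ has vertex set $W$ and an edge between $w$ and $ws$ for all $w\in W$, $s\in S$. *)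

(* Defs.v *)
From HB Require Import structures.
From mathcomp Require Import all_boot all_order all_algebra all_fingroup.
From mathcomp Require Import all_classical all_reals all_analysis.

Set Implicit Arguments.
Unset Strict Implicit.
Unset Printing Implicit Defensive.

Import Order.TTheory GRing.Theory Num.Theory.
Import numFieldNormedType.Exports.

Local Open Scope classical_set_scope.
Local Open Scope ring_scope.

(* For kappa <= 0,
   X_kappa is realized as the sheet
     { (t, v) in R x R^n | t^2 + kappa |v|^2 = 1, t > 0 },
   with the Riemannian metric induced by |dv|^2 + dt^2 / kappa when kappa < 0
   (the hyperboloid model rescaled to curvature kappa) and by |dv|^2 when
   kappa = 0 (the affine hyperplane t = 1, i.e. Euclidean space).
   The sheet is the graph of the function height below, so a point is given
   by its coordinate v : 'rV[R]_n; the projection (t, v) |-> v is a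
   homeomorphism, so the topology of X_kappa is that of 'rV[R]_n.  The
   distance, on the other hand, is dist below, not the norm of 'rV[R]_n. *)

Definition dotv (R : realType) (m : nat) (u v : 'rV[R]_m) : R :=
  \sum_(i < m) u 0 i * v 0 i.

Definition height (R : realType) (n : nat) (kappa : R) (v : 'rV[R]_n) : R :=
  Num.sqrt (1 - kappa * dotv v v).

Definition sheet (R : realType) (n : nat) (kappa : R) (v : 'rV[R]_n) :
    'rV[R]_(1 + n) :=
  row_mx (height kappa v)%:M v.

Definition arcosh (R : realType) (z : R) : R :=
  ln (z + Num.sqrt (z ^+ 2 - 1)).

(* For kappa < 0:
   cosh (sqrt (- kappa) * d (u, v)) = t_u t_v + kappa <u, v>. *)
Definition dist (R : realType) (n : nat) (kappa : R) (u v : 'rV[R]_n) : R :=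
  if kappa == 0 then Num.sqrt (dotv (u - v) (u - v))
  else arcosh (height kappa u * height kappa v + kappa * dotv u v)
       / Num.sqrt (- kappa).

Definition isometry (R : realType) (n : nat) (kappa : R)
    (f : 'rV[R]_n -> 'rV[R]_n) : Prop :=
  bijective f /\ forall u v, dist kappa (f u) (f v) = dist kappa u v.

(* Totally geodesic hyperplanes are the nonempty traces on the sheet of the
   linear hyperplanes of R^(1 + n).  Nonemptiness excludes, for kappa = 0, the
   hyperplane t = 0 parallel to the sheet. *)
Definition hplane (R : realType) (n : nat) (kappa : R) (a : 'rV[R]_(1 + n)) :
    set 'rV[R]_n :=
  [set v | dotv a (sheet kappa v) = 0].

Definition halfspace (R : realType) (n : nat) (kappa : R)
    (a : 'rV[R]_(1 + n)) : set 'rV[R]_n :=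
  [set v | 0 <= dotv a (sheet kappa v)].

Definition proper_covector (R : realType) (n : nat) (kappa : R)
    (a : 'rV[R]_(1 + n)) : Prop :=
  a != 0 /\ hplane kappa a !=set0.

Definition hyperplane (R : realType) (n : nat) (kappa : R)
    (H : set 'rV[R]_n) : Prop :=
  exists2 a, proper_covector kappa a & H = hplane kappa a.

Definition reflection (R : realType) (n : nat) (kappa : R)
    (r : 'rV[R]_n -> 'rV[R]_n) : Prop :=
  [/\ isometry kappa r, r <> id &
      exists2 H, hyperplane kappa H & forall p, H p -> r p = p].

(* The geodesic segment [u, v], described by the distance. *)
Definition segment (R : realType) (n : nat) (kappa : R) (u v : 'rV[R]_n) :
    set 'rV[R]_n :=
  [set p | dist kappa u p + dist kappa p v = dist kappa u v].

Definition geodesically_convex (R : realType) (n : nat) (kappa : R)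
    (A : set 'rV[R]_n) : Prop :=
  forall u v, A u -> A v -> segment kappa u v `<=` A.

Definition convex_hull (R : realType) (n : nat) (kappa : R)
    (A : set 'rV[R]_n) : set 'rV[R]_n :=
  smallest (geodesically_convex kappa) A.

(* The interior of C is allowed to be empty. *)
Definition compact_convex_polyhedron (R : realType) (n : nat) (kappa : R)
    (C : set 'rV[R]_n) : Prop :=
  [/\ C !=set0, compact C &
      exists2 s : seq 'rV[R]_(1 + n),
        (forall a, a \in s -> proper_covector kappa a) &
        C = [set v | forall a, a \in s -> halfspace kappa a v]].

(* C is a face of itself: this is needed when C is a point or a segment. *)
Definition face (R : realType) (n : nat) (kappa : R) (C F : set 'rV[R]_n) :
    Prop :=
  F !=set0 /\
  (F = C \/
   exists a, [/\ proper_covector kappa a, C `<=` halfspace kappa a &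
                 F = C `&` hplane kappa a]).

Definition vertex (R : realType) (n : nat) (kappa : R) (C : set 'rV[R]_n)
    (v : 'rV[R]_n) : Prop :=
  face kappa C [set v].

(* u and v are the endpoints of an edge of C. *)
Definition edge (R : realType) (n : nat) (kappa : R) (C : set 'rV[R]_n)
    (u v : 'rV[R]_n) : Prop :=
  u <> v /\ face kappa C (segment kappa u v).

Definition exchanging_reflection (R : realType) (n : nat) (kappa : R)
    (u v : 'rV[R]_n) (r : 'rV[R]_n -> 'rV[R]_n) : Prop :=
  [/\ reflection kappa r, r u = v & r v = u].

Definition even_polyhedron (R : realType) (n : nat) (kappa : R)
    (C : set 'rV[R]_n) : Prop :=
  forall u v, edge kappa C u v ->
  exists2 r, unique (exchanging_reflection kappa u v) r &
             r @` C = C /\ forall p, vertex kappa C p -> r p <> p.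

Section CoxeterSystems.
Local Open Scope group_scope.

(* (W, S) is a Coxeter system: S consists of involutions and W has the
   presentation < S | (s t)^m(s, t) >, m(s, t) being the order of s t in W.
   The presentation is expressed by its universal property among all groups,
   finite or not. *)
Definition coxeter_system (W : finGroupType) (S : {set W}) : Prop :=
  [/\ forall s, s \in S -> #[s] = 2%N,
      <<S>> = [set: W]%SET &
      forall (G : groupType) (f : W -> G),
        (forall s t, s \in S -> t \in S -> (f s * f t) ^+ #[s * t] = 1) ->
        exists2 phi : W -> G, {morph phi : g h / g * h} &
                              forall s, s \in S -> phi s = f s].

Definition cayley_adj (W : finGroupType) (S : {set W}) (g h : W) : Prop :=
  exists2 s, s \in S & h = g * s \/ g = h * s.

(* rho is an injective representation of W into the group of isometries of
   X_kappa fixing x, sending each element of S to a reflection. *)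
Definition reflection_representation (R : realType) (n : nat) (kappa : R)
    (x : 'rV[R]_n) (W : finGroupType) (S : {set W})
    (rho : W -> 'rV[R]_n -> 'rV[R]_n) : Prop :=
  [/\ forall g, isometry kappa (rho g) /\ rho g x = x,
      forall g h, rho (g * h) = rho g \o rho h,
      injective rho &
      forall s, s \in S -> reflection kappa (rho s)].

End CoxeterSystems.

Definition wall (R : realType) (n : nat) (kappa : R) (W : finGroupType)
    (rho : W -> 'rV[R]_n -> 'rV[R]_n) (H : set 'rV[R]_n) : Prop :=
  exists2 g, reflection kappa (rho g) & H = [set p | rho g p = p].

Definition off_walls (R : realType) (n : nat) (kappa : R) (W : finGroupType)
    (rho : W -> 'rV[R]_n -> 'rV[R]_n) : set 'rV[R]_n :=
  ~` \bigcup_(H in wall kappa rho) H.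

Definition chamber (R : realType) (n : nat) (kappa : R) (W : finGroupType)
    (rho : W -> 'rV[R]_n -> 'rV[R]_n) (D : set 'rV[R]_n) : Prop :=
  exists2 p, off_walls kappa rho p &
             D = closure (connected_component (off_walls kappa rho) p).

Definition coxeter_orbit_hull (R : realType) (n : nat) (kappa : R)
    (C : set 'rV[R]_n) (x : 'rV[R]_n) (W : finGroupType) (S : {set W})
    (rho : W -> 'rV[R]_n -> 'rV[R]_n) (y : 'rV[R]_n) : Prop :=
  [/\ coxeter_system S,
      reflection_representation kappa x S rho,
      exists2 D, chamber kappa rho D & (D°)%classic y &
      C = convex_hull kappa (range (fun g => rho g y))].

(* Isomorphism of the simple graphs with vertex sets A, B and adjacency
   relations e, e'. *)
Definition graph_isomorphic (U V : Type) (A : set U) (e : U -> U -> Prop)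
    (B : set V) (e' : V -> V -> Prop) : Prop :=
  exists2 f : U -> V, set_bij A B f &
    forall p q, A p -> A q -> (e p q <-> e' (f p) (f q)).

(* Main.v *)
Require Import Defs.
From HB Require Import structures.
From mathcomp Require Import all_boot all_order all_algebra all_fingroup.
From mathcomp Require Import all_solvable.
From mathcomp Require Import all_classical all_reals all_analysis.
From mathcomp Require Import ring lra.
Import Defs.

(** Write the points of the space of curvature kappa as vectors of a sheet in
R ^ (1 + n). Geodesic segments are then the traces of two-dimensional cones
([segment_sheet]), half-spaces are defined by linear forms, and reflections are
restrictions of linear reflections ([reflection_hrefl]). A finite group W of
isometries generated by reflections acts linearly on the ambient space and, for
an averaged scalar product g, orthogonally; averaging also gives an invariant
linear form tau that is positive on the sheet ([representation_action]). An
orbit of W thus lies on a sphere in an affine hyperplane. What remains is the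
theory of finite reflection groups in a Euclidean space and that of polytopes.

Let C be the hull of the W-orbit of y. A Coxeter generating set S of
reflections need not consist of the reflections in the walls of a chamber: in a
dihedral group of order ten, two generators may have mirrors at angle
2 pi / 5. But an automorphism of W maps S to such a set ([reflection_rigidity]),
and it induces an isomorphism of Cayley graphs, so S may be assumed to come from
a simple system of roots r s. A point in the interior of a chamber lies on no
wall ([chamber_interior_off]), and some point of its orbit is in the chamber of
S ([dominant_orbit]); call it y again. Then y - w y is a nonnegative
combination of the r s for every w, and is 0 only for w = 1 ([dominant_cone],
[dominant_free]). Comparing linear forms on the orbit, one finds that its points
are the vertices of C ([orbit_vertex], [vertex_orbit]) and that the edges join
w y to w s y with s in S ([orbit_edge], [edge_orbit]): the 1-skeleton is the
Cayley graph. The reflection w s w^-1 exchanges the two ends of such an edge,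
and fixes no vertex because W acts freely on the orbit; so C is even.

The rigidity theorem is proved by changing S one element at a time. Only pairs
whose product has order at least five can have the wrong angle. The Tits form
of a finite Coxeter system is positive definite ([tits_positive]), which limits
the diagram around such a pair to a component of rank two, H3 or H4
([heavy_neighbour], [heavy_isolated], [heavy_chain]). In rank two the reflection
nearest to the other generator is taken instead ([dihedral_adapted]); in H3 and
H4 the end of the heavy edge is replaced by an explicit element of the group,
whose root is a Galois conjugate ([h3_root], [h4_root]). Once all angles are
right, the diagram being a forest, the roots can be signed so that they form
obtuse angles, and an induction on length gives a simple system
([adapted_simple]).

Conversely let C be even. A composite of reflections in edges permutes the
vertices and is determined by this permutation ([motion_uniq]), so these
reflections generate a finite group W ([finite_motions]); it fixes the projection
of the sum of the vertices. No reflection in an edge, hence none of its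
conjugates, fixes a vertex v0. Therefore the roots of these conjugates that are
positive at v0 contain a simple system ([base_simple]); its reflections form a
Coxeter system ([simple_coxeter]), the conjugates are all the reflections of W
([reflection_mem]), and v0 is in the interior of a chamber. By the simplex method
([improving_edge]) a linear form that is maximal at a vertex among its neighbours
is maximal on C. Applied to the products with two vertices that are as close as W
permits, this shows that W is transitive on vertices ([vert_transitive]). So C,
the hull of its vertices ([polytope_ind]), is the hull of the orbit of v0. *)

Set Implicit Arguments.
Unset Strict Implicit.
Unset Printing Implicit Defensive.

Import Order.TTheory GRing.Theory Num.Theory.
Import numFieldNormedType.Exports.

Local Open Scope classical_set_scope.
Local Open Scope ring_scope.

(** * Orthogonal reflections in a group of isometries *)

Definition inner_product (R : realType) (E : lmodType R) (g : E -> E -> R) :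
    Prop :=
  [/\ forall x y, g x y = g y x,
      forall a x y z, g (a *: x + y) z = a * g x z + g y z &
      forall x, x != 0 -> 0 < g x x].

Definition orthogonal_action (R : realType) (E : lmodType R)
    (g : E -> E -> R) (W : finGroupType) (act : W -> E -> E) : Prop :=
  [/\ forall w a x y, act w (a *: x + y) = a *: act w x + act w y,
      forall v w x, act (v * w)%g x = act v (act w x),
      forall w x y, g (act w x) (act w y) = g x y &
      forall w, (forall x, act w x = x) -> w = 1%g].

Definition refl (R : realType) (E : lmodType R) (g : E -> E -> R)
    (a x : E) : E := x - (2 * g x a) *: a.

Definition reflects (R : realType) (E : lmodType R) (g : E -> E -> R)
    (W : finGroupType) (act : W -> E -> E) (t : W) (a : E) : Prop :=
  g a a = 1 /\ forall x, act t x = refl g a x.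

Definition cone (R : realType) (E : lmodType R) (W : finGroupType)
    (S : {set W}) (r : W -> E) (x : E) : Prop :=
  exists2 c : W -> R, (forall s, s \in S -> 0 <= c s) &
                      x = \sum_(s in S) c s *: r s.

Section InnerProduct.
Variables (R : realType) (E : lmodType R) (g : E -> E -> R).
Hypothesis gP : inner_product g.

Lemma ipC x y : g x y = g y x. Proof. by case: gP. Qed.
Lemma ipDl x y z : g (x + y) z = g x z + g y z.
Proof. by case: gP => _ L _; have := L 1 x y z; rewrite scale1r mul1r. Qed.
Lemma ip0l z : g 0 z = 0.
Proof. by have := ipDl 0 0 z; rewrite addr0; lra. Qed.
Lemma ipZl a x z : g (a *: x) z = a * g x z.
Proof. by case: gP => _ L _; have := L a x 0 z; rewrite addr0 ip0l addr0. Qed.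
Lemma ipNl x z : g (- x) z = - g x z.
Proof. by rewrite -scaleN1r ipZl mulN1r. Qed.
Lemma ipBl x y z : g (x - y) z = g x z - g y z.
Proof. by rewrite ipDl ipNl. Qed.
Lemma ipDr x y z : g x (y + z) = g x y + g x z.
Proof. by rewrite ipC ipDl !(ipC x). Qed.
Lemma ip0r z : g z 0 = 0. Proof. by rewrite ipC ip0l. Qed.
Lemma ipZr a x z : g x (a *: z) = a * g x z.
Proof. by rewrite ipC ipZl (ipC x). Qed.
Lemma ipNr x z : g x (- z) = - g x z.
Proof. by rewrite ipC ipNl (ipC x). Qed.
Lemma ipBr x y z : g x (y - z) = g x y - g x z.
Proof. by rewrite ipDr ipNr. Qed.
Lemma ip_suml (I : finType) (P : pred I) (F : I -> E) z :
  g (\sum_(i | P i) F i) z = \sum_(i | P i) g (F i) z.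
Proof. by elim/big_rec2: _ => [|i x y _ <-]; rewrite ?ip0l // ipDl. Qed.
Lemma ip_sumr (I : finType) (P : pred I) (F : I -> E) z :
  g z (\sum_(i | P i) F i) = \sum_(i | P i) g z (F i).
Proof. by rewrite ipC ip_suml; apply: eq_bigr => i _; rewrite ipC. Qed.
Lemma ip_ge0 x : 0 <= g x x.
Proof.
have [->|x0] := eqVneq x 0; first by rewrite ip0l.
by case: gP => _ _ p; apply/ltW/p.
Qed.
Lemma ip_eq0 x : g x x = 0 -> x = 0.
Proof.
move=> h; apply/eqP/negPn/negP => x0.
by case: gP => _ _ /(_ x x0); rewrite h ltxx.
Qed.

Definition ipE := (ipDl, ipDr, ipNl, ipNr, ipZl, ipZr, ip0l, ip0r).

Lemma reflK a : g a a = 1 -> involutive (refl g a).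
Proof.
move=> a1 x; rewrite /refl ipBl ipZl a1 mulr1 -addrA -opprD -scalerDl.
rewrite [X in X *: a](_ : _ = 0) ?scale0r ?subr0 //; ring.
Qed.

Lemma refl_opp a x : refl g (- a) x = refl g a x.
Proof. by rewrite /refl !ipE mulrN scaleNr scalerN opprK. Qed.

Lemma refl_id a : g a a = 1 -> refl g a a = - a.
Proof.
move=> a1; rewrite /refl a1 mulr1 scaler_nat mulr2n opprD addrA subrr.
by rewrite add0r.
Qed.

Lemma refl_inj a b : g a a = 1 -> g b b = 1 ->
  (forall x, refl g a x = refl g b x) -> a = b \/ a = - b.
Proof.
move=> a1 b1 /(_ a); rewrite refl_id // /refl => h.
have ab : a = g a b *: b.
  have : 2 *: a = (2 * g a b) *: b.
    apply/eqP; rewrite scaler_nat mulr2n -subr_eq0 -addrA -h subrr.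
    exact: eqxx.
  have two0 : (2 : R) != 0 by rewrite pnatr_eq0.
  by rewrite -scalerA; move/(scalerI two0).
have : (g a b - 1) * (g a b + 1) = 0.
  have : g a a = g a b * g a b by rewrite {1}ab ipZl ipC.
  by rewrite a1; nra.
move/eqP; rewrite mulf_eq0 => /orP[]/eqP h1; [left|right].
  by rewrite ab (_ : g a b = 1) ?scale1r //; lra.
by rewrite ab (_ : g a b = - 1) ?scaleN1r //; lra.
Qed.

Lemma cauchy_schwarz a b : g a b ^+ 2 <= g a a * g b b.
Proof.
have [->|b0] := eqVneq b 0; first by rewrite !ipE expr0n mulr0.
have bb : 0 < g b b by case: gP => _ _; apply.
have := ip_ge0 (g b b *: a - g a b *: b).
rewrite !ipE (ipC b a) => h.
have : 0 <= g b b * (g a a * g b b - g a b ^+ 2) by move: h; rewrite expr2; nra.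
by rewrite pmulr_rge0 // subr_ge0.
Qed.

Lemma cauchy_schwarz_lt a b : g a a = 1 -> g b b = 1 -> a <> b -> a <> - b ->
  g a b ^+ 2 < 1.
Proof.
move=> a1 b1 nab nab'; have := cauchy_schwarz a b; rewrite a1 b1 mulr1.
rewrite le_eqVlt => /orP[/eqP h|//]; exfalso.
have /eqP : (g a b - 1) * (g a b + 1) = 0 by rewrite expr2 in h; lra.
rewrite mulf_eq0 => /orP[]/eqP k.
  apply: nab; apply/eqP; rewrite -subr_eq0; apply/eqP/ip_eq0.
  by rewrite !ipE a1 b1 (ipC b a); lra.
apply: nab'; apply/eqP; rewrite -subr_eq0 opprK; apply/eqP/ip_eq0.
by rewrite !ipE a1 b1 (ipC b a); lra.
Qed.

End InnerProduct.

Section Cone.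
Variables (R : realType) (E : lmodType R) (W : finGroupType).
Variables (S : {set W}) (r : W -> E).

Lemma cone0 : cone S r 0.
Proof. by exists (fun=> 0) => //; rewrite big1 // => i _; rewrite scale0r. Qed.

Lemma coneD x y : cone S r x -> cone S r y -> cone S r (x + y).
Proof.
case=> c c0 -> [d d0 ->]; exists (fun s => c s + d s).
  by move=> s sS; rewrite addr_ge0 ?c0 ?d0.
by rewrite -big_split; apply: eq_bigr => s _; rewrite scalerDl.
Qed.

Lemma coneZ k x : 0 <= k -> cone S r x -> cone S r (k *: x).
Proof.
move=> k0 [c c0 ->]; exists (fun s => k * c s).
  by move=> s sS; rewrite mulr_ge0 ?c0.
by rewrite scaler_sumr; apply: eq_bigr => s _; rewrite scalerA.
Qed.

Lemma cone_gen s : s \in S -> cone S r (r s).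
Proof.
move=> sS; exists (fun t => (t == s)%:R); first by move=> t _; rewrite ler0n.
rewrite (bigD1 s) //= eqxx scale1r big1 ?addr0 // => t /andP[_ /negPf ->].
by rewrite scale0r.
Qed.

Lemma cone_sum (I : finType) (P : pred I) (F : I -> E) :
  (forall i, P i -> cone S r (F i)) -> cone S r (\sum_(i | P i) F i).
Proof. by move=> h; elim/big_ind: _ => //; [exact: cone0 | exact: coneD]. Qed.

End Cone.

Lemma cone_trans (R : realType) (E : lmodType R) (W : finGroupType)
    (S S' : {set W}) (r : W -> E) x :
  (forall s, s \in S -> cone S' r (r s)) -> cone S r x -> cone S' r x.
Proof.
move=> h [c c0 ->]; apply: cone_sum => s sS.
by apply: coneZ; [exact: c0 | exact: h].
Qed.

Section Action.
Variables (R : realType) (E : lmodType R) (g : E -> E -> R).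
Variables (W : finGroupType) (act : W -> E -> E).
Hypotheses (gP : inner_product g) (actP : orthogonal_action g act).

Lemma act_lin w a x y : act w (a *: x + y) = a *: act w x + act w y.
Proof. by case: actP. Qed.
Lemma actMl v w x : act (v * w)%g x = act v (act w x).
Proof. by case: actP. Qed.
Lemma act_ip w x y : g (act w x) (act w y) = g x y.
Proof. by case: actP. Qed.
Lemma act_faithful v w : (forall x, act v x = act w x) -> v = w.
Proof.
move=> h; apply/eqP; rewrite -(inj_eq (mulgI (v^-1)%g)) mulVg eq_sym; apply/eqP.
have act_inj u x y : act u x = act u y -> x = y.
  move=> e; apply/eqP; rewrite -subr_eq0; apply/eqP/(ip_eq0 gP).
  rewrite -(act_ip u).
  have -> : act u (x - y) = 0.
    have := act_lin u (-1) y x; rewrite !scaleN1r addrC => ->.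
    by rewrite e addrC subrr.
  by rewrite (ip0l gP).
case: (actP) => _ _ _; apply => x.
apply: (@act_inj v); rewrite -actMl mulgA mulgV mul1g.
by rewrite h.
Qed.
Lemma act1l x : act 1%g x = x.
Proof.
apply/eqP; rewrite -subr_eq0; apply/eqP/(ip_eq0 gP).
rewrite -(act_ip 1%g).
have -> : act 1%g (act 1%g x - x) = 0.
  have := act_lin 1%g (-1) x (act 1%g x); rewrite !scaleN1r addrC => ->.
  by rewrite -actMl mulg1 addrC subrr.
by rewrite (ip0l gP).
Qed.
Lemma actD w x y : act w (x + y) = act w x + act w y.
Proof. by have := act_lin w 1 x y; rewrite !scale1r. Qed.
Lemma act0 w : act w 0 = 0.
Proof.
by apply: (addrI (act w 0)); rewrite -actD !addr0.
Qed.
Lemma actZ w a x : act w (a *: x) = a *: act w x.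
Proof. by have := act_lin w a x 0; rewrite act0 !addr0. Qed.
Lemma actN w x : act w (- x) = - act w x.
Proof. by rewrite -scaleN1r actZ scaleN1r. Qed.
Lemma actB w x y : act w (x - y) = act w x - act w y.
Proof. by rewrite actD actN. Qed.
Lemma act_sum w (I : finType) (P : pred I) (F : I -> E) :
  act w (\sum_(i | P i) F i) = \sum_(i | P i) act w (F i).
Proof. by elim/big_rec2: _ => [|i x y _ <-]; rewrite ?act0 // actD. Qed.
Lemma actK w x : act w^-1%g (act w x) = x.
Proof. by rewrite -actMl mulVg act1l. Qed.
Lemma actKV w x : act w (act w^-1%g x) = x.
Proof. by rewrite -actMl mulgV act1l. Qed.

Lemma reflects_conj w t a : reflects g act t a ->
  reflects g act (w * t * w^-1)%g (act w a).
Proof.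
case=> a1 ta; split=> [|x]; first by rewrite act_ip.
rewrite !actMl ta /refl actB actKV actZ; congr (_ - (_ * _) *: _).
by rewrite -[LHS](act_ip w) actKV.
Qed.

Lemma reflects_uniq t u a : reflects g act t a -> reflects g act u a -> t = u.
Proof.
by case=> _ ta [_ ua]; apply: act_faithful => x; rewrite ta ua.
Qed.

Lemma reflectsN t a : reflects g act t a -> reflects g act t (- a).
Proof.
case=> a1 ta; split=> [|x]; first by rewrite !(ipE gP) opprK.
by rewrite (refl_opp gP).
Qed.

Lemma reflects_root t a b : reflects g act t a -> reflects g act t b ->
  a = b \/ a = - b.
Proof.
by case=> a1 ta [b1 tb]; apply: (refl_inj gP) => // x; rewrite -ta -tb.
Qed.

Lemma reflectsK t a : reflects g act t a -> (t * t)%g = 1%g.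
Proof.
case=> a1 ta; apply: act_faithful => x.
by rewrite act1l actMl !ta reflK.
Qed.

Lemma reflectsV t a : reflects g act t a -> t^-1%g = t.
Proof. by move/reflectsK => h; apply/eqP; rewrite eq_invg_mul h. Qed.

Lemma reflects_self t a : reflects g act t a -> act t a = - a.
Proof. by case=> a1 ->; rewrite refl_id. Qed.

Lemma unit_neq_opp a : g a a = 1 -> a <> - a.
Proof.
move=> a1 h; have : g a a = - g a a by rewrite {1}h (ipNl gP).
by rewrite a1; lra.
Qed.

Lemma reflects_neq1 t a : reflects g act t a -> t <> 1%g.
Proof.
move=> ta t1; have := reflects_self ta; rewrite t1 act1l.
by apply: unit_neq_opp; case: ta.
Qed.

Lemma reflects_order t a : reflects g act t a -> #[t]%g = 2%N.
Proof.
move=> ta; have : (#[t]%g %| 2)%N.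
  by rewrite order_dvdn expgS expg1 (reflectsK ta).
rewrite dvdn_divisors // !inE => /orP[|/eqP //].
by rewrite order_eq1 => /eqP /(reflects_neq1 ta).
Qed.

Lemma reflects_neq t u a b : reflects g act t a -> reflects g act u b ->
  t != u -> g a b ^+ 2 < 1.
Proof.
move=> ta ub /eqP tu; apply: (cauchy_schwarz_lt gP).
- by case: ta.
- by case: ub.
- by move=> ab; apply: tu; apply: (reflects_uniq ta); rewrite ab.
- by move=> ab; apply: tu; apply: (reflects_uniq ta); rewrite ab; apply: reflectsN.
Qed.

Lemma reflects_free t u a b p q : reflects g act t a -> reflects g act u b ->
  t != u -> p *: a + q *: b = 0 -> p = 0 /\ q = 0.
Proof.
move=> ta ub tu h; have c1 := reflects_neq ta ub tu.
case: (ta) => a1 _; case: (ub) => b1 _.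
have h1 : p + q * g a b = 0.
  by have := ip0l gP a; rewrite -h !(ipE gP) a1 (ipC gP b); lra.
have h2 : p * g a b + q = 0.
  by have := ip0l gP b; rewrite -h !(ipE gP) b1; lra.
have q0 : q = 0.
  have : q * (1 - g a b ^+ 2) = 0 by rewrite expr2; nra.
  by move/eqP; rewrite mulf_eq0 => /orP[/eqP //|/eqP]; lra.
by split=> //; move: h1; rewrite q0 mul0r addr0.
Qed.

End Action.

Definition word_in (W : finGroupType) (A : {set W}) (w : seq W) : bool :=
  all (fun s => s \in A) w.

Definition wprod (W : finGroupType) (w : seq W) : W := (\prod_(s <- w) s)%g.

Lemma wprod_cat (W : finGroupType) (u v : seq W) :
  wprod (u ++ v) = (wprod u * wprod v)%g.
Proof. by rewrite /wprod big_cat. Qed.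
Lemma wprod_cons (W : finGroupType) s (v : seq W) :
  wprod (s :: v) = (s * wprod v)%g.
Proof. by rewrite /wprod big_cons. Qed.
Lemma wprod_rcons (W : finGroupType) s (v : seq W) :
  wprod (rcons v s) = (wprod v * s)%g.
Proof. by rewrite -cats1 wprod_cat /wprod big_seq1. Qed.
Lemma wprod0 (W : finGroupType) : wprod [::] = 1%g :> W.
Proof. by rewrite /wprod big_nil. Qed.

Lemma gen_word (W : finGroupType) (A : {set W}) w :
  w \in <<A>>%g -> exists2 v, word_in A v & wprod v = w.
Proof.
case/gen_prodgP => n [c cA ->]; exists [seq c i | i <- index_enum 'I_n].
  by rewrite /word_in all_map; apply/allP => i _ /=; apply: cA.
by rewrite /wprod big_map.
Qed.

Lemma word_gen (W : finGroupType) (A : {set W}) v :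
  word_in A v -> wprod v \in <<A>>%g.
Proof.
elim: v => [|s v IH]; first by rewrite wprod0 group1.
by case/andP => sA /IH h; rewrite wprod_cons groupM // mem_gen.
Qed.

(** A product of two involutions never generates one of them: they would
commute, so that their product would have order two. *)
Lemma rotation_neq (W : finGroupType) (s t : W) p :
  (s * s)%g = 1%g -> (t * t)%g = 1%g -> s <> 1%g -> t <> 1%g ->
  ((s * t) ^+ p)%g <> s.
Proof.
move=> ss tt s1 t1 h.
have cst : commute s (s * t)%g.
  by rewrite -{1}h; apply/commute_sym/commuteX/commute_refl.
have ct : (t * s = s * t)%g.
  by have := cst; rewrite /commute mulgA ss mul1g => {1}->; rewrite -!mulgA ss mulg1.
have st2 : ((s * t) ^+ 2 = 1)%g.
  by rewrite expgS expg1 -{1}ct mulgA -[(t * s * s)%g]mulgA ss mulg1 tt.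
have : ((s * t) ^+ p = 1 \/ (s * t) ^+ p = s * t)%g.
  elim: p {h} => [|p [] IH]; first by left; rewrite expg0.
    by right; rewrite expgSr IH mul1g.
  by left; rewrite expgSr IH.
case=> hp; rewrite hp in h; first by apply: s1.
by apply: t1; apply: (mulgI s); rewrite h mulg1.
Qed.

Lemma dihedral_card (W : finGroupType) (s t : W) :
  (s * s)%g = 1%g -> (t * t)%g = 1%g -> s <> 1%g -> t <> 1%g ->
  #|<<[set s; t]%SET>>%g| = (#[s * t]%g * 2)%N.
Proof.
move=> ss tt s1 t1.
have os : #[s]%g = 2%N.
  have : (#[s]%g %| 2)%N by rewrite order_dvdn expgS expg1 ss.
  rewrite dvdn_divisors // !in_cons in_nil orbF => /orP[|/eqP //].
  by rewrite order_eq1 => /eqP /s1.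
have -> : <<[set s; t]%SET>>%g = (<[s * t]> * <[s]>)%g.
  rewrite -norm_joinEr; last first.
    rewrite cycle_subG; apply/normP; rewrite -cycleJ.
    have sV : (s^-1 = s)%g by apply/eqP; rewrite eq_invg_mul ss.
    have tV : (t^-1 = t)%g by apply/eqP; rewrite eq_invg_mul tt.
    have -> : ((s * t) ^ s = (s * t)^-1)%g.
      by rewrite /conjg invMg sV tV !mulgA ss mul1g.
    by rewrite cycleV.
  apply/eqP; rewrite finset.eqEsubset; apply/andP; split; last first.
    by rewrite join_subG !cycle_subG groupM ?mem_gen ?set21 ?set22.
  rewrite gen_subG.
  have sG : s \in (<[s * t]> <*> <[s]>)%g.
    by apply: (fintype.subsetP (joing_subr _ _)); apply: cycle_id.
  apply/fintype.subsetP => u; rewrite in_set2 => /orP[]/eqP -> //.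
  have e : (s * (s * t))%g = t by rewrite mulgA ss mul1g.
  rewrite -{1}e.
  by apply: groupM sG _; apply: (fintype.subsetP (joing_subl _ _) _ (cycle_id _)).
rewrite TI_cardMg; first by rewrite -[#|<[s]>%g|]/(#[s]%g) os.
apply/trivgP/fintype.subsetP => u; rewrite finset.in_setI => /andP[/cycleP [p ->]].
move=> /cycleP [k e]; rewrite e; apply/set1gP.
have sk j : (s ^+ j = 1 \/ s ^+ j = s)%g.
  elim: j => [|j [] IH]; first by left; rewrite expg0.
    by right; rewrite expgSr IH mul1g.
  by left; rewrite expgSr IH.
case: (sk k) => // sk1; exfalso.
by apply: (@rotation_neq W s t p) => //; rewrite e.
Qed.

(** * Simple systems *)

(** The reflections S in the walls of a chamber, with inner normals r; the point
z lies inside the chamber. The roots need not be linearly independent: the last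
field only asks that none of them is redundant in the cone that they span. *)
Record simple_system (R : realType) (E : lmodType R) (g : E -> E -> R)
    (W : finGroupType) (act : W -> E -> E) (S : {set W}) (r : W -> E) (z : E) :
    Prop := SimpleSystem {
  simple_refl : forall s, s \in S -> reflects g act s (r s);
  simple_gen : forall w, w \in <<S>>%g;
  simple_root : forall w s, s \in S ->
    cone S r (act w (r s)) \/ cone S r (- act w (r s));
  simple_pos : forall s, s \in S -> 0 < g z (r s);
  simple_free : forall s, s \in S -> ~ cone (S :\ s)%SET r (r s) }.

Section PositiveCone.
Variables (R : realType) (E : lmodType R) (g : E -> E -> R) (W : finGroupType).
Hypothesis gP : inner_product g.
Variables (r : W -> E) (z : E).

Lemma cone_ge0 (A : {set W}) y x : (forall s, s \in A -> 0 <= g y (r s)) ->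
  cone A r x -> 0 <= g y x.
Proof.
move=> yA [c c0 ->]; rewrite (ip_sumr gP); apply: sumr_ge0 => s sA.
by rewrite (ipZr gP) mulr_ge0 ?c0 ?yA.
Qed.

Lemma cone_eq0 (A : {set W}) (c : W -> R) :
  (forall s, s \in A -> 0 < g z (r s)) -> (forall s, s \in A -> 0 <= c s) ->
  g z (\sum_(s in A) c s *: r s) <= 0 -> forall s, s \in A -> c s = 0.
Proof.
move=> zr c0; rewrite (ip_sumr gP) => h s sA.
have F0 t : t \in A -> 0 <= g z (c t *: r t).
  by move=> tA; rewrite (ipZr gP); apply: mulr_ge0; [exact: c0 | exact/ltW/zr].
have /eqP : \sum_(t in A) g z (c t *: r t) = 0.
  by apply/eqP; rewrite eq_le h sumr_ge0.
rewrite psumr_eq0 // => /allP /(_ s (mem_index_enum _)); rewrite sA /=.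
rewrite (ipZr gP) mulf_eq0 => /orP[/eqP //|].
by have := zr s sA => /lt0r_neq0 /negPf ->.
Qed.

Lemma cone_excl (A : {set W}) s k (c : W -> R) : ~ cone (A :\ s)%SET r (r s) ->
  (forall u, u \in (A :\ s)%SET -> 0 <= c u) ->
  k *: r s = \sum_(u in (A :\ s)%SET) c u *: r u -> k <= 0.
Proof.
move=> free c0 h; rewrite leNgt; apply/negP => k0; apply: free.
exists (fun u => k^-1 * c u) => [u uS|].
  by rewrite mulr_ge0 ?c0 // invr_ge0 ltW.
have := congr1 (fun x => k^-1 *: x) h; rewrite scalerA mulVf ?gt_eqF // scale1r => ->.
by rewrite scaler_sumr; apply: eq_bigr => u _; rewrite scalerA.
Qed.

(** A positive combination that becomes negative by subtracting a multiple of
r s involves no other generator, since this subtraction cannot cancel their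
coefficients. *)
Lemma cone_cancel (A : {set W}) s x k : (forall u, u \in A -> 0 < g z (r u)) ->
  s \in A -> ~ cone (A :\ s)%SET r (r s) -> g (r s) (r s) = 1 -> g x x = 1 ->
  cone A r x -> cone A r (k *: r s - x) -> x = r s.
Proof.
move=> zr sA free s1 x1 [c c0 e] [d d0 e'].
have e2 : (k - c s - d s) *: r s = \sum_(v in (A :\ s)%SET) (c v + d v) *: r v.
  have e3 : k *: r s = \sum_(v in A) (c v + d v) *: r v.
    under eq_bigr do rewrite scalerDl.
    by rewrite big_split /= -e -e' addrC subrK.
  rewrite (big_setD1 s) //= in e3.
  by apply/eqP; rewrite -addrA -opprD scalerBl e3 subr_eq addrC.
have cd v : v \in (A :\ s)%SET -> 0 <= c v + d v.
  by rewrite in_setD1 => /andP[_ vA]; rewrite addr_ge0 ?c0 ?d0.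
have cd0 v : v \in (A :\ s)%SET -> c v + d v = 0.
  apply: (@cone_eq0 _ (fun v => c v + d v)) => // [u|].
    by rewrite in_setD1 => /andP[_ /zr].
  by rewrite -e2 (ipZr gP); apply: mulr_le0_ge0; [exact: cone_excl e2 | exact/ltW/zr].
have xE : x = c s *: r s.
  rewrite e (big_setD1 s) //= big1 ?addr0 // => v vA.
  have := vA; rewrite in_setD1 => /andP[_ vA'].
  have -> : c v = 0 by have := cd0 v vA; have := c0 v vA'; have := d0 v vA'; lra.
  by rewrite scale0r.
have cc : c s * c s = 1 by rewrite -x1 xE (ipZl gP) (ipZr gP) s1 mulr1.
rewrite xE (_ : c s = 1) ?scale1r //; have := c0 s sA => cs0.
have : (c s - 1) * (c s + 1) = 0 by nra.
by move/eqP; rewrite mulf_eq0 => /orP[]/eqP; lra.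
Qed.

End PositiveCone.

Section SimpleSystem.
Variables (R : realType) (E : lmodType R) (g : E -> E -> R).
Variables (W : finGroupType) (act : W -> E -> E).
Hypotheses (gP : inner_product g) (actP : orthogonal_action g act).
Variables (S : {set W}) (r : W -> E) (z : E).
Hypothesis Sz : simple_system g act S r z.

Let rS s : s \in S -> reflects g act s (r s). Proof. exact: (simple_refl Sz). Qed.
Let r1 s : s \in S -> g (r s) (r s) = 1. Proof. by case/rS. Qed.
Let zr s : s \in S -> 0 < g z (r s). Proof. exact: (simple_pos Sz). Qed.

Lemma root_neq0 w s : s \in S -> act w (r s) <> 0.
Proof.
move=> sS h; have := r1 sS; rewrite -(act_ip actP w) h (ip0l gP) => /eqP.
by rewrite eq_sym oner_eq0.
Qed.

Lemma root_signP w s : s \in S ->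
  0 < g z (act w (r s)) /\ cone S r (act w (r s)) \/
  g z (act w (r s)) < 0 /\ cone S r (- act w (r s)).
Proof.
move=> sS; have zS u : u \in S -> 0 <= g z (r u) by move/zr/ltW.
have nz : g z (act w (r s)) != 0.
  apply/negP => /eqP z0; apply: (@root_neq0 w s sS).
  case: (simple_root Sz w sS) => -[c c0 e].
    rewrite e; rewrite e in z0; apply: big1 => u uS.
    by rewrite (cone_eq0 gP zr c0) ?scale0r // z0.
  apply/eqP; rewrite -oppr_eq0; apply/eqP.
  have z1 : g z (- act w (r s)) = 0 by rewrite (ipNr gP) z0 oppr0.
  rewrite e; rewrite e in z1; apply: big1 => u uS.
  by rewrite (cone_eq0 gP zr c0) ?scale0r // z1.
case: (simple_root Sz w sS) => h; [left|right]; split=> //.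
  by rewrite lt0r nz (cone_ge0 gP zS).
by rewrite lt_neqAle nz -oppr_ge0 -(ipNr gP) (cone_ge0 gP zS).
Qed.

Lemma root_sign w s : s \in S -> g z (act w (r s)) < 0 \/ 0 < g z (act w (r s)).
Proof. by move=> sS; case: (root_signP w sS) => -[? _]; [right|left]. Qed.

Lemma root_cone w s : s \in S -> 0 < g z (act w (r s)) ->
  cone S r (act w (r s)).
Proof.
by move=> sS h; case: (root_signP w sS) => -[h1 //]; move: (lt_trans h h1);
  rewrite ltxx.
Qed.

(** A simple reflection makes only its own root negative. *)
Lemma simple_perm w s u : s \in S -> u \in S ->
  0 < g z (act w (r u)) -> g z (act (s * w)%g (r u)) < 0 -> act w (r u) = r s.
Proof.
move=> sS uS h1 h2; apply: (cone_cancel gP zr sS (simple_free Sz sS) (r1 sS)).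
- by rewrite (act_ip actP) r1.
- exact: root_cone.
have [_ sx] := rS sS; instantiate (1 := 2 * g (act w (r u)) (r s)).
have : cone S r (- act (s * w)%g (r u)).
  by case: (root_signP (s * w)%g uS) => -[h3 //]; move: (lt_trans h2 h3); rewrite ltxx.
by rewrite (actMl actP) sx /refl opprB.
Qed.

(** The exchange condition: along the word v, the letter u at which the root of s
changes sign has s as a conjugate, and can be deleted together with s. *)
Lemma exchange v s : word_in S v -> s \in S ->
  g z (act (wprod v) (r s)) < 0 ->
  exists v1 u v2, v = v1 ++ u :: v2 /\ (wprod v * s)%g = wprod (v1 ++ v2).
Proof.
move=> + sS; elim: v => [_|u v IH /= /andP[uS vS]].
  by rewrite wprod0 (act1l gP actP) => h; have := lt_trans h (zr sS); rewrite ltxx.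
rewrite wprod_cons => h.
case: (root_sign (wprod v) sS) => h1.
  have [v1 [u' [v2 [-> e]]]] := IH vS h1.
  exists (u :: v1), u', v2; split=> //=.
  by rewrite wprod_cons -mulgA e.
have e := simple_perm uS sS h1 h.
exists [::], u, v; split=> //=.
have /(reflects_uniq gP actP (rS uS)) -> : reflects g act (wprod v * s * (wprod v)^-1)%g (r u).
  by rewrite -e; apply: reflects_conj => //; apply: rS.
by rewrite mulgKV -mulgA (reflectsK gP actP (rS sS)) mulg1.
Qed.

(** The elements that have a word in A all of whose letters increase the length:
the induction principle for all statements on group elements below. *)
Inductive ascent (A : {set W}) : W -> Prop :=
| ascent1 : ascent A 1%g
| ascentM w s : ascent A w -> s \in A -> 0 < g z (act w (r s)) ->
    ascent A (w * s)%g.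

(** A letter that does not increase the length can be cancelled by exchange. *)
Lemma ascent_word (A : {set W}) v : A \subset S -> word_in A v ->
  ascent A (wprod v).
Proof.
move=> AS vA.
suff [v' [vA' <- _]] : exists v', [/\ word_in A v', wprod v' = wprod v,
    (size v' <= size v)%N & ascent A (wprod v')] by [].
have [k] := ubnP (size v); elim: k v vA => // k IH v.
case/lastP: v => [_ _|v s].
  by exists [::]; split=> //; rewrite wprod0; constructor.
rewrite /word_in all_rcons size_rcons ltnS => /andP[sA vA] vk.
have [v' [vA' e vv' asc]] := IH v vA vk.
have sS := fintype.subsetP AS _ sA.
case: (root_sign (wprod v') sS) => h; last first.
  exists (rcons v' s); split.
  - by rewrite /word_in all_rcons; apply/andP.
  - by rewrite !wprod_rcons e.
  - by rewrite size_rcons ltnS.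
  - by rewrite wprod_rcons; constructor.
have vS' : word_in S v'.
  by apply: sub_all vA' => x; apply: (fintype.subsetP AS).
have [v1 [u [v2 [ev eq]]]] := exchange vS' sS h.
have vA2 : word_in A (v1 ++ v2).
  by move: vA'; rewrite ev /word_in !all_cat /= => /and3P[-> _ ->].
have sz : (size v' = (size (v1 ++ v2)).+1)%N by rewrite ev !size_cat /= addnS.
have lt2 : (size (v1 ++ v2) < k)%N.
  by rewrite -sz (leq_trans vv') // ltnW.
have [v3 [vA3 e3 vv3 asc3]] := IH _ vA2 lt2.
exists v3; split=> //; first by rewrite e3 -eq e wprod_rcons.
apply: (leq_trans vv3); apply: (@leq_trans (size v')).
  by rewrite sz leqnSn.
by rewrite (leq_trans vv') // leqnSn.
Qed.

Lemma ascent_all w : ascent S w.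
Proof.
have [v vS <-] := gen_word (simple_gen Sz w).
exact: ascent_word.
Qed.

(** The last letter of an increasing word has its root made negative. *)
Lemma ascent_descent (A : {set W}) w : A \subset S -> ascent A w -> w <> 1%g ->
  exists2 s, s \in A & g z (act w (r s)) < 0.
Proof.
move=> AS [//|v s asc sA h _]; exists s => //.
have sS := fintype.subsetP AS _ sA.
rewrite (actMl actP) (reflects_self (rS sS)) (actN actP) (ipNr gP) oppr_lt0.
exact: h.
Qed.

(** Each letter s of an increasing word v s moves the image of y by a negative
multiple of the positive root v (r s). *)
Lemma dominant_cone y w : (forall s, s \in S -> 0 <= g y (r s)) ->
  cone S r (y - act w y).
Proof.
move=> y0; elim: (ascent_all w) => [|v s _ IH sS h].
  by rewrite (act1l gP actP) subrr; apply: cone0.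
have [_ sx] := rS sS.
rewrite (actMl actP) sx /refl (actB actP) (actZ actP) opprB addrCA addrC.
rewrite addrC; apply: coneD => //; apply: coneZ; last exact: root_cone.
by rewrite mulr_ge0 ?ler0n ?y0.
Qed.

Lemma dominant_free y w : (forall s, s \in S -> 0 < g y (r s)) ->
  act w y = y -> w = 1%g.
Proof.
move=> y0 e; case: (ascent_all w) e => // v s _ sS h e; exfalso.
have := cone_ge0 gP (fun s sS => ltW (zr sS)) (dominant_cone v (fun s sS => ltW (y0 s sS))).
have [_ sx] := rS sS.
have : y - act v y + (2 * g y (r s)) *: act v (r s) = 0.
  rewrite -{1}e (actMl actP) sx /refl (actB actP) (actZ actP).
  by rewrite addrAC subrK subrr.
move/(congr1 (g z)); rewrite (ipDr gP) (ipZr gP) (ip0r gP).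
by have := y0 _ sS; nra.
Qed.

(** * The Coxeter presentation *)

Lemma span2_ge0 s t w u p q : s \in S -> t \in S -> s != t -> u \in S ->
  act w (r u) = p *: r s + q *: r t -> 0 < g z (act w (r u)) ->
  0 <= p /\ 0 <= q.
Proof.
suff main s' t' w' u' p' q' : s' \in S -> t' \in S -> s' != t' -> u' \in S ->
    act w' (r u') = p' *: r s' + q' *: r t' -> 0 < g z (act w' (r u')) -> 0 <= q'.
  move=> sS tS st uS e h; split; last exact: (main s t w u p q).
  by apply: (main t s w u q p); rewrite // 1?eq_sym // e addrC.
move=> sS tS st uS e h; rewrite leNgt; apply/negP => q0.
have [c c0 e'] := root_cone uS h.
have tS' : t' \in (S :\ s')%SET by rewrite in_setD1 eq_sym st.
have e2 : (p' - c s') *: r s' =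
    \sum_(v in (S :\ s')%SET) (c v + (- q') * (v == t')%:R) *: r v.
  under eq_bigr do rewrite scalerDl.
  rewrite big_split /= [X in _ = _ + X](bigD1 t') //= eqxx mulr1.
  rewrite [X in _ = _ + (_ + X)]big1 => [|v /andP[_ /negPf ->]]; last first.
    by rewrite mulr0 scale0r.
  rewrite addr0 scalerBl scaleNr.
  have -> : p' *: r s' = (p' *: r s' + q' *: r t') - q' *: r t' by rewrite addrK.
  rewrite -e e' (big_setD1 s') //= addrAC; congr (_ - _).
  by rewrite addrC addKr.
have cc v : v \in (S :\ s')%SET -> 0 <= c v + (- q') * (v == t')%:R.
  rewrite in_setD1 => /andP[_ vS]; rewrite addr_ge0 ?c0 // mulr_ge0 ?ler0n //.
  by rewrite oppr_ge0 ltW.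
have k0 := cone_excl (simple_free Sz sS) cc e2.
have zr' v : v \in (S :\ s')%SET -> 0 < g z (r v) by rewrite in_setD1 => /andP[_ /zr].
have := cone_eq0 gP zr' cc _ tS'.
rewrite -e2 (ipZr gP) eqxx mulr1 (mulr_le0_ge0 k0 (ltW (zr sS))) => /(_ isT).
by have := c0 _ tS; lra.
Qed.

Lemma pair_span s t w : s \in S -> t \in S ->
  (exists2 v, word_in [set s; t]%SET v & wprod v = w) ->
  forall u, u \in [set s; t]%SET -> exists p q, act w (r u) = p *: r s + q *: r t.
Proof.
move=> sS tS [v + <-] u uA; elim: v => [_|x v IH /= /andP[xA /IH [p [q e]]]].
  rewrite wprod0 (act1l gP actP); move: uA; rewrite in_set2 => /orP[]/eqP ->.
    by exists 1, 0; rewrite scale1r scale0r addr0.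
  by exists 0, 1; rewrite scale1r scale0r add0r.
rewrite wprod_cons (actMl actP) e.
move: xA; rewrite in_set2 => /orP[]/eqP ->.
  have [_ ->] := rS sS; rewrite /refl.
  set k := 2 * _; exists (p - k), q; rewrite scalerBl addrAC; done.
have [_ ->] := rS tS; rewrite /refl.
by set k := 2 * _; exists p, (q - k); rewrite scalerBl addrA.
Qed.

(** The minimal element of a coset of a dihedral parabolic subgroup is unique: a
nontrivial element of the subgroup makes one of the two roots a negative
combination of both. *)
Lemma pair_min_uniq s t v v' w : s \in S -> t \in S -> s != t ->
  word_in [set s; t]%SET w -> v' = (v * wprod w)%g ->
  (forall u, u \in [set s; t]%SET -> 0 < g z (act v (r u))) ->
  (forall u, u \in [set s; t]%SET -> 0 < g z (act v' (r u))) -> wprod w = 1%g.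
Proof.
move=> sS tS st wA ev vA vA'; have [//|/eqP w1] := eqVneq (wprod w) 1%g; exfalso.
have AS : [set s; t]%SET \subset S.
  by apply/fintype.subsetP => u; rewrite in_set2 => /orP[]/eqP ->.
have [u uA h] := ascent_descent AS (ascent_word AS wA) w1.
have uS := fintype.subsetP AS _ uA.
have [p [q e]] := pair_span sS tS (ex_intro2 _ _ w wA erefl) uA.
have e' : act (wprod w * u)%g (r u) = (- p) *: r s + (- q) *: r t.
  rewrite (actMl actP) (reflects_self (rS uS)) (actN actP) e.
  by rewrite opprD !scaleNr.
have h' : 0 < g z (act (wprod w * u)%g (r u)).
  rewrite (actMl actP) (reflects_self (rS uS)) (actN actP) (ipNr gP).
  by rewrite oppr_gt0.
have [p0 q0] := span2_ge0 sS tS st uS e' h'.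
have := vA' u uA; rewrite ev (actMl actP) e (actD actP) !(actZ actP).
rewrite (ipDr gP) !(ipZr gP).
have := vA s; have := vA t; rewrite !in_set2 !eqxx orbT => /(_ isT) h1 /(_ isT) h2.
nra.
Qed.

(** A substitute for the length, strictly increasing along ascents, that needs
no choice of words. *)
Definition rank w := #|[set v : W | g z (act w z) < g z (act v z)]%SET|.

Lemma rank_ascent w s : s \in S -> 0 < g z (act w (r s)) ->
  (rank w < rank (w * s)%g)%N.
Proof.
move=> sS h; have [_ sx] := rS sS.
have lt1 : g z (act (w * s)%g z) < g z (act w z).
  rewrite (actMl actP) sx /refl (actB actP) (actZ actP) (ipBr gP) (ipZr gP).
  rewrite ltrBlDr ltrDl !mulr_gt0 ?ltr0n ?zr //.
apply: proper_card; apply/properP; split.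
  by apply/fintype.subsetP => v; rewrite !finset.in_set => /(lt_trans lt1).
by exists w; rewrite !finset.in_set ?ltxx.
Qed.

Section Presentation.
Variables (G : groupType) (f : W -> G).
Hypothesis fP : forall s t, s \in S -> t \in S ->
  ((f s * f t) ^+ #[s * t])%g = 1%g.

Let fprod (v : seq W) : G := (\prod_(s <- v) f s)%g.

Let fK s : s \in S -> (f s * f s)%g = 1%g.
Proof.
move=> sS; have := fP sS sS.
by rewrite (reflectsK gP actP (rS sS)) order1 expg1.
Qed.

(** The values that increasing words give to a group element under a map f of the
generators; that there is only one is the content of the presentation. *)
Inductive lift : W -> G -> Prop :=
| lift1 : lift 1%g 1%g
| liftM w x s : lift w x -> s \in S -> 0 < g z (act w (r s)) ->
    lift (w * s)%g (x * f s)%g.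

Lemma lift_ex w : exists x, lift w x.
Proof.
elim: (ascent_all w) => [|v s _ [x hx] sS h]; first by exists 1%g; constructor.
by exists (x * f s)%g; constructor.
Qed.

(** The decomposition w = v a, with a in the subgroup generated by s and t and v
minimal in its coset, is compatible with lift. *)
Lemma pair_descent s t w : s \in S -> t \in S -> s != t ->
  exists v a, [/\ word_in [set s; t]%SET a, w = (v * wprod a)%g,
    forall u, u \in [set s; t]%SET -> 0 < g z (act v (r u)),
    (rank v <= rank w)%N &
    forall x, lift v x -> lift w (x * fprod a)%g].
Proof.
move=> sS tS st; have [k] := ubnP (rank w); elim: k w => // k IH w.
rewrite ltnS => wk.
have AS u : u \in [set s; t]%SET -> u \in S.
  by rewrite in_set2 => /orP[]/eqP ->.
case: (pselect (exists2 u, u \in [set s; t]%SET & g z (act w (r u)) < 0)).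
  case=> u uA h; have uS := AS _ uA.
  have uu := reflectsK gP actP (rS uS).
  have h' : 0 < g z (act (w * u)%g (r u)).
    rewrite (actMl actP) (reflects_self (rS uS)) (actN actP) (ipNr gP).
    by rewrite oppr_gt0.
  have lt := rank_ascent uS h'; rewrite -mulgA uu mulg1 in lt.
  have [v [a [aA e pos le l]]] := IH _ (leq_trans lt wk).
  exists v, (rcons a u); split=> //.
  - by rewrite /word_in all_rcons; apply/andP.
  - by rewrite wprod_rcons mulgA -e -mulgA uu mulg1.
  - exact: leq_trans le (ltnW lt).
  - move=> x /l hl; rewrite /fprod big_rcons /= mulgA.
    have := liftM hl uS h'; rewrite -[(w * u * u)%g]mulgA uu mulg1; exact.
move=> nh; exists w, [::]; split=> //.
- by rewrite wprod0 mulg1.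
- move=> u uA; case: (root_sign w (AS _ uA)) => // h; exfalso.
  by apply: nh; exists u.
- by move=> x; rewrite /fprod big_nil mulg1.
Qed.

(** In a dihedral group every word is (s t)^p or (s t)^p s, simultaneously in
the group and in G, so the relation of s t alone decides equality. *)
Lemma pair_normal s t a : s \in S -> t \in S -> word_in [set s; t]%SET a ->
  exists p (e : bool), wprod a = ((s * t) ^+ p * s ^+ e)%g /\
                       fprod a = ((f s * f t) ^+ p * f s ^+ e)%g.
Proof.
move=> sS tS; have ss := reflectsK gP actP (rS sS); have tt := reflectsK gP actP (rS tS).
elim/last_ind: a => [_|a u IH].
  by exists 0%N, false; rewrite wprod0 /fprod big_nil !expg0 !mulg1.
rewrite /word_in all_rcons => /andP[uA /IH [p [e [ea fa]]]].
rewrite wprod_rcons /fprod big_rcons /= -/(fprod a) ea fa.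
move: uA; rewrite in_set2 => /orP[]/eqP ->.
  exists p, (~~ e); case: e {ea fa} => /=.
    by rewrite !expg1 !expg0 !mulg1 -!mulgA ss (fK sS) !mulg1.
  by rewrite !expg1 !expg0 !mulg1.
case: e {ea fa} => /=.
  by exists p.+1, false; rewrite !expg1 !expg0 !mulg1 !expgSr -!mulgA.
have [q [eq fq]] : exists q, ((s * t) ^+ p = (s * t) ^+ q.+1)%g /\
    ((f s * f t) ^+ p = (f s * f t) ^+ q.+1)%g.
  case: p => [|p]; last by exists p.
  exists #[(s * t)%g]%g.-1; rewrite prednK ?order_gt0 //.
  by rewrite expg_order fP.
exists q, true; rewrite eq fq !expg1 !expg0 !mulg1 !expgSr -!mulgA.
by rewrite tt (fK tS) !mulg1.
Qed.

Lemma pair_relation s t a b : s \in S -> t \in S -> s != t ->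
  word_in [set s; t]%SET a -> word_in [set s; t]%SET b ->
  wprod a = wprod b -> fprod a = fprod b.
Proof.
move=> sS tS st aA bA ab.
have ss := reflectsK gP actP (rS sS); have tt := reflectsK gP actP (rS tS).
have revA v : word_in [set s; t]%SET v ->
    (fprod (rev v) * fprod v)%g = 1%g /\ (wprod (rev v) * wprod v)%g = 1%g.
  elim: v => [_|u v IH /= /andP[uA /IH [h1 h2]]].
    by rewrite /fprod /wprod /= !big_nil !mulg1.
  have uS : u \in S by move: uA; rewrite in_set2 => /orP[]/eqP ->.
  rewrite rev_cons wprod_rcons wprod_cons /fprod big_rcons big_cons /=.
  rewrite -/(fprod v) -/(fprod (rev v)).
  rewrite -!mulgA [(f u * (_ * _))%g]mulgA [(u * (_ * _))%g]mulgA (fK uS).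
  by rewrite (reflectsK gP actP (rS uS)) !mul1g.
suff h : fprod (rev b ++ a) = 1%g.
  have [hb _] := revA b bA.
  apply: (mulgI (fprod (rev b))); rewrite hb.
  by rewrite -h /fprod big_cat.
have cA : word_in [set s; t]%SET (rev b ++ a).
  by rewrite /word_in all_cat all_rev; apply/andP.
have c1 : wprod (rev b ++ a) = 1%g.
  by rewrite wprod_cat ab; have [_ ->] := revA b bA.
have [p [e [ec fc]]] := pair_normal sS tS cA.
rewrite fc; rewrite c1 in ec; case: e ec {fc} => /=.
  rewrite expg1 => h; exfalso.
  apply: (@rotation_neq W s t p) => //.
  - exact: (reflects_neq1 gP actP (rS sS)).
  - exact: (reflects_neq1 gP actP (rS tS)).
  - by apply: (mulIg s); rewrite ss -h.
rewrite !expg0 !mulg1 => h.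
have : (#[s * t] %| p)%N%g by rewrite order_dvdn -h.
by case/dvdnP => k ->; rewrite mulnC expgM fP // expg1n.
Qed.

(** Two increasing words for w with different last letters s and t are compared
through the minimal element of the coset of w modulo the subgroup generated by s
and t; in this subgroup the relation of s t suffices. *)
Lemma lift_uniq w x x' : lift w x -> lift w x' -> x = x'.
Proof.
have inv v y : lift v y -> v = 1%g /\ y = 1%g \/
    exists v1 s y1, [/\ v = (v1 * s)%g, y = (y1 * f s)%g, s \in S,
                        0 < g z (act v1 (r s)) & lift v1 y1].
  by case=> [|v1 y1 s h1 h2 h3]; [left|right; exists v1, s, y1].
have no1 v1 s : s \in S -> 0 < g z (act v1 (r s)) -> (1 = v1 * s)%g -> False.
  move=> sS h e; have e1 : v1 = s.
    by rewrite -[LHS]mulg1 -(reflectsK gP actP (rS sS)) mulgA -e mul1g.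
  move: h; rewrite e1 (reflects_self (rS sS)) (ipNr gP) oppr_gt0.
  by move=> h; have := lt_trans h (zr sS); rewrite ltxx.
have [k] := ubnP (rank w); elim: k w x x' => // k IH w x x'.
rewrite ltnS => wk /inv [[w1 ->]|[w1 [s [x1 [ew ex sS h l1]]]]] /inv.
  case=> [[_ ->] //|[w2 [t [x2 [ew' _ tS h' _]]]]].
  by exfalso; apply: (no1 w2 t) => //; rewrite -ew'.
case=> [[w1' _]|[w2 [t [x2 [ew' ex' tS h' l2]]]]].
  by exfalso; apply: (no1 w1 s) => //; rewrite -ew.
have k1 : (rank w1 < k)%N by apply: leq_trans wk; rewrite ew; apply: rank_ascent.
have k2 : (rank w2 < k)%N by apply: leq_trans wk; rewrite ew'; apply: rank_ascent.
have [est|st] := eqVneq s t.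
  have e12 : w1 = w2 by apply: (mulIg s); rewrite -ew ew' est.
  by rewrite ex ex' est; congr (_ * _)%g; apply: (IH w1) => //; rewrite e12.
have [v [a [aA ea va le la]]] := pair_descent w1 sS tS st.
have [v' [b [bA eb vb le' lb]]] := pair_descent w2 sS tS st.
have sA : s \in [set s; t]%SET by rewrite in_set2 eqxx.
have tA : t \in [set s; t]%SET by rewrite in_set2 eqxx orbT.
have asA : word_in [set s; t]%SET (rcons a s) by rewrite /word_in all_rcons; apply/andP.
have btA : word_in [set s; t]%SET (rcons b t) by rewrite /word_in all_rcons; apply/andP.
have ewa : w = (v * wprod (rcons a s))%g by rewrite wprod_rcons mulgA -ea.
have ewb : w = (v' * wprod (rcons b t))%g by rewrite wprod_rcons mulgA -eb.
have wrev c : word_in [set s; t]%SET c -> (wprod c * wprod (rev c))%g = 1%g.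
  elim: c => [|u c IHc /= /andP[uA /IHc e]]; first by rewrite /rev /= wprod0 mulg1.
  rewrite rev_cons wprod_rcons wprod_cons mulgA -[(u * _ * _)%g]mulgA e mulg1.
  apply: (reflectsK gP actP (a := r u)); apply: rS.
  by move: uA; rewrite in_set2 => /orP[]/eqP ->.
have evv : v' = (v * wprod (rcons a s ++ rev (rcons b t)))%g.
  rewrite wprod_cat mulgA -ewa ewb -mulgA wrev // mulg1; done.
have cA : word_in [set s; t]%SET (rcons a s ++ rev (rcons b t)).
  by rewrite /word_in all_cat all_rev; apply/andP.
have c1 := pair_min_uniq sS tS st cA evv va vb.
rewrite c1 mulg1 in evv; subst v'.
have [x0 lx0] := lift_ex v.
have -> : x = (x0 * fprod (rcons a s))%g.
  rewrite ex (IH w1 x1 (x0 * fprod a)%g) //; last exact: la.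
  by rewrite /fprod big_rcons mulgA.
have -> : x' = (x0 * fprod (rcons b t))%g.
  rewrite ex' (IH w2 x2 (x0 * fprod b)%g) //; last exact: lb.
  by rewrite /fprod big_rcons mulgA.
congr (_ * _)%g; apply: (pair_relation sS tS) => //.
by apply: (mulgI v); rewrite -ewa -ewb.
Qed.

Lemma presentation : exists2 phi : W -> G,
  {morph phi : v w / (v * w)%g} & forall s, s \in S -> phi s = f s.
Proof.
have [phi phiP] := choice lift_ex.
have phi1 : phi 1%g = 1%g by apply: (@lift_uniq 1%g); [exact: phiP|constructor].
have phiS w s : s \in S -> phi (w * s)%g = (phi w * f s)%g.
  move=> sS; case: (root_sign w sS) => h; last first.
    by apply: lift_uniq (phiP _) _; constructor.
  have h' : 0 < g z (act (w * s)%g (r s)).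
    rewrite (actMl actP) (reflects_self (rS sS)) (actN actP) (ipNr gP).
    by rewrite oppr_gt0.
  have := liftM (phiP (w * s)%g) sS h'.
  rewrite -[(w * s * s)%g]mulgA (reflectsK gP actP (rS sS)) mulg1.
  move=> /(lift_uniq (phiP w)) ->.
  by rewrite -mulgA fK // mulg1.
exists phi; last by move=> s sS; rewrite -[s]mul1g phiS // phi1 mul1g mul1g.
move=> v w; have [a + <-] := gen_word (simple_gen Sz w).
elim/last_ind: a => [_|a s IH]; first by rewrite wprod0 mulg1 phi1 mulg1.
rewrite /word_in all_rcons wprod_rcons => /andP[sS /IH e].
by rewrite mulgA !(phiS _ _ sS) e mulgA.
Qed.

End Presentation.

Lemma simple_coxeter : coxeter_system S.
Proof.
split.
- by move=> s /rS /(reflects_order gP actP).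
- by apply/setP => w; rewrite (simple_gen Sz) finset.in_setT.
- by move=> G f fP; apply: presentation.
Qed.

End SimpleSystem.

(** * Simple systems from base points *)

Section BasePoint.
Variables (R : realType) (E : lmodType R) (g : E -> E -> R).
Variables (W : finGroupType) (act : W -> E -> E).
Hypotheses (gP : inner_product g) (actP : orthogonal_action g act).
Variables (T : {set W}).
Hypothesis TJ : forall w t : W, t \in T -> (w * t * w^-1)%g \in T.
Hypothesis TG : forall w : W, w \in <<T>>%g.

Section Positive.
Variables (r : W -> E) (y : E).
Hypothesis rT : forall t, t \in T -> reflects g act t (r t).
Hypothesis ry : forall t, t \in T -> 0 < g y (r t).

Lemma root_conj w t : t \in T ->
  act w (r t) = r (w * t * w^-1)%g \/ act w (r t) = - r (w * t * w^-1)%g.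
Proof.
move=> tT; have := reflects_conj gP actP w (rT tT).
by move/(reflects_root gP); apply; apply/rT/TJ.
Qed.

(** A minimal set D of elements of T whose roots span the cone of all positive
roots is a simple system. *)
Lemma positive_simple : exists2 D : {set W}, D \subset T &
  simple_system g act D r y.
Proof.
pose P (D : {set W}) := `[< D \subset T /\ forall t, t \in T -> cone D r (r t) >].
have PT : P T by apply/asboolP; split=> // t; apply: cone_gen.
have [D Dmin _] := minset_exists PT.
have [/asboolP [DT Dc] Dm] := minsetP Dmin.
have DTi s : s \in D -> s \in T by apply: (fintype.subsetP DT).
have Dfree s : s \in D -> ~ cone (D :\ s)%SET r (r s).
  move=> sD sc.
  have e : (D :\ s)%SET = D.
    apply: Dm; last exact: subD1set.
    apply/asboolP; split; first exact: fintype.subset_trans (subD1set _ _) DT.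
    move=> t /Dc; apply: cone_trans => u uD.
    have [->//|us] := eqVneq u s.
    by apply: cone_gen; rewrite in_setD1 us.
  by have := in_setD1 s D s; rewrite e sD eqxx.
(* otherwise a simple reflection would lower the height of the root w (r t) *)
have conjD t : t \in T -> exists w d, [/\ w \in <<D>>%g, d \in D & t = (w * d * w^-1)%g].
  move=> tT.
  pose Q w := (w \in <<D>>%g) && (0 < g y (act w (r t))).
  pose w0 := [arg min_(w < 1%g | Q w) g y (act w (r t))]%O.
  have : Q w0 /\ forall w, Q w -> g y (act w0 (r t)) <= g y (act w (r t)).
    rewrite /w0; case: arg_minP => //.
    by rewrite /Q group1 (act1l gP actP) ry.
  case=> /andP[w0D h0] hmin.
  have [c c0 e] : cone D r (act w0 (r t)).
    case: (root_conj w0 tT) => e0; rewrite e0; first exact/Dc/TJ.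
    exfalso; have := ry (TJ w0 tT); move: h0; rewrite e0 (ipNr gP) oppr_gt0.
    by move=> /lt_trans h /h; rewrite ltxx.
  have [d dD gd] : exists2 d, d \in D & 0 < g (act w0 (r t)) (r d).
    apply: contrapT => no.
    have : g (act w0 (r t)) (act w0 (r t)) <= 0.
      rewrite {2}e (ip_sumr gP); apply: sumr_le0 => d dD.
      rewrite (ipZr gP); apply: mulr_ge0_le0; first exact: c0.
      by rewrite leNgt; apply/negP => h; apply: no; exists d.
    by rewrite (act_ip actP); have [-> _] := rT tT; rewrite ler10.
  have [_ dx] := rT (DTi d dD).
  have Qn : ~~ Q (d * w0)%g.
    apply/negP => /hmin; rewrite (actMl actP) dx /refl (ipBr gP) (ipZr gP).
    by have := ry (DTi d dD); nra.
  have neg : g y (act (d * w0)%g (r t)) < 0.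
    rewrite ltNge; apply/negP => h; move: Qn; rewrite /Q (groupM (mem_gen dD) w0D) /=.
    rewrite lt0r h andbT negbK => /eqP h'.
    have := ry (TJ (d * w0)%g tT); case: (root_conj (d * w0)%g tT) => e2;
      by move: h'; rewrite e2 ?(ipNr gP); lra.
  have ed : act w0 (r t) = r d.
    have [d1 _] := rT (DTi d dD); have [t1 _] := rT tT.
    apply: (cone_cancel gP (z := y) (A := D) (k := 2 * g (act w0 (r t)) (r d)) _ dD (Dfree d dD) d1).
    - by move=> u /DTi /ry.
    - by rewrite (act_ip actP).
    - by exists c.
    have : cone D r (- act (d * w0)%g (r t)).
      case: (root_conj (d * w0)%g tT) => e2; last by rewrite e2 opprK; exact/Dc/TJ.
      by move: neg; rewrite e2 => /(lt_trans (ry (TJ _ tT))); rewrite ltxx.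
    by rewrite (actMl actP) dx /refl opprB.
  exists w0^-1%g, d; split=> //; first by rewrite groupV.
  have := reflects_conj gP actP w0 (rT tT); rewrite ed => /(reflects_uniq gP actP (rT (DTi d dD))) ->.
  by rewrite invgK !mulgA mulVg mul1g mulgKV.
exists D => //; split=> //.
- by move=> s /DTi /rT.
- move=> w; have := TG w; apply/fintype.subsetP; rewrite gen_subG.
  apply/fintype.subsetP => t /conjD [v [d [vD dD ->]]].
  by rewrite !groupM ?groupV ?(mem_gen dD).
- move=> w s /DTi sT; case: (root_conj w sT) => ->; [left|right; rewrite opprK];
    exact/Dc/TJ.
- by move=> s /DTi /ry.
Qed.

End Positive.

Lemma base_simple (r : W -> E) y :
  (forall t, t \in T -> reflects g act t (r t)) ->
  (forall t, t \in T -> act t y <> y) ->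
  exists (D : {set W}) (r' : W -> E), D \subset T /\ simple_system g act D r' y.
Proof.
move=> rT ty; pose r' t := if 0 < g y (r t) then r t else - r t.
have rT' t : t \in T -> reflects g act t (r' t).
  by move/rT => h; rewrite /r'; case: ifP => // _; apply: (reflectsN gP).
have ry t : t \in T -> 0 < g y (r' t).
  move=> tT; rewrite /r'; case: ifP => // /negbT; rewrite -leNgt (ipNr gP) => h.
  rewrite oppr_gt0 lt_neqAle h andbT; apply/eqP => h0; apply: (ty t tT).
  by have [_ ->] := rT t tT; rewrite /refl h0 mulr0 scale0r subr0.
by have [D DT Ds] := positive_simple rT' ry; exists D, r'.
Qed.

(** A vector space over an infinite field is not a union of finitely many
hyperplanes; here the space is the hyperplane orthogonal to p. *)
Lemma generic_point (L : seq E) (p : E) :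
  (forall a, a \in L -> exists2 u, g u p = 0 & g u a <> 0) ->
  exists2 z, g z p = 0 & forall a, a \in L -> g z a <> 0.
Proof.
elim: L => [_|a L IH h]; first by exists 0; rewrite ?(ip0l gP).
have [|z zp zL] := IH; first by move=> b bL; apply: h; rewrite in_cons bL orbT.
have [u up ua] := h a (mem_head _ _).
case: (pselect (g z a = 0)) => za; last first.
  by exists z => // b; rewrite in_cons => /orP[/eqP ->|/zL].
pose e := 1 + \sum_(b <- L) `|g z b / g u b|.
have e0 : 0 < e by rewrite ltr_pwDl // sumr_ge0.
have eb b : b \in L -> `|g z b / g u b| < e.
  move=> bL; rewrite /e (big_rem b) //= addrCA ltrDl ltr_pwDl //.
  by rewrite sumr_ge0.
exists (z + e *: u); first by rewrite (ipDl gP) (ipZl gP) zp up mulr0 addr0.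
move=> b; rewrite in_cons (ipDl gP) (ipZl gP) => /orP[/eqP ->|bL].
  rewrite za add0r => /eqP; rewrite mulf_eq0 (gt_eqF e0) /= => /eqP; exact: ua.
move=> h0; have ub : g u b != 0.
  by apply/eqP => ub; apply: (zL b bL); move: h0; rewrite ub mulr0 addr0.
have : g z b / g u b = - e by apply: (mulIf ub); rewrite mulfVK //; lra.
by move=> h1; have := eb b bL; rewrite h1 normrN (gtr0_norm e0) ltxx.
Qed.

(** Every reflection of the group belongs to T: a generic point of its mirror
lies on no mirror of T, and such points have a trivial stabiliser. *)
Lemma reflection_mem (r : W -> E) h p :
  (forall t, t \in T -> reflects g act t (r t)) ->
  reflects g act h p -> h \in T.
Proof.
move=> rT hp; apply: contrapT => hT.
have [|z zp zT] := @generic_point [seq r t | t <- enum T] p.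
  move=> a /mapP[t + ->]; rewrite mem_enum => tT.
  have th : t != h by apply/eqP => th; apply: hT; rewrite -th.
  have := reflects_neq gP actP (rT t tT) hp th.
  have [t1 _] := rT t tT; have [p1 _] := hp.
  exists (r t - g (r t) p *: p); first by rewrite !(ipE gP) p1; lra.
  by rewrite !(ipE gP) t1 (ipC gP p); move=> h0; nra.
have tz t : t \in T -> act t z <> z.
  move=> tT; have [t1 ->] := rT t tT; rewrite /refl => /eqP.
  rewrite -subr_eq0 addrAC subrr add0r oppr_eq0 scaler_eq0 => /orP[].
    rewrite mulf_eq0 pnatr_eq0 /= => /eqP; apply: zT.
    by apply: map_f; rewrite mem_enum.
  by move=> /eqP r0; move: t1; rewrite r0 (ip0l gP) => /eqP; rewrite eq_sym oner_eq0.
have [D [r' [DT Ds]]] := base_simple rT tz.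
apply: (reflects_neq1 gP actP hp).
apply: (dominant_free gP actP Ds (y := z)); first exact: simple_pos Ds.
by have [_ ->] := hp; rewrite /refl zp mulr0 scale0r subr0.
Qed.

End BasePoint.

(** A point off the mirrors can be moved into the chamber of the base point:
an element of its orbit closest to the base point lies there. *)
Lemma dominant_orbit (R : realType) (E : lmodType R) (g : E -> E -> R)
    (W : finGroupType) (act : W -> E -> E) (S : {set W}) (r : W -> E) (z x : E) :
  inner_product g -> orthogonal_action g act ->
  simple_system g act S r z ->
  (forall w s, s \in S -> act s (act w x) <> act w x) ->
  exists w, forall s, s \in S -> 0 < g (act w x) (r s).
Proof.
move=> gP actP Sz off; pose w0 := [arg max_(w > 1%g | true) g (act w x) z]%O.
have hmax w : g (act w x) z <= g (act w0 x) z by rewrite /w0; case: arg_maxP => // v _; apply.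
exists w0 => s sS; have [s1 sx] := simple_refl Sz sS.
rewrite lt_neqAle; apply/andP; split.
  apply/eqP => h; apply: (off w0 s sS).
  by rewrite sx /refl -h mulr0 scale0r subr0.
have := hmax (s * w0)%g; rewrite (actMl actP) sx /refl (ipBl gP) (ipZl gP).
rewrite [g (r s) z](ipC gP); have := simple_pos Sz sS.
move=> h1 h2; rewrite -(pmulr_lge0 _ h1); lra.
Qed.

(** * Positivity of Gram matrices of finite Coxeter systems *)

Section LinearGroup.
Variables (R : realType) (X : lmodType R).

(** The universal property of a Coxeter system applies to abstract groups: this is
the group of linear automorphisms, which need not be finite. *)
Record linear_aut := LinearAut {
  lfun : X -> X;
  linv : X -> X;
  lfun_lin : forall a x y, lfun (a *: x + y) = a *: lfun x + lfun y;
  lfunK : cancel lfun linv;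
  linvK : cancel linv lfun }.

HB.instance Definition _ := gen_eqMixin linear_aut.
HB.instance Definition _ := gen_choiceMixin linear_aut.

Lemma linear_aut_eq (a b : linear_aut) : lfun a =1 lfun b -> a = b.
Proof.
case: a b => [f f' fl fK f'K] [h h' hl hK h'K] /= e.
have efh : f = h by apply: funext.
subst h; have e' : f' = h'.
  by apply: funext => x; rewrite -[x in RHS]f'K hK.
by subst h'; congr LinearAut; apply: Prop_irrelevance.
Qed.

Lemma linv_lin (f : linear_aut) a x y :
  linv f (a *: x + y) = a *: linv f x + linv f y.
Proof.
by apply: (can_inj (lfunK f)); rewrite lfun_lin !linvK.
Qed.

Definition linear_aut1 : linear_aut :=
  @LinearAut id id (fun _ _ _ => erefl) (fun _ => erefl) (fun _ => erefl).

Definition linear_autM (f h : linear_aut) : linear_aut.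
Proof.
exists (lfun f \o lfun h) (linv h \o linv f).
- by move=> a x y /=; rewrite !lfun_lin.
- by move=> x /=; rewrite !lfunK.
- by move=> x /=; rewrite !linvK.
Defined.

Definition linear_autV (f : linear_aut) : linear_aut :=
  LinearAut (linv_lin f) (linvK f) (lfunK f).

Let mulA : associative linear_autM.
Proof. by move=> f h k; apply: linear_aut_eq. Qed.
Let mul1 : left_id linear_aut1 linear_autM.
Proof. by move=> f; apply: linear_aut_eq. Qed.
Let mulr1 : right_id linear_aut1 linear_autM.
Proof. by move=> f; apply: linear_aut_eq. Qed.
Let mulV : left_inverse linear_aut1 linear_autV linear_autM.
Proof. by move=> f; apply: linear_aut_eq => x /=; rewrite lfunK. Qed.
Let mulrV : right_inverse linear_aut1 linear_autV linear_autM.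
Proof. by move=> f; apply: linear_aut_eq => x /=; rewrite linvK. Qed.

HB.instance Definition _ := isGroup.Build linear_aut mulA mul1 mulr1 mulV mulrV.

Lemma lfunX (f : linear_aut) k x : lfun (f ^+ k)%g x = iter k (lfun f) x.
Proof.
elim: k x => [|k IH] x; first by rewrite expg0.
by rewrite expgSr -[lfun _ x]/(lfun (f ^+ k)%g (lfun f x)) IH iterSr.
Qed.

End LinearGroup.

(** The product of two reflections in the basis of their roots, c being the scalar
product of the roots. *)
Definition rot (R : realType) (c : R) (p : R * R) : R * R :=
  let q := - p.2 - 2 * c * p.1 in (- p.1 - 2 * c * q, q).

(** A symmetric matrix B with unit diagonal defines formal reflections of R ^ S.
When each pair of them satisfies the relation of the Coxeter system, they
generate a finite group, which forces B to be positive definite. This applies to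
the Tits matrix and to the Gram matrices of the roots of actual reflections. *)
Section GramPositive.
Variables (R : realType) (W : finGroupType) (S : {set W}).
Hypothesis SC : coxeter_system S.
Variable B : W -> W -> R.
Hypothesis BC : forall s t, s \in S -> t \in S -> B s t = B t s.
Hypothesis B1 : forall s, s \in S -> B s s = 1.
Hypothesis Blt : forall s t, s \in S -> t \in S -> s != t -> B s t ^+ 2 < 1.
Hypothesis Brot : forall s t, s \in S -> t \in S -> s != t ->
  forall p, iter #[s * t]%g (rot (B s t)) p = p.

Let X := {ffun W -> R^o}.
Let e s : X := [ffun t => (t == s)%:R].
Let b s (x : X) : R := \sum_(t in S) B s t * x t.
Let sg s (x : X) : X := x - (2 * b s x) *: e s.

Let b_lin s a x y : b s (a *: x + y) = a * b s x + b s y.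
Proof.
rewrite /b mulr_sumr -big_split; apply: eq_bigr => t _ /=.
by rewrite !ffunE /GRing.scale /=; ring.
Qed.

Let b_e s t : t \in S -> b s (e t) = B s t.
Proof.
move=> tS; rewrite /b (big_setD1 t) //= ffunE eqxx mulr1 big1 ?addr0 // => u.
by rewrite in_setD1 ffunE => /andP[/negPf -> _]; rewrite mulr0.
Qed.

Let sg_lin s a x y : sg s (a *: x + y) = a *: sg s x + sg s y.
Proof.
rewrite /sg b_lin scalerBr !scalerA addrACA -opprD -scalerDl.
by congr (_ - _ *: _); ring.
Qed.

Let b0 s : b s 0 = 0.
Proof. by rewrite /b big1 // => t _; rewrite ffunE mulr0. Qed.
Let bZ s a x : b s (a *: x) = a * b s x.
Proof. by have := b_lin s a x 0; rewrite b0 !addr0. Qed.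
Let bD s x y : b s (x + y) = b s x + b s y.
Proof. by have := b_lin s 1 x y; rewrite scale1r mul1r. Qed.
Let bB s x y : b s (x - y) = b s x - b s y.
Proof. by rewrite bD -scaleN1r bZ mulN1r. Qed.

Let sgK s : s \in S -> involutive (sg s).
Proof.
move=> sS x; rewrite {1}/sg /sg bB bZ b_e // B1 // mulr1 -addrA -opprD -scalerDl.
rewrite [X in X *: _](_ : _ = 0) ?scale0r ?subr0 //; ring.
Qed.

Let aut s : linear_aut X :=
  if pselect (s \in S) is left sS
  then LinearAut (sg_lin s) (sgK sS) (sgK sS) else 1%g.

Let autE s x : s \in S -> lfun (aut s) x = sg s x.
Proof. by rewrite /aut; case: pselect. Qed.

Let sg_plane s t p : s \in S -> t \in S ->
  sg s (sg t (p.1 *: e s + p.2 *: e t)) =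
  (rot (B s t) p).1 *: e s + (rot (B s t) p).2 *: e t.
Proof.
move=> sS tS; rewrite /sg.
have -> : p.1 *: e s + p.2 *: e t - (2 * b t (p.1 *: e s + p.2 *: e t)) *: e t =
    p.1 *: e s + (rot (B s t) p).2 *: e t.
  rewrite -addrA -scalerBl bD !bZ !b_e // B1 // (BC tS sS) /rot /=.
  by congr (_ + _ *: _); ring.
rewrite addrAC -scalerBl bD !bZ !b_e // B1 //.
by congr (_ *: _ + _); rewrite /rot /=; ring.
Qed.

Let aut_relation s t : s \in S -> t \in S -> ((aut s * aut t) ^+ #[s * t])%g = 1%g.
Proof.
move=> sS tS; apply: linear_aut_eq => x; rewrite lfunX /=.
have [est|st] := eqVneq s t.
  rewrite est; have [S2 _ _] := SC.
  have -> : (t * t)%g = 1%g by have := expg_order t; rewrite S2 // expgS expg1.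
  by rewrite order1 /= !autE // sgK.
have c1 := Blt sS tS st; set c := B s t in c1.
have d0 : 1 - c ^+ 2 != 0 by rewrite subr_eq0 eq_sym; apply/eqP; lra.
pose al := (b s x - c * b t x) / (1 - c ^+ 2).
pose be := (b t x - c * b s x) / (1 - c ^+ 2).
pose x0 := x - (al *: e s + be *: e t).
have bs : b s x0 = 0.
  by rewrite bB bD !bZ !b_e // B1 // -/c /al /be; field.
have bt : b t x0 = 0.
  by rewrite bB bD !bZ !b_e // B1 // (BC tS sS) -/c /al /be; field.
pose f y := lfun (aut s) (lfun (aut t) y).
rewrite -[LHS]/(iter #[(s * t)%g]%g f x).
have -> : x = 1 *: x0 + (al *: e s + be *: e t) by rewrite scale1r subrK.
have fl a y z : f (a *: y + z) = a *: f y + f z by rewrite /f !autE // !sg_lin.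
have itl k y z : iter k f (1 *: y + z) = 1 *: iter k f y + iter k f z.
  by elim: k => //= k ->; rewrite fl.
rewrite itl; congr (_ *: _ + _).
  elim: #[_]%g => //= k ->; rewrite /f !autE // /sg bt mulr0 scale0r subr0.
  by rewrite bs mulr0 scale0r subr0.
have itp k : iter k f (al *: e s + be *: e t) =
    (iter k (rot c) (al, be)).1 *: e s + (iter k (rot c) (al, be)).2 *: e t.
  by elim: k => //= k ->; rewrite /f !autE // sg_plane.
by rewrite itp /c Brot.
Qed.

(** Averaging a scalar product over the finite group yields an invariant one,
for which each generator is the orthogonal reflection along its basis vector;
its Gram matrix is a positive diagonal rescaling of B. *)
Lemma gram_positive (x : W -> R) : (exists2 s, s \in S & x s != 0) ->
  0 < \sum_(s in S) \sum_(t in S) x s * x t * B s t.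
Proof.
case=> s0 s0S xs0; have [_ gen univ] := SC.
have [phi phiM phiS] := univ _ aut aut_relation.
have phi1 : phi 1%g = 1%g by apply: (mulgI (phi 1%g)); rewrite -phiM !mulg1.
pose A (u v : X) : R := \sum_w \sum_t (lfun (phi w) u) t * (lfun (phi w) v) t.
have AP : inner_product A.
  split.
  - by move=> u v; apply: eq_bigr => w _; apply: eq_bigr => t _; rewrite mulrC.
  - move=> a u v z; rewrite /A mulr_sumr -big_split; apply: eq_bigr => w _ /=.
    rewrite mulr_sumr -big_split; apply: eq_bigr => t _ /=.
    by rewrite lfun_lin !ffunE /GRing.scale /=; ring.
  - move=> u u0; rewrite /A (bigD1 1%g) //= phi1 /=; apply: ltr_wpDr.
      by apply: sumr_ge0 => w _; apply: sumr_ge0 => t _; rewrite -expr2 sqr_ge0.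
    have [t ut] : exists t, u t != 0.
      apply: contrapT => no; move/eqP: u0; apply; apply/ffunP => t; rewrite ffunE.
      by apply/eqP/negPn/negP => ut; apply: no; exists t.
    rewrite (bigD1 t) //=; apply: ltr_wpDr.
      by apply: sumr_ge0 => t' _; rewrite -expr2 sqr_ge0.
    by rewrite -expr2 exprn_even_gt0.
have Ainv s u v : s \in S -> A (sg s u) (sg s v) = A u v.
  move=> sS; rewrite /A [RHS](reindex_inj (mulIg s)); apply: eq_bigr => w _.
  apply: eq_bigr => t _.
  have mE (v' : X) : lfun (phi (w * s)%g) v' = lfun (phi w) (sg s v').
    by rewrite phiM (phiS s sS) -(autE v' sS).
  by rewrite !mE.
pose d s := A (e s) (e s).
have e0 s : e s != 0.
  by apply/eqP => /ffunP /(_ s); rewrite !ffunE eqxx => /eqP; rewrite oner_eq0.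
have d0 s : 0 < d s by case: AP => _ _; apply.
have Ae s u : s \in S -> A u (e s) = b s u * d s.
  move=> sS; have := Ainv s (sg s u) (e s) sS; rewrite sgK //.
  have -> : sg s (e s) = - e s.
    by rewrite /sg b_e // B1 // mulr1 scaler_nat mulr2n opprD addNKr.
  rewrite (ipNr AP) {1}/sg (ipBl AP) (ipZl AP) -/(d s); lra.
have AB s t : s \in S -> t \in S -> A (e s) (e t) = Num.sqrt (d s) * Num.sqrt (d t) * B s t.
  move=> sS tS; have h1 := Ae t (e s) tS; have h2 := Ae s (e t) sS.
  rewrite b_e // in h1; rewrite b_e // (ipC AP) (BC sS tS) in h2.
  rewrite (BC sS tS); have [h|nz] := eqVneq (B t s) 0.
    by rewrite h1 h mulr0 mul0r.
  have -> : d s = d t by apply: (mulfI nz); rewrite -h1 -h2.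
  by rewrite -expr2 sqr_sqrtr ?ltW // h1 mulrC.
pose y : X := \sum_(s in S) (x s / Num.sqrt (d s)) *: e s.
have sd s : 0 < Num.sqrt (d s) by rewrite sqrtr_gt0.
have -> : \sum_(s in S) \sum_(t in S) x s * x t * B s t = A y y.
  rewrite (ip_suml AP); apply: eq_bigr => s sS; rewrite (ip_sumr AP).
  apply: eq_bigr => t tS; rewrite (ipZl AP) (ipZr AP) AB //.
  by field; rewrite !gt_eqF.
case: AP => _ _; apply; apply/eqP => y0; move/eqP: xs0; apply.
have : y s0 = 0 by rewrite y0 ffunE.
rewrite /y sum_ffunE (big_setD1 s0) //= big1 => [|t]; last first.
  by rewrite in_setD1 !ffunE eq_sym => /andP[/negPf -> _]; rewrite scaler0.
rewrite addr0 !ffunE eqxx /GRing.scale /= mulr1 => /eqP.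
by rewrite mulf_eq0 invr_eq0 (gt_eqF (sd s0)) orbF => /eqP.
Qed.

End GramPositive.

(** * Diagrams of finite Coxeter systems *)

Definition cosm (R : realType) (m : nat) : R := cos (pi / m%:R).

Section CosBounds.
Variable R : realType.

Let pim m : (0 < m)%N -> 0 <= (pi / m%:R : R) <= (pi : R).
Proof.
move=> m0; rewrite divr_ge0 ?pi_ge0 ?ler0n //= ler_pdivrMr ?ltr0n //.
by rewrite ler_peMr ?pi_ge0 // ler1n.
Qed.

Let cosm_mono k m : (0 < k)%N -> (k <= m)%N -> cosm R k <= cosm R m.
Proof.
move=> k0 km; have m0 := leq_trans k0 km.
have [e|nkm] := eqVneq (pi / k%:R : R) (pi / m%:R); first by rewrite /cosm e.
apply/ltW; rewrite ltr_cos ?in_itv /= ?pim //.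
rewrite lt_neqAle eq_sym nkm ler_pM2l ?pi_gt0 //.
by rewrite lef_pV2 ?posrE ?ltr0n // ler_nat.
Qed.

Lemma cosm_ge0 m : (2 <= m)%N -> 0 <= cosm R m.
Proof. by move=> h; apply: le_trans (cosm_mono _ h); rewrite /cosm ?cos_pihalf. Qed.

Let cosm_gt0 m : (3 <= m)%N -> 0 < cosm R m.
Proof.
move=> h; have m0 : (0 < m)%N by apply: leq_trans h.
apply: cos_gt0_pihalf; rewrite (lt_trans (y := 0)) ?oppr_lt0 ?divr_gt0 ?pi_gt0 ?ltr0n //=.
by rewrite ltr_pM2l ?pi_gt0 // ltf_pV2 ?posrE ?ltr0n // ltr_nat.
Qed.

Let cos2x (x : R) : cos (2 * x) = 2 * cos x ^+ 2 - 1.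
Proof. by rewrite mulrC mulr_natr cos_mulr2n -mulr_natl. Qed.

Let cos3x (x : R) : cos (3 * x) = 4 * cos x ^+ 3 - 3 * cos x.
Proof.
have -> : 3 * x = 2 * x + x by ring.
have s2 : sin (2 * x) = 2 * (cos x * sin x).
  by rewrite mulrC mulr_natr sin_mulr2n -mulr_natl.
have h := cos2Dsin2 x; rewrite cosD cos2x s2.
apply/eqP; rewrite -subr_eq0; apply/eqP.
transitivity (- 2 * cos x * (cos x ^+ 2 + sin x ^+ 2 - 1)); first by ring.
by rewrite h subrr mulr0.
Qed.

(** By monotonicity it suffices to treat m = 3, and likewise m = 4, 5, 6 below; the
multiplication formulas then give a polynomial with the root cos (pi / m). *)
Lemma cosm3_ge m : (3 <= m)%N -> 1 / 2 <= cosm R m.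
Proof.
move=> h; apply: le_trans (cosm_mono _ h) => //.
have := cos3x (pi / 3); have -> : 3 * (pi / 3) = pi :> R by field.
rewrite cospi -/(cosm R 3); have := @cosm_gt0 3 isT; set c := cosm R 3 => c0 e.
have : (c + 1) * (2 * c - 1) ^+ 2 = 0.
  by transitivity (4 * c ^+ 3 - 3 * c + 1); [ring | lra].
by move/eqP; rewrite mulf_eq0 expf_eq0 /= => /orP[]/eqP; lra.
Qed.

Lemma cosm4_ge m : (4 <= m)%N -> 7 / 10 <= cosm R m.
Proof.
move=> h; apply: le_trans (cosm_mono _ h) => //.
have := cos2x (pi / 4); have -> : 2 * (pi / 4) = pi / 2 :> R by field.
rewrite cos_pihalf -/(cosm R 4); have := @cosm_gt0 4 isT; set c := cosm R 4 => c0 e.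
by rewrite leNgt; apply/negP => h1; nra.
Qed.

Lemma cosm5_ge m : (5 <= m)%N -> 4 / 5 <= cosm R m.
Proof.
move=> h; apply: le_trans (cosm_mono _ h) => //.
have := cos3x (pi / 5); have -> : 3 * (pi / 5) = - (2 * (pi / 5)) + pi :> R by field.
rewrite cosDpi cosN cos2x -/(cosm R 5); have := @cosm_gt0 5 isT.
set c := cosm R 5 => c0 e.
have : (c + 1) * (4 * c ^+ 2 - 2 * c - 1) = 0.
  have -> : (c + 1) * (4 * c ^+ 2 - 2 * c - 1) = 4 * c ^+ 3 - 3 * c + (2 * c ^+ 2 - 1) by ring.
  by rewrite -e; ring.
move/eqP; rewrite mulf_eq0 => /orP[]/eqP h1; first lra.
by rewrite leNgt; apply/negP => h2; nra.
Qed.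

Lemma cosm6_ge m : (6 <= m)%N -> 3 / 4 <= cosm R m ^+ 2.
Proof.
move=> h; have c0 := @cosm_gt0 6 isT; have c1 := cosm_mono (isT : (0 < 6)%N) h.
suff : 3 / 4 <= cosm R 6 ^+ 2 by move=> h1; nra.
have := cos2x (pi / 6); have -> : 2 * (pi / 6) = pi / 3 :> R by field.
by have := @cosm3_ge 3 isT; rewrite -/(cosm R 3) -/(cosm R 6); lra.
Qed.

(** Two mirrors at angle pi / m: the entries of the powers of the product are
values of the sine at multiples of pi / m. *)
Lemma cosm_rot m p : (2 <= m)%N -> iter m (rot (- cosm R m)) p = p.
Proof.
move=> m2; have m0 : (0 < m)%N by apply: leq_trans m2.
set th : R := pi / m%:R; have mR : m%:R != 0 :> R by rewrite pnatr_eq0 -lt0n.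
have s0 : sin th != 0.
  apply: lt0r_neq0; apply: sin_gt0_pi; rewrite divr_gt0 ?pi_gt0 ?ltr0n //=.
  by rewrite ltr_pdivrMr ?ltr0n // ltr_pMr ?pi_gt0 // ltr1n.
have rec (x : R) : sin (x + th) = 2 * cos th * sin x - sin (x - th).
  by rewrite sinB sinD; ring.
have E k : iter k (rot (- cosm R m)) p =
    ((p.1 * sin ((2 * k%:R + 1) * th) - p.2 * sin (2 * k%:R * th)) / sin th,
     (p.1 * sin (2 * k%:R * th) - p.2 * sin ((2 * k%:R - 1) * th)) / sin th).
  elim: k => [|k /= ->].
    rewrite mulr0 mul0r sin0 !mulr0 subr0 add0r mul1r sub0r mulfK // add0r mulN1r.
    by rewrite sinN mulrN opprK mulfK // [LHS]surjective_pairing.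
  rewrite /rot /= -/th /cosm -/th.
  have e1 : (2 * k.+1%:R + 1) * th = (2 * k%:R + 2) * th + th by rewrite -natr1; ring.
  have e2 : 2 * k.+1%:R * th = (2 * k%:R + 1) * th + th by rewrite -natr1; ring.
  have e3 : (2 * k.+1%:R - 1) * th = 2 * k%:R * th + th by rewrite -natr1; ring.
  have e4 : (2 * k%:R + 2) * th = (2 * k%:R + 1) * th + th by ring.
  have e5 : (2 * k%:R + 1) * th = 2 * k%:R * th + th by ring.
  have e6 : (2 * k%:R + 2) * th - th = (2 * k%:R + 1) * th by ring.
  have e7 : (2 * k%:R + 1) * th - th = 2 * k%:R * th by ring.
  have e8 : 2 * k%:R * th - th = (2 * k%:R - 1) * th by ring.
  have r1 := rec ((2 * k%:R + 2) * th); have r2 := rec ((2 * k%:R + 1) * th).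
  have r3 := rec (2 * k%:R * th); rewrite e6 in r1; rewrite e7 in r2; rewrite e8 in r3.
  rewrite e1 e2 e3 r1 e4 r2 -e5; rewrite -e5 in r3.
  have -> : sin ((2 * k%:R - 1) * th) = 2 * cos th * sin (2 * k%:R * th) - sin ((2 * k%:R + 1) * th).
    by rewrite r3; ring.
  by congr (_, _); field.
have emt : m%:R * th = pi by rewrite /th; field.
rewrite E.
have -> : sin (2 * m%:R * th) = 0.
  by rewrite -mulrA emt mulrC mulr_natr sin2pi.
have -> : sin ((2 * m%:R + 1) * th) = sin th.
  have -> : (2 * m%:R + 1) * th = th + (pi + pi) by rewrite -emt; ring.
  by rewrite addrA !sinDpi opprK.
have -> : sin ((2 * m%:R - 1) * th) = - sin th.
  have -> : (2 * m%:R - 1) * th = - th + (pi + pi) by rewrite -emt; ring.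
  by rewrite addrA !sinDpi opprK sinN.
by rewrite !mulr0 subr0 sub0r mulrN opprK !mulfK // -surjective_pairing.
Qed.

End CosBounds.

Section Diagram.
Variables (R : realType) (W : finGroupType) (S : {set W}).
Hypothesis SC : coxeter_system S.

Lemma coxeter_sq s : s \in S -> (s * s)%g = 1%g.
Proof.
by case: SC => S2 _ _ sS; have := expg_order s; rewrite S2 // expgS expg1.
Qed.

Lemma coxeter_order_sym s t : s \in S -> t \in S -> #[s * t]%g = #[t * s]%g.
Proof.
move=> sS tS; rewrite -[RHS](orderJ _ t); congr #[_]%g.
rewrite /conjg !mulgA mulVg mul1g; done.
Qed.

Lemma coxeter_order_ge2 s t : s \in S -> t \in S -> s != t -> (2 <= #[s * t]%g)%N.
Proof.
move=> sS tS st; rewrite ltnNge; apply/negP => h.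
have /eqP : #[s * t]%g = 1%N by apply/eqP; rewrite eqn_leq h order_gt0.
rewrite order_eq1 => /eqP h1; move/eqP: st; apply.
by apply: (mulIg t); rewrite h1 coxeter_sq.
Qed.

Definition tits (s t : W) : R := if s == t then 1 else - cosm R #[s * t]%g.

Lemma tits_sym s t : s \in S -> t \in S -> tits s t = tits t s.
Proof. by move=> sS tS; rewrite /tits eq_sym (coxeter_order_sym sS tS). Qed.

Lemma tits_lt1 s t : s \in S -> t \in S -> s != t -> tits s t ^+ 2 < 1.
Proof.
move=> sS tS st; rewrite /tits (negPf st) sqrrN.
have m2 := coxeter_order_ge2 sS tS st; set m := #[_]%g in m2 *.
have := cos2Dsin2 (pi / m%:R : R); rewrite -/(cosm R m).
have : 0 < sin (pi / m%:R : R).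
  have m0 : (0 < m)%N by apply: leq_trans m2.
  apply: sin_gt0_pi; rewrite divr_gt0 ?pi_gt0 ?ltr0n //=.
  by rewrite ltr_pdivrMr ?ltr0n // ltr_pMr ?pi_gt0 // ltr1n.
by nra.
Qed.

Lemma tits_positive (x : W -> R) : (exists2 s, s \in S & x s != 0) ->
  0 < \sum_(s in S) \sum_(t in S) x s * x t * tits s t.
Proof.
apply: (gram_positive SC).
- exact: tits_sym.
- by move=> s _; rewrite /tits eqxx.
- exact: tits_lt1.
- move=> s t sS tS st p; rewrite /tits (negPf st).
  by apply: cosm_rot; apply: coxeter_order_ge2.
Qed.

Lemma tits_list (L : seq W) (a : seq R) : uniq L -> all (fun s => s \in S) L ->
  size a = size L -> has (fun c => c != 0) a ->
  0 < \sum_(0 <= i < size L) \sum_(0 <= j < size L)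
        a`_i * a`_j * tits (nth 1%g L i) (nth 1%g L j).
Proof.
move=> uL LS sa /(has_nthP 0) [i0 i0a ai0].
pose x u := a`_(index u L).
have xout u : u \notin L -> x u = 0.
  move=> uL'; rewrite /x nth_default // sa leqNgt index_mem; exact: uL'.
have conv (F : W -> R) : (forall u, u \notin L -> F u = 0) ->
    \sum_(s in S) F s = \sum_(0 <= i < size L) F (nth 1%g L i).
  move=> F0; rewrite -(big_nth 1%g predT F) (big_uniq _ uL) /=.
  rewrite big_mkcond [RHS]big_mkcond; apply: eq_bigr => u _.
  case: (boolP (u \in L)) => [uL'|/F0 ->]; last by case: ifP.
  by rewrite (allP LS).
have pos : 0 < \sum_(s in S) \sum_(t in S) x s * x t * tits s t.
  apply: tits_positive; exists (nth 1%g L i0); rewrite sa in i0a.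
    by apply: (allP LS); apply: mem_nth.
  by rewrite /x index_uniq.
rewrite conv in pos; last first.
  by move=> u /xout ->; rewrite big1 // => t _; rewrite !mul0r.
apply: lt_le_trans pos _; rewrite le_eqVlt; apply/orP; left; apply/eqP.
rewrite !big_nat; apply: eq_bigr => i /= iL.
rewrite conv; last by move=> u /xout ->; rewrite mulr0 mul0r.
rewrite !big_nat; apply: eq_bigr => j /= jL.
by rewrite /x !index_uniq.
Qed.

Definition adjacent (s t : W) := [&& s \in S, t \in S, s != t & (3 <= #[s * t]%g)%N].

Lemma nonadjacent_order s t : s \in S -> t \in S -> s != t -> ~~ adjacent s t ->
  #[s * t]%g = 2%N.
Proof.
move=> sS tS st; rewrite /adjacent sS tS st /= -ltnNge ltnS => h.
by apply/eqP; rewrite eqn_leq h coxeter_order_ge2.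
Qed.

Let c (s t : W) : R := cosm R #[s * t]%g.

Let c0 s t : s \in S -> t \in S -> s != t -> 0 <= c s t.
Proof. by move=> sS tS st; apply/cosm_ge0/coxeter_order_ge2. Qed.
Let c3 s t : adjacent s t -> 1 / 2 <= c s t.
Proof. by case/and4P => _ _ _; apply: cosm3_ge. Qed.
Let csym s t : s \in S -> t \in S -> c s t = c t s.
Proof. by move=> sS tS; rewrite /c coxeter_order_sym. Qed.

(** The next three lemmas are the instances of the positivity of the Tits form on
which the restrictions on diagrams rest. *)
Lemma tits3 s t u (x y z : R) : s \in S -> t \in S -> u \in S ->
  uniq [:: s; t; u] -> x != 0 ->
  0 < x * x + y * y + z * z - 2 * (x * y * c s t + x * z * c s u + y * z * c t u).
Proof.
move=> sS tS uS uq x0; have := @tits_list [:: s; t; u] [:: x; y; z] uq.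
rewrite /= sS tS uS x0 => /(_ isT erefl isT).
move: (uq); rewrite /= !in_cons !in_nil !orbF !andbT negb_or => /andP[/andP[st su] tu].
rewrite !big_nat_recl // !big_geq //= /tits !eqxx (negPf st) (negPf su) (negPf tu).
rewrite ![_ == s]eq_sym (negPf st) (negPf su) ![u == t]eq_sym (negPf tu).
rewrite -/(c s t) -/(c s u) -/(c t u) -/(c t s) -/(c u s) -/(c u t).
rewrite (csym tS sS) (csym uS sS) (csym uS tS).
by move=> h; apply: lt_le_trans h _; rewrite le_eqVlt; apply/orP; left; apply/eqP; ring.
Qed.

Lemma tits4 s t u v (x y z w : R) : s \in S -> t \in S -> u \in S -> v \in S ->
  uniq [:: s; t; u; v] -> x != 0 ->
  0 < x * x + y * y + z * z + w * w
      - 2 * (x * y * c s t + x * z * c s u + x * w * c s v + y * z * c t u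
             + y * w * c t v + z * w * c u v).
Proof.
move=> sS tS uS vS uq x0; have := @tits_list [:: s; t; u; v] [:: x; y; z; w] uq.
rewrite /= sS tS uS vS x0 => /(_ isT erefl isT).
move: (uq); rewrite /= !in_cons !in_nil !orbF !andbT !negb_or.
move=> /and3P[/and3P[st su sv] /andP[tu tv] uv].
rewrite !big_nat_recl // !big_geq //= /tits !eqxx.
rewrite (negPf st) (negPf su) (negPf sv) (negPf tu) (negPf tv) (negPf uv).
rewrite ![_ == s]eq_sym (negPf st) (negPf su) (negPf sv).
rewrite ![_ == t]eq_sym (negPf tu) (negPf tv) ![v == u]eq_sym (negPf uv).
rewrite -!/(c _ _).
rewrite (csym tS sS) (csym uS sS) (csym uS tS) (csym vS sS) (csym vS tS) (csym vS uS).
by move=> h; apply: lt_le_trans h _; rewrite le_eqVlt; apply/orP; left; apply/eqP; ring.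
Qed.

Lemma tits5 s t u v p (x y z w q : R) :
  s \in S -> t \in S -> u \in S -> v \in S -> p \in S ->
  uniq [:: s; t; u; v; p] -> x != 0 ->
  0 < x * x + y * y + z * z + w * w + q * q
      - 2 * (x * y * c s t + x * z * c s u + x * w * c s v + x * q * c s p
             + y * z * c t u + y * w * c t v + y * q * c t p
             + z * w * c u v + z * q * c u p + w * q * c v p).
Proof.
move=> sS tS uS vS pS uq x0.
have := @tits_list [:: s; t; u; v; p] [:: x; y; z; w; q] uq.
rewrite /= sS tS uS vS pS x0 => /(_ isT erefl isT).
move: (uq); rewrite /= !in_cons !in_nil !orbF !andbT !negb_or.
move=> /and4P[/and4P[st su sv sp] /and3P[tu tv tp] /andP[uv up] vp].
rewrite !big_nat_recl // !big_geq //= /tits !eqxx.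
rewrite (negPf st) (negPf su) (negPf sv) (negPf sp) (negPf tu) (negPf tv) (negPf tp).
rewrite (negPf uv) (negPf up) (negPf vp).
rewrite ![_ == s]eq_sym (negPf st) (negPf su) (negPf sv) (negPf sp).
rewrite ![_ == t]eq_sym (negPf tu) (negPf tv) (negPf tp).
rewrite ![_ == u]eq_sym (negPf uv) (negPf up) ![p == v]eq_sym (negPf vp).
rewrite -!/(c _ _).
rewrite (csym tS sS) (csym uS sS) (csym uS tS) (csym vS sS) (csym vS tS) (csym vS uS).
rewrite (csym pS sS) (csym pS tS) (csym pS uS) (csym pS vS).
by move=> h; apply: lt_le_trans h _; rewrite le_eqVlt; apply/orP; left; apply/eqP; ring.
Qed.

End Diagram.

Section DiagramShape.
Variables (R : realType) (W : finGroupType) (S : {set W}).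
Hypothesis SC : coxeter_system S.

Let c (s t : W) : R := cosm R #[s * t]%g.

Let c0 s t : s \in S -> t \in S -> s != t -> 0 <= c s t.
Proof. by move=> sS tS st; apply/cosm_ge0/(coxeter_order_ge2 SC). Qed.
Let c3 s t : adjacent S s t -> 1 / 2 <= c s t.
Proof. by case/and4P => _ _ _; apply: cosm3_ge. Qed.
Let c4 s t : (4 <= #[s * t]%g)%N -> 7 / 10 <= c s t.
Proof. exact: cosm4_ge. Qed.

Let adjS s t : adjacent S s t -> [/\ s \in S, t \in S & s != t].
Proof. by case/and4P. Qed.

(** In this and the next lemmas a larger label or a further edge would make the
Tits form nonpositive on an explicit rational vector, cos (pi / 5) being at
least 4 / 5. *)
Lemma heavy_neighbour s t u : adjacent S s t -> (5 <= #[s * t]%g)%N ->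
  adjacent S t u -> s != u ->
  [/\ #[s * t]%g = 5%N, #[t * u]%g = 3%N & ~~ adjacent S s u].
Proof.
move=> ast h5 atu su; have [sS tS st] := adjS ast; have [_ uS tu] := adjS atu.
have uq : uniq [:: s; t; u] by rewrite /= !in_cons !in_nil !orbF negb_or st su tu.
have cst : 4 / 5 <= c s t by apply: cosm5_ge.
have ctu := c3 atu; have csu := c0 sS uS su.
split.
- apply/eqP; rewrite eqn_leq h5 andbT leqNgt; apply/negP => h6.
  have c6 : 3 / 4 <= c s t ^+ 2 by apply: cosm6_ge.
  have x0 : c s t != 0 by apply/eqP => e; move: cst; rewrite e; lra.
  have := tits3 SC (x := c s t) 1 (1 / 2) sS tS uS uq x0.
  rewrite -!/(c _ _); have := mulr_ge0 (le_trans (_ : 0 <= 4 / 5) cst) csu.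
  by move=> /(_ ltac:(lra)) h1; nra.
- apply/eqP; rewrite eqn_leq; case/and4P: (atu) => _ _ _ ->; rewrite andbT.
  rewrite leqNgt; apply/negP => /c4 h4.
  have x0 : (4 / 5 : R) != 0 by apply/eqP; lra.
  have := tits3 SC (x := 4 / 5) 1 (7 / 10) sS tS uS uq x0; rewrite -!/(c _ _); lra.
- apply/negP => /c3 h3.
  have x0 : (1 : R) != 0 by apply/eqP; lra.
  have := tits3 SC (x := 1) 1 1 sS tS uS uq x0; rewrite -!/(c _ _); lra.
Qed.

Lemma heavy_isolated s t u v : adjacent S s t -> (5 <= #[s * t]%g)%N ->
  adjacent S t u -> s != u -> v \in S -> v \notin [:: s; t; u] ->
  ~~ adjacent S s v /\ ~~ adjacent S t v.
Proof.
move=> ast h5 atu su vS; rewrite !in_cons in_nil orbF !negb_or => /and3P[vs vt vu].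
have [sS tS st] := adjS ast; have [_ uS tu] := adjS atu.
have cst : 4 / 5 <= c s t by apply: cosm5_ge.
have ctu := c3 atu; have csu := c0 sS uS su.
have cuv : 0 <= c u v by apply: c0; rewrite // eq_sym.
have csv : 0 <= c s v by apply: c0; rewrite // eq_sym.
have ctv : 0 <= c t v by apply: c0; rewrite // eq_sym.
have uq : uniq [:: s; t; u; v].
  rewrite /= !in_cons !in_nil !orbF !negb_or st su tu.
  by rewrite ![_ == v]eq_sym vs vt vu.
split; apply/negP => /c3 h3.
  have x0 : (2 : R) != 0 by apply/eqP; lra.
  have := tits4 SC (x := 2) 2 1 1 sS tS uS vS uq x0; rewrite -!/(c _ _); lra.
have x0 : (8 / 5 : R) != 0 by apply/eqP; lra.
have := tits4 SC (x := 8 / 5) 2 1 1 sS tS uS vS uq x0; rewrite -!/(c _ _); lra.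
Qed.

Lemma heavy_chain s t u w : adjacent S s t -> (5 <= #[s * t]%g)%N ->
  adjacent S t u -> s != u -> adjacent S u w -> w \notin [:: s; t] ->
  #[u * w]%g = 3%N /\
  forall v, v \in S -> v \notin [:: s; t; u; w] ->
            ~~ adjacent S u v /\ ~~ adjacent S w v.
Proof.
move=> ast h5 atu su auw; rewrite !in_cons in_nil orbF negb_or => /andP[ws wt].
have [sS tS st] := adjS ast; have [_ uS tu] := adjS atu; have [_ wS uw] := adjS auw.
have cst : 4 / 5 <= c s t by apply: cosm5_ge.
have ctu := c3 atu; have csu := c0 sS uS su; have cuw := c3 auw.
have csw : 0 <= c s w by apply: c0; rewrite // eq_sym.
have ctw : 0 <= c t w by apply: c0; rewrite // eq_sym.
have uq : uniq [:: s; t; u; w].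
  by rewrite /= !in_cons !in_nil !orbF !negb_or st su tu uw ![_ == w]eq_sym ws wt.
have x0 : (4 / 5 : R) != 0 by apply/eqP; lra.
split=> [|v vS].
  apply/eqP; rewrite eqn_leq; case/and4P: (auw) => _ _ _ ->; rewrite andbT.
  rewrite leqNgt; apply/negP => /c4 h4.
  by have := tits4 SC (x := 4 / 5) 1 1 (7 / 10) sS tS uS wS uq x0; rewrite -!/(c _ _); lra.
rewrite !in_cons in_nil orbF !negb_or => /and4P[vs vt vu vw].
have csv : 0 <= c s v by apply: c0; rewrite // eq_sym.
have ctv : 0 <= c t v by apply: c0; rewrite // eq_sym.
have cuv : 0 <= c u v by apply: c0; rewrite // eq_sym.
have cwv : 0 <= c w v by apply: c0; rewrite // eq_sym.
have uq5 : uniq [:: s; t; u; w; v].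
  move: uq; rewrite /= !in_cons !in_nil !orbF !negb_or.
  by rewrite ![_ == v]eq_sym vs vt vu vw !andbT.
split; apply/negP => /c3 h3.
  have := tits5 SC (x := 4 / 5) 1 1 (1 / 2) (1 / 2) sS tS uS wS vS uq5 x0.
  by rewrite -!/(c _ _); lra.
have := tits5 SC (x := 4 / 5) 1 (3 / 4) (1 / 2) (1 / 4) sS tS uS wS vS uq5 x0.
by rewrite -!/(c _ _); lra.
Qed.

(** The diagram is a forest: on a set where every vertex has two neighbours,
the constant vector would be nonpositive for the Tits form. *)
Lemma diagram_leaf (U : {set W}) : U \subset S -> U != finset.set0 ->
  exists2 s, s \in U & forall t t', t \in U -> t' \in U ->
    adjacent S s t -> adjacent S s t' -> t = t'.
Proof.
move=> US /set0Pn [s0 s0U]; apply: contrapT => no.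
have US' s : s \in U -> s \in S by apply: (fintype.subsetP US).
have := @tits_positive R W S SC (fun s => (s \in U)%:R).
move=> /(_ (ex_intro2 _ _ s0 (US' _ s0U) _)); rewrite s0U oner_eq0 => /(_ isT).
rewrite ltNge => /negP; apply; apply: sumr_le0 => s sS.
case: (boolP (s \in U)) => sU; last by rewrite big1 // => t _; rewrite !mul0r.
have [t [t' [tU t'U ast ast' tt']]] : exists t t', [/\ t \in U, t' \in U,
    adjacent S s t, adjacent S s t' & t <> t'].
  apply: contrapT => no'; apply: no; exists s => // t t' tU t'U ast ast'.
  by apply: contrapT => tt'; apply: no'; exists t, t'.
have [_ tS st] := adjS ast; have [_ t'S st'] := adjS ast'.
have F u : u \in S -> u != s -> 1 * (u \in U)%:R * tits R s u <= 0.
  move=> uS us; rewrite mul1r; apply: mulr_ge0_le0; first by rewrite ler0n.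
  by rewrite /tits eq_sym (negPf us) oppr_le0; apply: c0; rewrite // eq_sym.
rewrite (big_setD1 s) //= (big_setD1 t) /=; last by rewrite in_setD1 eq_sym st.
rewrite (big_setD1 t') /=; last first.
  rewrite !in_setD1 t'S andbT; apply/andP; split; last by rewrite eq_sym.
  by apply/eqP => e; apply: tt'.
have : \sum_(i in (((S :\ s) :\ t) :\ t')%SET) 1 * (i \in U)%:R * tits R s i <= 0.
  by apply: sumr_le0 => u; rewrite !in_setD1 => /and4P[_ _ us uS]; apply: F.
rewrite /= sU tU t'U !mul1r /tits eqxx (negPf st) (negPf st').
by have := c3 ast; have := c3 ast'; rewrite /c; lra.
Qed.

End DiagramShape.

(** * Angles between mirrors *)

Section Angles.
Variables (R : realType) (E : lmodType R) (g : E -> E -> R).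
Variables (W : finGroupType) (act : W -> E -> E).
Hypotheses (gP : inner_product g) (actP : orthogonal_action g act).

Let reflects_eq u u' x x' : reflects g act u x -> reflects g act u' x' ->
  x = x' \/ x = - x' -> u = u'.
Proof.
move=> ux ux' [e|e]; apply: (reflects_uniq gP actP ux); rewrite e //.
exact: (reflectsN gP).
Qed.

Section Pair.
Variables (s t : W) (a b : E).
Hypotheses (sa : reflects g act s a) (tb : reflects g act t b) (st : s != t).
Let ss : (s * s)%g = 1%g. Proof. exact: (reflectsK gP actP sa). Qed.
Let tt : (t * t)%g = 1%g. Proof. exact: (reflectsK gP actP tb). Qed.
Let sV : s^-1%g = s. Proof. exact: (reflectsV gP actP sa). Qed.
Let tV : t^-1%g = t. Proof. exact: (reflectsV gP actP tb). Qed.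
Let free p q : p *: a + q *: b = 0 -> p = 0 /\ q = 0.
Proof. exact: (reflects_free gP actP sa tb st). Qed.
Let c := g a b.
Let c1 : c ^+ 2 < 1. Proof. exact: (reflects_neq gP actP sa tb st). Qed.

Lemma act_pair_l p q : act s (p *: a + q *: b) = (- p - 2 * c * q) *: a + q *: b.
Proof.
case: sa => a1 sx; rewrite sx /refl !(ipE gP) a1 (ipC gP b a) -/c addrAC -scalerBl.
by congr (_ *: _ + _); ring.
Qed.

Lemma act_pair_r p q : act t (p *: a + q *: b) = p *: a + (- q - 2 * c * p) *: b.
Proof.
case: tb => b1 tx; rewrite tx /refl !(ipE gP) b1 -/c -addrA -scalerBl.
by congr (_ + _ *: _); ring.
Qed.

Let aE : a = 1 *: a + 0 *: b. Proof. by rewrite scale1r scale0r addr0. Qed.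
Let bE : b = 0 *: a + 1 *: b. Proof. by rewrite scale1r scale0r add0r. Qed.

Let pairE p q p' q' : p *: a + q *: b = p' *: a + q' *: b -> p = p' /\ q = q'.
Proof.
move=> h; have [] := @free (p - p') (q - q').
  by rewrite !scalerBl addrACA h -opprD subrr.
by move=> /eqP; rewrite subr_eq0 => /eqP -> /eqP; rewrite subr_eq0 => /eqP ->.
Qed.

Let pairEN p q p' q' : p *: a + q *: b = - (p' *: a + q' *: b) ->
  p = - p' /\ q = - q'.
Proof. by rewrite opprD -!scaleNr; apply: pairE. Qed.

Let order2P : #[s * t]%g = 2%N <-> (s * t = t * s)%g.
Proof.
split=> [h|h].
  have := expg_order (s * t)%g; rewrite h expgS expg1 => e.
  by apply/eqP; rewrite eq_sym -(inj_eq (mulgI (s * t)%g)) e !mulgA -(mulgA s) tt mulg1 ss.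
have d : (#[s * t]%g %| 2)%N.
  by rewrite order_dvdn expgS expg1 {2}h !mulgA -(mulgA s) tt mulg1 ss.
move: d; rewrite dvdn_divisors // !in_cons in_nil orbF => /orP[|/eqP //].
rewrite order_eq1 => /eqP e; move/eqP: st; case.
by apply: (mulIg t); rewrite e tt.
Qed.

Lemma order2_ip : #[s * t]%g = 2%N <-> c = 0.
Proof.
have tst : reflects g act (t * s * t^-1)%g (act t a) by apply: reflects_conj.
have ta : act t a = 1 *: a + (- 2 * c) *: b.
  by rewrite {1}aE act_pair_r; congr (_ + _ *: _); ring.
rewrite order2P; split=> [h|h].
  have e : (t * s * t^-1)%g = s by rewrite -h mulgK.
  rewrite e in tst; case: (reflects_root gP sa tst) => e'.
    by move: e'; rewrite ta {1}aE => /pairE []; lra.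
  by move: e'; rewrite ta {1}aE => /pairEN []; lra.
have e : (t * s * t^-1)%g = s.
  apply: (reflects_eq tst sa); left; rewrite ta h.
  by rewrite mulr0 scale0r scale1r addr0.
by rewrite -{1}e mulgKV.
Qed.

Lemma order3_ip : #[s * t]%g = 3%N -> 4 * c ^+ 2 = 1.
Proof.
move=> h; have := expg_order (s * t)%g; rewrite h !expgS expg0 mulg1 => e.
have e1 : (s * t * s^-1 = t * s * t^-1)%g.
  apply: (mulIg (t * s * t)%g); rewrite sV tV.
  have -> : (s * t * s * (t * s * t) = s * t * (s * t * (s * t)))%g by rewrite !mulgA.
  rewrite e !mulgA -(mulgA _ t t) tt mulg1 -(mulgA _ s s) ss mulg1; done.
have h1 := reflects_conj gP actP s tb; have h2 := reflects_conj gP actP t sa.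
rewrite e1 in h1.
have sb : act s b = (- 2 * c) *: a + 1 *: b.
  by rewrite {1}bE act_pair_l; congr (_ *: _ + _); ring.
have ta : act t a = 1 *: a + (- 2 * c) *: b.
  by rewrite {1}aE act_pair_r; congr (_ + _ *: _); ring.
case: (reflects_root gP h1 h2); rewrite sb ta.
  by move/pairE => [e2 _]; nra.
by move/pairEN => [e2 _]; nra.
Qed.

Lemma order5_ip : #[s * t]%g = 5%N ->
  (4 * c ^+ 2 + 2 * c - 1) * (4 * c ^+ 2 - 2 * c - 1) = 0.
Proof.
move=> h; have := expg_order (s * t)%g; rewrite h !expgS expg0 mulg1 => e.
have e1 : ((s * t) * s * (s * t)^-1 = (t * s) * t * (t * s)^-1)%g.
  rewrite !invMg sV tV; apply: (mulIg (t * s * t * s * t)%g).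
  have -> : (s * t * s * (t * s) * (t * s * t * s * t) =
             s * t * (s * t * (s * t * (s * t * (s * t)))))%g by rewrite !mulgA.
  rewrite e !mulgA -(mulgA _ t t) tt mulg1 -(mulgA _ s s) ss mulg1.
  by rewrite -(mulgA _ t t) tt mulg1 -(mulgA _ s s) ss mulg1 tt.
have h1 := reflects_conj gP actP (s * t)%g sa.
have h2 := reflects_conj gP actP (t * s)%g tb.
rewrite e1 in h1.
have sta : act (s * t)%g a = (4 * c ^+ 2 - 1) *: a + (- 2 * c) *: b.
  rewrite (actMl actP) {1}aE act_pair_r act_pair_l.
  by congr (_ *: _ + _ *: _); ring.
have tsb : act (t * s)%g b = (- 2 * c) *: a + (4 * c ^+ 2 - 1) *: b.
  rewrite (actMl actP) {1}bE act_pair_l act_pair_r.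
  by congr (_ *: _ + _ *: _); ring.
case: (reflects_root gP h1 h2); rewrite sta tsb.
  by move/pairE => [e2 _]; rewrite (_ : 4 * c ^+ 2 + 2 * c - 1 = 0) ?mul0r //; lra.
by move/pairEN => [e2 _]; rewrite (_ : 4 * c ^+ 2 - 2 * c - 1 = 0) ?mulr0 //; lra.
Qed.

Lemma ip_order5 : (4 * c ^+ 2 + 2 * c - 1) * (4 * c ^+ 2 - 2 * c - 1) = 0 ->
  #[s * t]%g = 5%N.
Proof.
move=> h.
have h1 := reflects_conj gP actP (s * t)%g sa.
have h2 := reflects_conj gP actP (t * s)%g tb.
have sta : act (s * t)%g a = (4 * c ^+ 2 - 1) *: a + (- 2 * c) *: b.
  rewrite (actMl actP) {1}aE act_pair_r act_pair_l.
  by congr (_ *: _ + _ *: _); ring.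
have tsb : act (t * s)%g b = (- 2 * c) *: a + (4 * c ^+ 2 - 1) *: b.
  rewrite (actMl actP) {1}bE act_pair_l act_pair_r.
  by congr (_ *: _ + _ *: _); ring.
have e1 : ((s * t) * s * (s * t)^-1 = (t * s) * t * (t * s)^-1)%g.
  apply: (reflects_eq h1 h2); rewrite sta tsb.
  move/eqP: h; rewrite mulf_eq0 => /orP[]/eqP h; [left|right].
    by congr (_ *: _ + _ *: _); lra.
  by rewrite -[RHS]scaleN1r scalerDr !scalerA; congr (_ *: _ + _ *: _); lra.
have d : (#[s * t]%g %| 5)%N.
  rewrite order_dvdn !expgS expg0 mulg1; apply/eqP.
  have -> : (s * t * (s * t * (s * t * (s * t * (s * t)))) =
      (s * t * s * (t * s)) * (t * s * t * s * t))%g by rewrite !mulgA.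
  have -> : (s * t * s * (t * s) = (t * s) * t * (t * s)^-1)%g.
    by rewrite -e1 invMg sV tV.
  rewrite invMg sV tV !mulgA -(mulgA _ t t) tt mulg1 -(mulgA _ s s) ss mulg1.
  by rewrite -(mulgA _ t t) tt mulg1 -(mulgA _ s s) ss mulg1 tt.
move: d; rewrite dvdn_divisors // !in_cons in_nil orbF => /orP[|/eqP //].
rewrite order_eq1 => /eqP e; move/eqP: st; case.
by apply: (mulIg t); rewrite e tt.
Qed.

End Pair.

Lemma order4_ip s t a b : reflects g act s a -> reflects g act t b -> s != t ->
  #[s * t]%g = 4%N -> 2 * g a b ^+ 2 = 1.
Proof.
move=> sa tb st h.
have ss := reflectsK gP actP sa; have tt := reflectsK gP actP tb.
have tV := reflectsV gP actP tb.
have ta : act t a = 1 *: a + (- 2 * g a b) *: b.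
  case: tb => _ ->; rewrite /refl scale1r -scaleNr; congr (_ + _ *: _); ring.
have tst := reflects_conj gP actP t sa.
have e := expg_order (s * t)%g; rewrite h in e.
have su : s != (t * s * t^-1)%g.
  apply/eqP => e'; have : (#[s * t]%g %| 2)%N; last by rewrite h.
  rewrite order_dvdn expgS expg1 {1}e' tV -(mulgA _ t t) tt mulg1.
  by rewrite !mulgA -(mulgA _ s s) ss mulg1 tt.
have o2 : #[s * (t * s * t^-1)]%g = 2%N.
  have d : (#[s * (t * s * t^-1)]%g %| 2)%N.
    rewrite order_dvdn -e !expgS expg0 !mulg1 tV !mulgA; done.
  move: d; rewrite dvdn_divisors // !in_cons in_nil orbF => /orP[|/eqP //].
  rewrite order_eq1 => /eqP e'; move/eqP: su; case.
  by apply: (mulIg (t * s * t^-1)%g); rewrite e' (reflectsK gP actP tst).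
have := (order2_ip sa tst su).1 o2; case: (sa) => a1 _.
by rewrite ta !(ipE gP) a1; lra.
Qed.

Lemma order_rot s t a b p : reflects g act s a -> reflects g act t b -> s != t ->
  iter #[s * t]%g (rot (g a b)) p = p.
Proof.
move=> sa tb st.
have itE k x : iter k (act (s * t)%g) (x.1 *: a + x.2 *: b) =
    (iter k (rot (g a b)) x).1 *: a + (iter k (rot (g a b)) x).2 *: b.
  elim: k => //= k ->; rewrite (actMl actP) (act_pair_r a tb) (act_pair_l b sa).
  by rewrite /rot /=; congr (_ *: _ + _ *: _); ring.
have X k x : iter k (act (s * t)%g) x = act ((s * t) ^+ k)%g x.
  elim: k => [|k /= ->]; first by rewrite expg0 (act1l gP actP).
  by rewrite expgS [RHS](actMl actP).
have := itE #[s * t]%g p; rewrite X expg_order (act1l gP actP) => /eqP.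
set q := iter _ _ _; rewrite -subr_eq0 opprD addrACA -!scalerBl => /eqP.
move/(reflects_free gP actP sa tb st) => [].
move=> /eqP; rewrite subr_eq0 => /eqP e1 /eqP; rewrite subr_eq0 => /eqP e2.
by rewrite (surjective_pairing p) e1 e2 -surjective_pairing.
Qed.

(** * Reflections bounding a chamber of their dihedral group *)

(** The roots r s and r t, one of them negated if their product is positive,
form a simple system of the dihedral group generated by s and t. *)
Definition adapted (r : W -> E) (s t : W) : Prop :=
  forall d u, d \in <<[set s; t]%SET>>%g -> u \in [set s; t]%SET ->
  exists p q, act d (r u) = p *: r s + q *: r t /\ p * q * g (r s) (r t) <= 0.

Lemma adapted_sym r s t : adapted r s t -> adapted r t s.
Proof.
move=> h d u; rewrite finset.setUC => dD uD; have [p [q [e pq]]] := h d u dD uD.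
exists q, p; rewrite addrC; split=> //.
by rewrite (ipC gP); have -> : q * p = p * q by ring.
Qed.

(** To prove adaptedness it suffices to list the coordinates of the positive roots
of the dihedral group. *)
Lemma adapted_list (r : W -> E) (s t : W) (k : R) (L : seq (R * R)) :
  reflects g act s (r s) -> reflects g act t (r t) ->
  k = 2 * `|g (r s) (r t)| ->
  (1, 0) \in L -> (0, 1) \in L ->
  (forall x, x \in L -> 0 <= x.1 /\ 0 <= x.2) ->
  (forall x, x \in L -> (k * x.2 - x.1, x.2) \in L \/ (x.1 - k * x.2, - x.2) \in L) ->
  (forall x, x \in L -> (x.1, k * x.1 - x.2) \in L \/ (- x.1, x.2 - k * x.1) \in L) ->
  adapted r s t.
Proof.
move=> sr tr kE L10 L01 Lpos Ls Lt d u dD uD.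
pose e : R := if 0 <= g (r s) (r t) then -1 else 1.
have ee : e * e = 1 by rewrite /e; case: ifP => _; ring.
have ek : 2 * g (r s) (r t) = - e * k.
  rewrite kE /e; case: ifP => [h|/negbT]; first by rewrite ger0_norm //; ring.
  by rewrite -ltNge => /ltW h; rewrite ler0_norm //; ring.
pose ok x := exists y h, [/\ y \in L, h * h = 1 :> R &
   x = (h * y.1) *: r s + (h * e * y.2) *: r t].
have oks x : ok x -> ok (act s x).
  move=> [y [h [yL hh ->]]]; rewrite (act_pair_l (r t) sr).
  have e1 : 2 * g (r s) (r t) * (h * e * y.2) = - (h * k * y.2).
    by rewrite ek; transitivity (- (e * e) * (h * k * y.2)); [ring|rewrite ee; ring].
  case: (Ls y yL) => yL'.
    exists (k * y.2 - y.1, y.2), h; split=> //=; congr (_ *: _ + _).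
    by rewrite e1; ring.
  exists (y.1 - k * y.2, - y.2), (- h); split=> //=; first by rewrite mulrNN.
  by congr (_ *: _ + _ *: _); rewrite ?e1; ring.
have okt x : ok x -> ok (act t x).
  move=> [y [h [yL hh ->]]]; rewrite (act_pair_r (r s) tr).
  have e1 : 2 * g (r s) (r t) * (h * y.1) = - (h * e * k * y.1).
    by rewrite ek; ring.
  case: (Lt y yL) => yL'.
    exists (y.1, k * y.1 - y.2), h; split=> //=; congr (_ + _ *: _).
    by rewrite e1; ring.
  exists (- y.1, y.2 - k * y.1), (- h); split=> //=; first by rewrite mulrNN.
  by congr (_ *: _ + _ *: _); rewrite ?e1; ring.
have [v vA <-] := gen_word dD.
have : ok (act (wprod v) (r u)).
  elim: v vA => [_|x v IH /= /andP[xA /IH okv]].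
    rewrite wprod0 (act1l gP actP); move: uD; rewrite in_set2 => /orP[]/eqP ->.
      exists (1, 0), 1; split=> //=; first by ring.
      by rewrite mulr1 mulr0 scale1r scale0r addr0.
    exists (0, 1), e; split=> //=.
    by rewrite mulr0 mulr1 ee scale1r scale0r add0r.
  rewrite wprod_cons (actMl actP).
  by move: xA; rewrite in_set2 => /orP[]/eqP ->; [apply: oks|apply: okt].
move=> [y [h [yL hh eq]]]; exists (h * y.1), (h * e * y.2); split=> //.
have [y1 y2] := Lpos y yL.
have -> : h * y.1 * (h * e * y.2) * g (r s) (r t) = - (h * h) * (e * e) * (y.1 * y.2 * k) / 2.
  have -> : g (r s) (r t) = - e * k / 2 by rewrite -ek; field.
  by field.
rewrite hh ee; have k0 : 0 <= k by rewrite kE mulr_ge0.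
by have := mulr_ge0 (mulr_ge0 y1 y2) k0; lra.
Qed.

(** Only for orders at least five can the angle of two mirrors be a proper
multiple of pi divided by the order of the product. *)
Lemma adapted_or_heavy (r : W -> E) (s t : W) :
  reflects g act s (r s) -> reflects g act t (r t) -> s != t ->
  adapted r s t \/ (5 <= #[s * t]%g)%N /\
    (#[s * t]%g = 5%N -> 4 * g (r s) (r t) ^+ 2 + 2 * `|g (r s) (r t)| - 1 = 0).
Proof.
move=> sr tr st; set c := g (r s) (r t).
have cn : `|c| ^+ 2 = c ^+ 2 by rewrite -normrX ger0_norm // sqr_ge0.
have n0 : 0 <= `|c| by [].
have ad := adapted_list sr tr erefl; rewrite -/c in ad.
have p (x y z w : R) : x = z -> y = w -> (x, y) = (z, w) by move=> -> ->.
have [m5|m5] := leqP 5 #[s * t]%g; last first.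
  left; case m: #[s * t]%g m5 (order_gt0 (s * t)%g) => [|[|[|[|[|//]]]]] // _ _.
  - exfalso; move/eqP: m; rewrite order_eq1 => /eqP e; move/eqP: st; case.
    by apply: (mulIg t); rewrite e (reflectsK gP actP tr).
  - move/(order2_ip sr tr st): m; rewrite -/c => c0.
    apply: (ad [:: (1, 0); (0, 1)]); rewrite ?in_cons ?eqxx ?orbT //.
    + by move=> x; rewrite !in_cons in_nil orbF => /orP[]/eqP -> /=; lra.
    + rewrite c0 normr0 mulr0 => x; rewrite !in_cons !in_nil !orbF => /orP[]/eqP -> /=.
        by right; rewrite mul0r subr0 oppr0 eqxx.
      by left; rewrite mul0r subr0 eqxx orbT.
    + rewrite c0 normr0 mulr0 => x; rewrite !in_cons !in_nil !orbF => /orP[]/eqP -> /=.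
        by left; rewrite mul0r subr0 eqxx.
      by right; rewrite mul0r subr0 oppr0 eqxx orbT.
  - have := order3_ip sr tr st m; rewrite -/c -cn => c3.
    have ch : 2 * `|c| = 1.
      have : (2 * `|c| - 1) * (2 * `|c| + 1) = 0.
        by transitivity (4 * `|c| ^+ 2 - 1); [ring | rewrite c3; ring].
      by move/eqP; rewrite mulf_eq0 => /orP[]/eqP; lra.
    rewrite ch in ad.
    apply: (ad [:: (1, 0); (0, 1); (1, 1)]); rewrite ?in_cons ?eqxx ?orbT //.
    + by move=> x; rewrite !in_cons in_nil orbF => /or3P[]/eqP -> /=; lra.
    + move=> x; rewrite !in_cons !in_nil !orbF => /or3P[]/eqP -> /=.
      * by right; apply/orP; left; apply/eqP/p; ring.
      * by left; apply/or3P/Or33/eqP/p; ring.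
      * by left; apply/or3P/Or32/eqP/p; ring.
    + move=> x; rewrite !in_cons !in_nil !orbF => /or3P[]/eqP -> /=.
      * by left; apply/or3P/Or33/eqP/p; ring.
      * by right; apply/or3P/Or32/eqP/p; ring.
      * by left; apply/or3P/Or31/eqP/p; ring.
  - have := order4_ip sr tr st m; rewrite -/c -cn => c4.
    have k2 : (2 * `|c|) * (2 * `|c|) = 2 by nra.
    have k0 : 0 <= 2 * `|c| by lra.
    move: ad k2 k0; set k := 2 * `|c| => ad k2 k0.
    apply: (ad [:: (1, 0); (0, 1); (k, 1); (1, k)]); rewrite ?in_cons ?eqxx ?orbT //.
    + by move=> x; rewrite !in_cons in_nil orbF => /or4P[]/eqP -> /=; lra.
    + move=> x; rewrite !in_cons !in_nil !orbF => /or4P[]/eqP -> /=.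
      * by right; apply/or4P/Or41/eqP/p; ring.
      * by left; apply/or4P/Or43/eqP/p; ring.
      * by left; apply/or4P/Or42/eqP/p; ring.
      * by left; apply/or4P/Or44/eqP/p; lra.
    + move=> x; rewrite !in_cons !in_nil !orbF => /or4P[]/eqP -> /=.
      * by left; apply/or4P/Or44/eqP/p; ring.
      * by right; apply/or4P/Or42/eqP/p; ring.
      * by left; apply/or4P/Or43/eqP/p; lra.
      * by left; apply/or4P/Or41/eqP/p; ring.
have [m|m] := eqVneq #[s * t]%g 5%N; last first.
  by right; split=> // e; rewrite e eqxx in m.
have := order5_ip sr tr st m; rewrite -/c => h5.
have : (4 * `|c| ^+ 2 + 2 * `|c| - 1) * (4 * `|c| ^+ 2 - 2 * `|c| - 1) = 0.
  rewrite -h5 cn; have [h|/ltW h] := leP 0 c; first by rewrite ger0_norm.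
  by rewrite ler0_norm //; ring.
rewrite cn; move/eqP; rewrite mulf_eq0 => /orP[]/eqP h; first by right.
left; rewrite -cn in h; have k2 : (2 * `|c|) * (2 * `|c|) = 2 * `|c| + 1 by nra.
have k0 : 0 <= 2 * `|c| by lra.
move: ad k2 k0; set k := 2 * `|c| => ad k2 k0.
apply: (ad [:: (k, k); (1, 0); (0, 1); (k, 1); (1, k)]); rewrite ?in_cons ?eqxx ?orbT //.
- move=> x; rewrite !in_cons in_nil orbF => /orP[/eqP -> /= //|].
  by move=> /or4P[]/eqP -> /=; lra.
- move=> x; rewrite !in_cons !in_nil !orbF => /orP[/eqP -> /=|].
    by left; apply/orP; right; apply/or4P/Or44/eqP/p; lra.
  move=> /or4P[]/eqP -> /=.
  + by right; apply/orP; right; apply/or4P/Or41/eqP/p; ring.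
  + by left; apply/orP; right; apply/or4P/Or43/eqP/p; ring.
  + by left; apply/orP; right; apply/or4P/Or42/eqP/p; ring.
  + by left; apply/orP; left; apply/eqP/p; lra.
- move=> x; rewrite !in_cons !in_nil !orbF => /orP[/eqP -> /=|].
    by left; apply/orP; right; apply/or4P/Or43/eqP/p; lra.
  move=> /or4P[]/eqP -> /=.
  + by left; apply/orP; right; apply/or4P/Or44/eqP/p; ring.
  + by right; apply/orP; right; apply/or4P/Or42/eqP/p; ring.
  + by left; apply/orP; left; apply/eqP/p; lra.
  + by left; apply/orP; right; apply/or4P/Or41/eqP/p; ring.
Qed.

Lemma adapted_orth (r : W -> E) s t :
  reflects g act s (r s) -> reflects g act t (r t) -> g (r s) (r t) = 0 ->
  adapted r s t.
Proof.
move=> sr tr c0; have [->|st] := eqVneq s t.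
  move=> d u; rewrite finset.setUid finset.in_set1 => + /eqP ->.
  case/cycleP => k ->; exists ((-1) ^+ k), 0; rewrite scale0r addr0 mulr0 mul0r.
  split=> //; elim: k => [|k IH]; first by rewrite expg0 (act1l gP actP) scale1r.
  rewrite expgS (actMl actP) IH (actZ actP) (reflects_self tr).
  by rewrite exprS mulN1r scaleNr scalerN.
have [//|[m5 _]] := adapted_or_heavy sr tr st.
by have /(order2_ip sr tr st) m := c0; rewrite m in m5.
Qed.

End Angles.

(** * Adapted generators form a simple system *)

Lemma mul_ge0_sign (R : realType) (p q : R) : 0 <= p * q ->
  0 <= p /\ 0 <= q \/ p <= 0 /\ q <= 0.
Proof.
move=> pq; have [p0|p0] := leP 0 p; have [q0|q0] := leP 0 q; [by left| | |].
- have [->|p1] := eqVneq p 0; first by right; split=> //; apply: ltW.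
  have {}p1 : 0 < p by rewrite lt0r p1.
  by exfalso; nra.
- have [->|q1] := eqVneq q 0; first by right; split=> //; apply: ltW.
  have {}q1 : 0 < q by rewrite lt0r q1.
  by exfalso; nra.
- by right; split; apply: ltW.
Qed.

Section Glue.
Variables (R : realType) (E : lmodType R) (g : E -> E -> R).
Variables (W : finGroupType) (act : W -> E -> E).
Hypotheses (gP : inner_product g) (actP : orthogonal_action g act).

Lemma adapted_sign (r : W -> E) s t d u :
  reflects g act s (r s) -> reflects g act t (r t) -> s != t ->
  adapted g act r s t -> g (r s) (r t) <= 0 ->
  d \in <<[set s; t]%SET>>%g -> u \in [set s; t]%SET ->
  exists p q, act d (r u) = p *: r s + q *: r t /\
    (0 <= p /\ 0 <= q \/ p <= 0 /\ q <= 0).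
Proof.
move=> sr tr st ad c0 dD uD.
case: (eqVneq (g (r s) (r t)) 0) => c; last first.
  have [p [q [e pq]]] := ad d u dD uD; exists p, q; split=> //.
  have {}c0 : g (r s) (r t) < 0 by rewrite lt_neqAle c c0.
  have pq0 : 0 <= p * q by rewrite -(nmulr_lle0 _ c0).
  exact: mul_ge0_sign.
have sgn : act d (r u) = r u \/ act d (r u) = - r u.
  have [v + <-] := gen_word dD; elim: v => [_|x v IH /= /andP[xA /IH h]].
    by left; rewrite wprod0 (act1l gP actP).
  have xu : act x (r u) = r u \/ act x (r u) = - r u.
    have c' : g (r t) (r s) = 0 by rewrite (ipC gP).
    case: (sr) (tr) => [_ sx] [_ tx].
    move: xA uD; rewrite !in_set2 => /orP[]/eqP -> /orP[]/eqP ->.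
    - by right; apply: reflects_self sr.
    - by left; rewrite sx /refl c' mulr0 scale0r subr0.
    - by left; rewrite tx /refl c mulr0 scale0r subr0.
    - by right; apply: reflects_self tr.
  rewrite wprod_cons (actMl actP).
  case: h => ->; rewrite ?(actN actP) //.
  by case: xu => ->; rewrite ?opprK; [right|left].
have [e [e1 ->]] : exists e : R, (e = 1 \/ e = -1) /\ act d (r u) = e *: r u.
  case: sgn => ->; [exists 1|exists (-1)]; rewrite ?scale1r ?scaleN1r; split=> //.
    by left.
  by right.
move: uD; rewrite in_set2 => /orP[]/eqP ->.
  exists e, 0; rewrite scale0r addr0; split=> //.
  by case: e1 => ->; [left|right]; split; lra.
exists 0, e; rewrite scale0r add0r; split=> //.
by case: e1 => ->; [left|right]; split; lra.
Qed.

Lemma pair_exchange (r : W -> E) s t v u p q :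
  reflects g act s (r s) -> reflects g act t (r t) -> s != t ->
  adapted g act r s t -> g (r s) (r t) <= 0 ->
  word_in [set s; t]%SET v -> u \in [set s; t]%SET ->
  act (wprod v) (r u) = p *: r s + q *: r t -> p <= 0 -> q <= 0 ->
  exists v', [/\ word_in [set s; t]%SET v', (size v').+1 = size v &
                 wprod v' = (wprod v * u)%g].
Proof.
move=> sr tr st ad c0 vA uA.
have sA : s \in [set s; t]%SET by rewrite set21.
have tA : t \in [set s; t]%SET by rewrite set22.
have uniq p1 q1 p2 q2 : p1 *: r s + q1 *: r t = p2 *: r s + q2 *: r t -> p1 = p2 /\ q1 = q2.
  move=> h.
  have [] : p1 - p2 = 0 /\ q1 - q2 = 0.
    by apply: (reflects_free gP actP sr tr st); rewrite !scalerBl addrACA h -opprD subrr.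
  by move=> /eqP; rewrite subr_eq0 => /eqP -> /eqP; rewrite subr_eq0 => /eqP ->.
have rA x : x \in [set s; t]%SET -> reflects g act x (r x).
  by rewrite in_set2 => /orP[]/eqP ->.
elim: v p q vA => [|x v IH] p q.
  move=> _; rewrite wprod0 (act1l gP actP) => e p0 q0; exfalso.
  have : exists p1 q1, r u = p1 *: r s + q1 *: r t /\ 0 < p1 + q1.
    move: uA; rewrite in_set2 => /orP[]/eqP ->.
      by exists 1, 0; rewrite scale1r scale0r addr0; split=> //; lra.
    by exists 0, 1; rewrite scale1r scale0r add0r; split=> //; lra.
  by move=> [p1 [q1 [e1 h]]]; move: e; rewrite e1 => /uniq [? ?]; lra.
move=> /= /andP[xA vA] e p0 q0.
have [p1 [q1 [e1 [[p10 q10]|[p10 q10]]]]] :=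
    adapted_sign sr tr st ad c0 (word_gen vA) uA; last first.
  have [v' [vA' sz ev]] := IH p1 q1 vA e1 p10 q10.
  exists (x :: v'); split=> /=; [exact/andP|by rewrite sz|].
  by rewrite !wprod_cons ev mulgA.
have xr : act (wprod v) (r u) = r x.
  have u1 : g (act (wprod v) (r u)) (act (wprod v) (r u)) = 1.
    by rewrite (act_ip actP); have [-> _] := rA u uA.
  have sq1 (k : R) : 0 <= k -> k * k = 1 -> k = 1.
    move=> k0 kk; have : (k - 1) * (k + 1) = 0 by nra.
    by move/eqP; rewrite mulf_eq0 => /orP[]/eqP; lra.
  move: e; rewrite wprod_cons (actMl actP) e1.
  case: (sr) (tr) => [s1 _] [t1 _].
  move: xA; rewrite in_set2 => /orP[]/eqP ->.
    rewrite (act_pair_l gP (r t) sr) => /uniq [_ h].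
    have q00 : q1 = 0 by lra.
    rewrite e1 q00 scale0r addr0 (ipZl gP) (ipZr gP) s1 mulr1 in u1.
    by rewrite q00 scale0r addr0 (sq1 p1) ?scale1r.
  rewrite (act_pair_r gP (r s) tr) => /uniq [h _].
  have p00 : p1 = 0 by lra.
  rewrite e1 p00 scale0r add0r (ipZl gP) (ipZr gP) t1 mulr1 in u1.
  by rewrite p00 scale0r add0r (sq1 q1) ?scale1r.
exists v; split=> //.
have := reflects_conj gP actP (wprod v) (rA u uA); rewrite xr.
move/(reflects_uniq gP actP (rA x xA)) => ->.
by rewrite wprod_cons mulgKV -mulgA (reflectsK gP actP (rA u uA)) mulg1.
Qed.

Section Length.
Variables (S : {set W}) (r : W -> E).
Hypothesis rS : forall s, s \in S -> reflects g act s (r s).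
Hypothesis Sgen : forall w : W, w \in <<S>>%g.
Hypothesis Sad : forall s t, s \in S -> t \in S -> s != t ->
  adapted g act r s t /\ g (r s) (r t) <= 0.

Let is_len (w : W) (n : nat) : bool :=
  `[< exists v, [/\ word_in S v, size v = n & wprod v = w] >].
Let is_len_ex w : exists n, is_len w n.
Proof.
have [v vS e] := gen_word (Sgen w).
by exists (size v); apply/asboolP; exists v.
Qed.
Let len w := ex_minn (is_len_ex w).
Let lenP w : exists v, [/\ word_in S v, size v = len w & wprod v = w].
Proof. by rewrite /len; case: ex_minnP => n /asboolP. Qed.
Let len_le v : word_in S v -> (len (wprod v) <= size v)%N.
Proof.
move=> vS; rewrite /len; case: ex_minnP => n _; apply.
by apply/asboolP; exists v.
Qed.
Let lenMw w v : word_in S v -> (len (w * wprod v)%g <= len w + size v)%N.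
Proof.
move=> vS; have [a [aS sz e]] := lenP w.
rewrite -e -wprod_cat; apply: leq_trans (len_le _) _.
  by rewrite /word_in all_cat; apply/andP.
by rewrite size_cat sz e.
Qed.
Let sqS s : s \in S -> (s * s)%g = 1%g. Proof. by move/rS/(reflectsK gP actP). Qed.

Let coset_descent s t w : s \in S -> t \in S ->
  exists v a, [/\ word_in [set s; t]%SET a, w = (v * wprod a)%g,
    len w = (len v + size a)%N &
    forall u, u \in [set s; t]%SET -> (len v <= len (v * u)%g)%N].
Proof.
move=> sS tS; have AS u : u \in [set s; t]%SET -> u \in S.
  by rewrite in_set2 => /orP[]/eqP ->.
have [k] := ubnP (len w); elim: k w => // k IH w; rewrite ltnS => wk.
case: (pselect (exists2 u, u \in [set s; t]%SET & (len (w * u)%g < len w)%N)).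
  move=> [u uA lt]; have [v [a [aA e l min]]] := IH _ (leq_trans lt wk).
  exists v, (rcons a u); split=> //.
  - by rewrite /word_in all_rcons; apply/andP.
  - by rewrite wprod_rcons mulgA -e -mulgA sqS ?AS // mulg1.
  - rewrite size_rcons addnS -l; apply/eqP; rewrite eqn_leq lt andbT.
    have := @lenMw (w * u)%g [:: u]; rewrite /= AS // => /(_ isT).
    by rewrite /wprod big_seq1 -mulgA sqS ?AS // mulg1 addn1.
move=> no; exists w, [::]; split=> //; first by rewrite wprod0 mulg1.
  by rewrite addn0.
by move=> u uA; rewrite leqNgt; apply/negP => h; apply: no; exists u.
Qed.

(** Tits: if w s is not shorter than w, then w makes the root of s positive.
One reduces to the part of w in a dihedral subgroup containing s, where the
generators are adapted. *)
Let len_cone w s : s \in S -> (len w <= len (w * s)%g)%N ->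
  cone S r (act w (r s)).
Proof.
have [k] := ubnP (len w); elim: k w s => // k IH w s; rewrite ltnS => wk sS ws.
have [w1|/eqP w1] := eqVneq w 1%g.
  by rewrite w1 (act1l gP actP); apply: cone_gen.
have [t tS wt] : exists2 t, t \in S & (len (w * t)%g < len w)%N.
  have [v []] := lenP w; case/lastP: v => [_ _|v t].
    by rewrite wprod0 => e; case: w1.
  rewrite /word_in all_rcons size_rcons wprod_rcons => /andP[tS vS] sz e.
  by exists t => //; rewrite -sz ltnS -e -mulgA sqS // mulg1; apply: len_le.
have st : s != t.
  by apply/eqP => e; move: ws; rewrite e leqNgt wt.
have [v [a [aA ew lw min]]] := coset_descent w sS tS.
have a0 : (0 < size a)%N.
  case: a aA ew lw => // _ ew _; move: wt.
  by rewrite ew wprod0 mulg1 ltnNge min // set22.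
have vk : (len v < k)%N by apply: leq_trans wk; rewrite lw -addn1 leq_add2l.
have vs := IH v s vk sS (min s (set21 _ _)).
have vt := IH v t vk tS (min t (set22 _ _)).
have [ad c0] := Sad sS tS st.
have [p [q [e [[p0 q0]|[p0 q0]]]]] :=
    adapted_sign (rS sS) (rS tS) st ad c0 (word_gen aA) (set21 s t).
  rewrite ew (actMl actP) e (actD actP) !(actZ actP).
  by apply: coneD; apply: coneZ.
have [a' [aA' sz ea]] := pair_exchange (rS sS) (rS tS) st ad c0 aA (set21 s t) e p0 q0.
have : (len (w * s)%g <= len v + size a')%N.
  rewrite ew -mulgA -ea; apply: lenMw; apply: sub_all aA' => u.
  by rewrite in_set2 => /orP[]/eqP ->.
by move/(leq_trans ws); rewrite lw -sz addnS ltnn.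
Qed.

Lemma adapted_root w s : s \in S ->
  cone S r (act w (r s)) \/ cone S r (- act w (r s)).
Proof.
move=> sS; have [h|/ltnW h] := leqP (len w) (len (w * s)%g).
  by left; apply: len_cone.
right; have := @len_cone (w * s)%g s sS.
rewrite (actMl actP) (reflects_self (rS sS)) (actN actP) -mulgA sqS // mulg1.
exact.
Qed.

End Length.

Lemma adapted_scale (r : W -> E) (e : W -> R) s t : (forall u, e u * e u = 1) ->
  adapted g act r s t -> adapted g act (fun u => e u *: r u) s t.
Proof.
move=> ee ad d u dD uD; have [p [q [eq pq]]] := ad d u dD uD.
exists (e u * e s * p), (e u * e t * q); split.
  rewrite (actZ actP) eq scalerDr !scalerA; congr (_ *: _ + _ *: _).
    by transitivity (e u * p * (e s * e s)); [rewrite ee|]; ring.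
  by transitivity (e u * q * (e t * e t)); [rewrite ee|]; ring.
rewrite (ipZl gP) (ipZr gP).
have -> : e u * e s * p * (e u * e t * q) * (e s * (e t * g (r s) (r t))) =
   (e u * e u) * (e s * e s) * (e t * e t) * (p * q * g (r s) (r t)) by ring.
by rewrite !ee !mul1r.
Qed.

Section Coxeter.
Variables (S : {set W}) (r : W -> E).
Hypothesis SC : coxeter_system S.
Hypothesis rS : forall s, s \in S -> reflects g act s (r s).

(** Signs are propagated along the forest formed by the diagram. *)
Lemma root_signs : exists2 e : W -> R, forall u, e u * e u = 1 &
  forall s t, s \in S -> t \in S -> s != t ->
    g (e s *: r s) (e t *: r t) <= 0.
Proof.
suff main (U : {set W}) : U \subset S -> exists2 e : W -> R,
    forall u, e u * e u = 1 &
    forall s t, s \in U -> t \in U -> s != t -> g (e s *: r s) (e t *: r t) <= 0.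
  exact: main (fintype.subxx S).
have [k] := ubnP #|U|; elim: k U => // k IH U Uk US.
have [->|U0] := eqVneq U finset.set0.
  by exists (fun=> 1) => [u|s t]; rewrite ?mulr1 // finset.in_set0.
have [s sU leaf] := diagram_leaf R SC US U0.
have US' : (U :\ s)%SET \subset S by apply: fintype.subset_trans (subD1set _ _) US.
have Uk' : (#|(U :\ s)%SET| < k)%N by move: Uk; rewrite (cardsD1 s U) sU add1n ltnS.
have [e ee eU] := IH _ Uk' US'.
have USi u : u \in U -> u \in S by apply: (fintype.subsetP US).
have nadj u : u \in U -> u != s -> ~~ adjacent S s u -> g (r s) (r u) = 0.
  move=> uU us na; have [sS uS] := (USi s sU, USi u uU).
  rewrite eq_sym in us; apply/(order2_ip gP actP (rS sS) (rS uS) us).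
  exact: (nonadjacent_order SC).
have [h hh hU] : exists2 h : R, h * h = 1 &
    forall u, u \in U -> u != s -> g (h *: r s) (e u *: r u) <= 0.
  case: (pselect (exists2 t, t \in U & adjacent S s t)) => [[t tU ast]|no].
    exists (if 0 <= g (r s) (r t) then - e t else e t).
      by case: ifP => _; rewrite ?mulrNN ee.
    move=> u uU us; have [au|na] := boolP (adjacent S s u); last first.
      by rewrite !(ipE gP) (nadj u uU us na) !mulr0.
    rewrite -(leaf t u tU uU ast au) !(ipE gP) mulrA.
    case: ifP => [h|/negbT]; first by rewrite mulNr ee mulN1r oppr_le0.
    by rewrite -ltNge ee mul1r => /ltW.
  exists 1 => [|u uU us]; first by rewrite mulr1.
  rewrite !(ipE gP) (nadj u uU us) ?mulr0 //; apply/negP => au.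
  by apply: no; exists u.
exists (fun u => if u == s then h else e u) => [u|u v uU vU uv].
  by case: ifP.
have [us|us] := eqVneq u s.
  by rewrite us eq_sym in uv *; rewrite (negPf uv); apply: hU.
have [vs|vs] := eqVneq v s; first by rewrite vs (ipC gP); apply: hU.
by apply: eU; rewrite // in_setD1 ?us ?vs.
Qed.

(** The Gram matrix of the roots is positive definite by the relations alone. *)
Lemma gram_independent (x : W -> R) : \sum_(s in S) x s *: r s = 0 ->
  forall s, s \in S -> x s = 0.
Proof.
move=> h s sS; apply/eqP/negPn/negP => xs.
have := @gram_positive R W S SC (fun s t => g (r s) (r t)) _ _ _ _ x (ex_intro2 _ _ s sS xs).
have -> : \sum_(s in S) \sum_(t in S) x s * x t * g (r s) (r t) =
    g (\sum_(s in S) x s *: r s) (\sum_(s in S) x s *: r s).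
  rewrite (ip_suml gP); apply: eq_bigr => u _; rewrite (ip_sumr gP).
  by apply: eq_bigr => v _; rewrite (ipZl gP) (ipZr gP) mulrA.
rewrite h (ip0l gP) ltxx => H; suff : false by []; apply: H.
- by move=> u v _ _; rewrite (ipC gP).
- by move=> u /rS [].
- by move=> u v uS vS uv; apply: (reflects_neq gP actP (rS uS) (rS vS) uv).
- by move=> u v uS vS uv p; apply: (order_rot gP actP p (rS uS) (rS vS) uv).
Qed.

Lemma dual_vector : exists z, forall s, s \in S -> g z (r s) = 1.
Proof.
pose M := \matrix_(i < #|S|, j < #|S|) g (r (enum_val i)) (r (enum_val j)).
have ME i j : M i j = g (r (enum_val i)) (r (enum_val j)) by rewrite mxE.
have Mu : M \in unitmx.
  rewrite -row_free_unit -kermx_eq0; apply/eqP/row_matrixP => k; rewrite row0.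
  move: (row_sub k (kermx M)); set x := row k _; move: x => x xk.
  have xM : x *m M = 0 by apply/sub_kermxP.
  pose X := \sum_i x 0 i *: r (enum_val i).
  have XX : g X X = 0.
    rewrite {2}/X (ip_sumr gP) big1 // => j _; rewrite (ipZr gP).
    have -> : g X (r (enum_val j)) = (x *m M) 0 j.
      rewrite (ip_suml gP) mxE; apply: eq_bigr => i _.
      by rewrite (ipZl gP) ME.
    by rewrite xM mxE mulr0.
  have X0 := ip_eq0 gP XX; apply/rowP => i; rewrite mxE.
  pose y s := \sum_(i | enum_val i == s) x 0 i.
  have yE j : y (enum_val j) = x 0 j.
    by rewrite /y (big_pred1 j) // => j'; rewrite (inj_eq enum_val_inj).
  rewrite -yE; apply: (gram_independent (x := y) _ (enum_valP i)).
  rewrite (@big_enum_val _ _ _ _ (mem S)) -[RHS]X0.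
  by apply: eq_bigr => j _; rewrite yE.
pose x := (const_mx 1 : 'rV[R]_#|S|) *m invmx M.
exists (\sum_i x 0 i *: r (enum_val i)) => s sS.
have xM : x *m M = const_mx 1 by rewrite mulmxKV.
have := congr1 (fun A : 'rV_ _ => A 0 (enum_rank_in sS s)) xM; rewrite !mxE => <-.
rewrite (ip_suml gP); apply: eq_bigr => i _.
by rewrite (ipZl gP) ME enum_rankK_in.
Qed.

End Coxeter.

(** A Coxeter system of reflections whose pairs are adapted consists of the
reflections in the walls of a chamber: the signs of the roots are chosen such
that all angles are obtuse, and the roots are then linearly independent. *)
Lemma adapted_simple (S : {set W}) (r : W -> E) : coxeter_system S ->
  (forall s, s \in S -> reflects g act s (r s)) ->
  (forall s t, s \in S -> t \in S -> s != t -> adapted g act r s t) ->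
  exists r' z, simple_system g act S r' z.
Proof.
move=> SC rS ad; have [e ee eS] := root_signs SC rS.
pose r' u := e u *: r u.
have rS' s : s \in S -> reflects g act s (r' s).
  move=> sS; rewrite /r'; have : (e s - 1) * (e s + 1) = 0 by have := ee s; nra.
  move/eqP; rewrite mulf_eq0 => /orP[]/eqP h.
    by rewrite (_ : e s = 1) ?scale1r; [apply: rS|lra].
  rewrite (_ : e s = -1); last by lra.
  by rewrite scaleN1r; apply: (reflectsN gP); apply: rS.
have gen w : w \in <<S>>%g by case: SC => _ -> _; rewrite finset.in_setT.
have [z zS] := dual_vector SC rS'.
exists r', z; split=> //.
- apply: adapted_root => // s t sS tS st; split; last exact: eS.
  by apply: adapted_scale => //; apply: ad.
- by move=> s /zS ->.
- move=> s sS [c c0 h].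
  pose x u := if u == s then -1 else c u.
  have : x s = 0.
    apply: (gram_independent SC rS' (x := x) _ sS).
    rewrite (big_setD1 s) //= {1}/x eqxx scaleN1r {1}h; apply/eqP.
    rewrite addrC subr_eq0; apply/eqP; apply: eq_bigr => u.
    by rewrite in_setD1 /x => /andP[/negPf -> _].
  by rewrite /x eqxx; lra.
Qed.

End Glue.

(** * Reflection rigidity *)

Section Icosahedral.
Variables (R : realType) (E : lmodType R) (g : E -> E -> R).
Variables (W : finGroupType) (act : W -> E -> E).
Hypotheses (gP : inner_product g) (actP : orthogonal_action g act).

(** Four vectors suffice for the diagrams H3, with d = 0, and H4. *)
Definition comb4 (a b c d : E) (p q m n : R) : E :=
  p *: a + q *: b + m *: c + n *: d.

Lemma comb4_0 a b c d p q m n k :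
  comb4 a b c d p q m n - k *: a = comb4 a b c d (p - k) q m n.
Proof.
by rewrite /comb4 scalerBl -!addrA; congr (_ + _); rewrite [RHS]addrC -!addrA.
Qed.
Lemma comb4_1 a b c d p q m n k :
  comb4 a b c d p q m n - k *: b = comb4 a b c d p (q - k) m n.
Proof.
rewrite /comb4 scalerBl -!addrA; congr (_ + (_ + _)).
by rewrite [RHS]addrC -!addrA.
Qed.
Lemma comb4_2 a b c d p q m n k :
  comb4 a b c d p q m n - k *: c = comb4 a b c d p q (m - k) n.
Proof. by rewrite /comb4 scalerBl -!addrA; congr (_ + (_ + (_ + _))); rewrite addrC. Qed.
Lemma comb4_3 a b c d p q m n k :
  comb4 a b c d p q m n - k *: d = comb4 a b c d p q m (n - k).
Proof. by rewrite /comb4 scalerBl -!addrA. Qed.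

Lemma comb4_comb4 a b c d p q m n k x y z :
  comb4 (comb4 a b c d p q m n) b c d k x y z =
  comb4 a b c d (k * p) (k * q + x) (k * m + y) (k * n + z).
Proof.
rewrite /comb4 !scalerDr !scalerA !scalerDl.
by rewrite (ACl (1 * (2 * 5) * (3 * 6) * (4 * 7)))%AC.
Qed.

Variables (A : {set W}) (s t u : W) (a b c : E) (f : R).
Hypotheses (sa : reflects g act s a) (tb : reflects g act t b).
Hypothesis uc : reflects g act u c.
Hypotheses (sA : s \in <<A>>%g) (tA : t \in <<A>>%g) (uA : u \in <<A>>%g).
Hypothesis ff : f * f = f + 1.
Hypotheses (gab : g a b = (1 - f) / 2) (gbc : g b c = - 1 / 2) (gac : g a c = 0).

Let orb (x y : E) := exists2 v, v \in <<A>>%g & act v x = y.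

Let orb_step x v y z : v \in <<A>>%g -> orb x y -> act v y = z -> orb x z.
Proof.
by move=> vA [w wA <-] <-; exists (v * w)%g; rewrite ?groupM // (actMl actP).
Qed.

Let orb_refl v x y : orb x y -> reflects g act v x -> v \in <<A>>%g ->
  exists2 s', s' \in <<A>>%g & reflects g act s' y.
Proof.
move=> [w wA <-] vx vA; exists (w * v * w^-1)%g; first by rewrite !groupM ?groupV.
exact: reflects_conj.
Qed.

(** In the basis of roots of a diagram H3 whose heavy edge has the angle 2 pi / 5,
this vector is, up to sign, the Galois conjugate of the first root: exchanging
f and 1 - f exchanges the two bases and their Gram matrices. The proof is a
chain of reflections leading to it from a root of the basis. *)
Lemma h3_root : exists2 s', s' \in <<A>>%g &
  reflects g act s' (comb4 a b c 0 (2 - f) (- 2 + 2 * f) (- 1 + f) 0).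
Proof.
pose C p q m := comb4 a b c 0 p q m 0.
have [a1 sx] := sa; have [b1 tx] := tb; have [c1 ux] := uc.
have step0 p q m p' : orb b (C p q m) -> p' = - p + (f - 1) * q -> orb b (C p' q m).
  move=> h e; apply: (orb_step sA h).
  rewrite sx /refl comb4_0; congr comb4; rewrite /comb4 !(ipE gP) a1.
  by rewrite (ipC gP b) (ipC gP c) gab gac e; field.
have step1 p q m q' : orb b (C p q m) -> q' = - q + (f - 1) * p + m ->
    orb b (C p q' m).
  move=> h e; apply: (orb_step tA h).
  rewrite tx /refl comb4_1; congr comb4; rewrite /comb4 !(ipE gP) b1.
  by rewrite (ipC gP c) gab gbc e; field.
have step2 p q m m' : orb b (C p q m) -> m' = - m + q -> orb b (C p q m').
  move=> h e; apply: (orb_step uA h).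
  rewrite ux /refl comb4_2; congr comb4; rewrite /comb4 !(ipE gP) c1.
  by rewrite gac gbc e; field.
suff : orb b (C (- 2 + f) (2 - 2 * f) (1 - f)).
  move/orb_refl => /(_ t tb tA) [s' s'A h]; exists s' => //.
  have -> : comb4 a b c 0 (2 - f) (- 2 + 2 * f) (- 1 + f) 0 =
      - C (- 2 + f) (2 - 2 * f) (1 - f).
    rewrite /C /comb4 -[RHS]scaleN1r !scalerDr !scalerA.
    by congr (_ *: _ + _ *: _ + _ *: _ + _ *: _); ring.
  exact: (reflectsN gP).
apply: (step1 _ (2 - f) _); last by ring: ff.
apply: (step0 (- 1 + f) _ _); last by ring: ff.
apply: (step1 _ (1 - f) _); last by ring: ff.
apply: (step2 _ _ (0)); last by ring: ff.
apply: (step1 _ (1) _); last by ring: ff.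
apply: (step0 (0) _ _); last by ring: ff.
exists 1%g; rewrite ?group1 // (act1l gP actP) /C /comb4.
by rewrite !scale0r scale1r add0r !addr0.
Qed.

Variables (w : W) (d : E).
Hypotheses (wd : reflects g act w d) (wA : w \in <<A>>%g).
Hypotheses (gcd : g c d = - 1 / 2) (gad : g a d = 0) (gbd : g b d = 0).

(** The same for H4, the chain of reflections starting from the first root. *)
Lemma h4_root : exists2 s', s' \in <<A>>%g &
  reflects g act s' (comb4 a b c d (- 5 + 3 * f) (6 - 3 * f) (4 - 2 * f) (2 - f)).
Proof.
pose C := comb4 a b c d.
have [a1 sx] := sa; have [b1 tx] := tb; have [c1 ux] := uc; have [d1 wx] := wd.
have step0 p q m n p' : orb a (C p q m n) -> p' = - p + (f - 1) * q ->
    orb a (C p' q m n).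
  move=> h e; apply: (orb_step sA h).
  rewrite sx /refl comb4_0; congr comb4; rewrite /C /comb4 !(ipE gP) a1.
  by rewrite (ipC gP b) (ipC gP c) (ipC gP d) gab gac gad e; field.
have step1 p q m n q' : orb a (C p q m n) -> q' = - q + (f - 1) * p + m ->
    orb a (C p q' m n).
  move=> h e; apply: (orb_step tA h).
  rewrite tx /refl comb4_1; congr comb4; rewrite /C /comb4 !(ipE gP) b1.
  by rewrite (ipC gP c) (ipC gP d) gab gbc gbd e; field.
have step2 p q m n m' : orb a (C p q m n) -> m' = - m + q + n -> orb a (C p q m' n).
  move=> h e; apply: (orb_step uA h).
  rewrite ux /refl comb4_2; congr comb4; rewrite /C /comb4 !(ipE gP) c1.
  by rewrite (ipC gP d) gac gbc gcd e; field.
have step3 p q m n n' : orb a (C p q m n) -> n' = - n + m -> orb a (C p q m n').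
  move=> h e; apply: (orb_step wA h).
  rewrite wx /refl comb4_3; congr comb4; rewrite /C /comb4 !(ipE gP) d1.
  by rewrite gad gbd gcd e; field.
suff : orb a (C (5 - 3 * f) (- 6 + 3 * f) (- 4 + 2 * f) (- 2 + f)).
  move/orb_refl => /(_ s sa sA) [s' s'A h]; exists s' => //.
  have -> : comb4 a b c d (- 5 + 3 * f) (6 - 3 * f) (4 - 2 * f) (2 - f) =
      - C (5 - 3 * f) (- 6 + 3 * f) (- 4 + 2 * f) (- 2 + f).
    rewrite /C /comb4 -[RHS]scaleN1r !scalerDr !scalerA.
    by congr (_ *: _ + _ *: _ + _ *: _ + _ *: _); ring.
  exact: (reflectsN gP).
apply: (step0 (4 - 3 * f) _ _ _); last by ring: ff.
apply: (step1 _ (- 5 + 3 * f) _ _); last by ring: ff.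
apply: (step2 _ _ (- 3 + 2 * f) _); last by ring: ff.
apply: (step3 _ _ _ (- 1 + f)); last by ring: ff.
apply: (step0 (4 - 2 * f) _ _ _); last by ring: ff.
apply: (step1 _ (- 4 + 3 * f) _ _); last by ring: ff.
apply: (step2 _ _ (- 2 + 2 * f) _); last by ring: ff.
apply: (step0 (3 - 2 * f) _ _ _); last by ring: ff.
apply: (step1 _ (- 3 + 2 * f) _ _); last by ring: ff.
apply: (step0 (2 - f) _ _ _); last by ring: ff.
apply: (step1 _ (- 2 + 2 * f) _ _); last by ring: ff.
apply: (step2 _ _ (- 1 + f) _); last by ring: ff.
apply: (step3 _ _ _ (0)); last by ring: ff.
apply: (step1 _ (- 2 + f) _ _); last by ring: ff.
apply: (step0 (1 - f) _ _ _); last by ring: ff.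
apply: (step1 _ (- 1 + f) _ _); last by ring: ff.
apply: (step2 _ _ (0) _); last by ring: ff.
apply: (step0 (1) _ _ _); last by ring: ff.
apply: (step1 _ (0) _ _); last by ring: ff.
exists 1%g; rewrite ?group1 // (act1l gP actP) /C /comb4.
by rewrite !scale0r scale1r !addr0.
Qed.

End Icosahedral.

Section Replacement.
Variables (W : finGroupType).

(** A finite Coxeter group has the automorphism replacing one generator, if the
orders of products are kept and the generator can be recovered. *)
Lemma coxeter_replace (S : {set W}) (s s' : W) :
  coxeter_system S -> s \in S -> (s' * s')%g = 1%g ->
  (forall u, u \in (S :\ s)%SET -> #[s' * u]%g = #[s * u]%g) ->
  s \in <<(s' |: (S :\ s))%SET>>%g ->
  exists al : W -> W, [/\ {morph al : v w / (v * w)%g}, bijective al,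
    al s = s' & forall u, u \in (S :\ s)%SET -> al u = u].
Proof.
move=> SC sS ss' ord sgen; have [S2 gen univ] := SC.
pose f u := if u == s then s' else u.
have fne u : u \in (S :\ s)%SET -> f u = u.
  by rewrite in_setD1 /f => /andP[/negPf -> _].
have sq := coxeter_sq SC.
have uu u : u \in (S :\ s)%SET -> (u * u)%g = 1%g by rewrite in_setD1 => /andP[_ /sq].
have osym (u v : W) : (u * u)%g = 1%g -> (v * v)%g = 1%g -> #[u * v]%g = #[v * u]%g.
  move=> u2 v2; rewrite -[RHS](orderJ _ v); congr #[_]%g.
  by rewrite /conjg !mulgA mulVg mul1g.
have [al alM alS] : exists2 al : W -> W, {morph al : v w / (v * w)%g} &
    forall u, u \in S -> al u = f u.
  apply: univ => u v uS vS.
  have [us|us] := eqVneq u s; have [vs|vs] := eqVneq v s.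
  - by rewrite us vs /f eqxx ss' sq // order1 expg1.
  - have vS' : v \in (S :\ s)%SET by rewrite in_setD1 vs.
    by rewrite us (fne v vS') /f eqxx -ord // expg_order.
  - have uS' : u \in (S :\ s)%SET by rewrite in_setD1 us.
    have e : #[u * s]%g = #[u * s']%g.
      by rewrite (osym u s (uu u uS') (sq s sS)) -(ord u uS') (osym s' u ss' (uu u uS')).
    by rewrite vs (fne u uS') /f eqxx e expg_order.
  - by rewrite /f (negPf us) (negPf vs) expg_order.
have als : al s = s' by rewrite alS // /f eqxx.
have alu u : u \in (S :\ s)%SET -> al u = u.
  by move=> uS; rewrite alS ?fne //; move: uS; rewrite in_setD1 => /andP[].
have al1 : al 1%g = 1%g by apply: (mulgI (al 1%g)); rewrite -alM !mulg1.
have surj w : exists v, al v = w.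
  have gs : <<S>>%g \subset <<(s' |: (S :\ s))%SET>>%g.
    rewrite gen_subG; apply/fintype.subsetP => u uS.
    have [->//|us] := eqVneq u s.
    by apply: mem_gen; rewrite in_setU1 in_setD1 us uS orbT.
  have wg : w \in <<(s' |: (S :\ s))%SET>>%g.
    by apply: (fintype.subsetP gs); rewrite gen finset.in_setT.
  have [a + <-] := gen_word wg; elim: a => [_|x a IH /= /andP[xA /IH [v e]]].
    by exists 1%g; rewrite wprod0.
  move: xA; rewrite in_setU1 => /orP[/eqP ->|xS].
    by exists (s * v)%g; rewrite alM als e wprod_cons.
  by exists (x * v)%g; rewrite alM alu // e wprod_cons.
have [be alK] := choice surj.
have beb : bijective be by apply: injF_bij; apply: can_inj alK.
by exists al; split=> //; apply: (bij_can_bij beb alK).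
Qed.

Lemma coxeter_aut (S : {set W}) (al : W -> W) :
  {morph al : v w / (v * w)%g} -> bijective al ->
  coxeter_system S -> coxeter_system (al @: S)%SET.
Proof.
move=> alM [be alK beK] [S2 gen univ].
have al1 : al 1%g = 1%g by apply: (mulgI (al 1%g)); rewrite -alM !mulg1.
have beM : {morph be : v w / (v * w)%g}.
  by move=> v w; apply: (can_inj alK); rewrite alM !beK.
have alX w k : al (w ^+ k)%g = (al w ^+ k)%g.
  by elim: k => [|k IH]; rewrite ?expg0 // !expgS alM IH.
have ordal w : #[al w]%g = #[w]%g.
  apply/eqP; rewrite eqn_dvd !order_dvdn -alX expg_order al1 eqxx /=.
  by rewrite -(inj_eq (can_inj alK)) alX expg_order al1.
split.
- by move=> s' /imsetP[s sS ->]; rewrite ordal S2.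
- apply/setP => w; rewrite finset.in_setT.
  have : be w \in <<S>>%g by rewrite gen finset.in_setT.
  case/gen_word => v vS e; have {e} -> : w = wprod [seq al x | x <- v].
    rewrite -[LHS]beK -e; elim: v {vS e} => [|x v IH]; first by rewrite !wprod0.
    by rewrite /= !wprod_cons alM IH.
  apply: word_gen; rewrite /word_in all_map; apply: sub_all vS => x xS /=.
  exact: imset_f.
- move=> G f fP; have [|phi phiM phiS] := univ G (f \o al).
    move=> s t sS tS /=; rewrite -ordal alM; apply: fP; exact: imset_f.
  exists (phi \o be) => [v w /=|s' /imsetP[s sS ->] /=]; first by rewrite beM phiM.
  by rewrite alK phiS.
Qed.

End Replacement.

Section Rigidity.
Variables (R : realType) (E : lmodType R) (g : E -> E -> R).
Variables (W : finGroupType) (act : W -> E -> E).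
Hypotheses (gP : inner_product g) (actP : orthogonal_action g act).

Let is_refl t := exists a, reflects g act t a.
Variable r : W -> E.
Hypothesis rP : forall t, is_refl t -> reflects g act t (r t).

Lemma norm_root t a x : reflects g act t a -> `|g (r t) x| = `|g a x|.
Proof.
move=> ta; have := rP (ex_intro _ a ta).
by case/(reflects_root gP ta) => ->; rewrite // (ipNl gP) normrN.
Qed.

Lemma signed_root u y : is_refl u -> exists2 c, reflects g act u c &
  g y c = - `|g y (r u)| /\ (c = r u \/ c = - r u).
Proof.
move=> /rP ur; have [h|/ltW h] := leP 0 (g y (r u)).
  exists (- r u); first exact: (reflectsN gP).
  by rewrite (ipNr gP) ger0_norm //; split=> //; right.
by exists (r u) => //; rewrite ler0_norm // opprK; split=> //; left.
Qed.

(** In a dihedral group, the mirrors of t and of the reflection nearest to t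
bound a chamber. *)
Lemma dihedral_adapted s t : is_refl s -> is_refl t -> s != t ->
  exists s', [/\ is_refl s', s' \in <<[set s; t]%SET>>%g, s' != t,
    s \in <<[set s'; t]%SET>>%g & adapted g act r s' t /\
    exists p q, r s' = p *: r s + q *: r t].
Proof.
move=> /rP sr /rP tr st; set D := <<_>>%g.
have sD : s \in D by rewrite mem_gen // set21.
have tD : t \in D by rewrite mem_gen // set22.
pose U := [set x | [exists d in D, (x == d * s * d^-1)%g || (x == d * t * d^-1)%g]]%SET.
have UP x : x \in U -> exists d y, [/\ d \in D, y \in [set s; t]%SET & x = (d * y * d^-1)%g].
  rewrite finset.in_set => /existsP[d /andP[dD /orP[]/eqP ->]].
    by exists d, s; rewrite dD set21.
  by exists d, t; rewrite dD set22.
have yr y : y \in [set s; t]%SET -> reflects g act y (r y).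
  by rewrite in_set2 => /orP[]/eqP ->.
have Ur x : x \in U -> reflects g act x (r x).
  move=> /UP [d [y [dD yA ->]]]; apply: rP; exists (act d (r y)).
  by apply: reflects_conj => //; apply: yr.
have UJ d x : d \in D -> x \in U -> (d * x * d^-1)%g \in U.
  move=> dD; rewrite !finset.in_set => /existsP[e /andP[eD h]].
  apply/existsP; exists (d * e)%g; rewrite groupM //= !invMg.
  by case/orP: h => /eqP ->; rewrite !mulgA eqxx ?orbT.
have UD x : x \in U -> x \in D.
  move=> /UP [d [y [dD yA ->]]]; rewrite !groupM ?groupV //.
  by move: yA; rewrite in_set2 => /orP[]/eqP ->.
have sU : s \in U.
  by rewrite finset.in_set; apply/existsP; exists 1%g; rewrite group1 invg1 mulg1 mul1g eqxx.
have tU : t \in U.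
  by rewrite finset.in_set; apply/existsP; exists 1%g; rewrite group1 invg1 !mulg1 !mul1g eqxx orbT.
have span x : x \in U -> exists p q, r x = p *: r s + q *: r t.
  move=> xU; have [d [y [dD yA e]]] := UP x xU.
  have [p [q e']] : exists p q, act d (r y) = p *: r s + q *: r t.
    have [v + <-] := gen_word dD; elim: v => [_|z v IH /= /andP[zA /IH [p [q e1]]]].
      rewrite wprod0 (act1l gP actP); move: yA; rewrite in_set2 => /orP[]/eqP ->.
        by exists 1, 0; rewrite scale1r scale0r addr0.
      by exists 0, 1; rewrite scale1r scale0r add0r.
    rewrite wprod_cons (actMl actP) e1; move: zA; rewrite in_set2 => /orP[]/eqP ->.
      by rewrite (act_pair_l gP (r t) sr); eexists; eexists.
    by rewrite (act_pair_r gP (r s) tr); eexists; eexists.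
  have h := reflects_conj gP actP d (yr y yA); rewrite -e in h.
  case: (reflects_root gP (Ur x xU) h) => ->; first by exists p, q.
  by exists (- p), (- q); rewrite e' opprD !scaleNr.
pose s' := [arg max_(x > s | (x \in U) && (x != t)) `|g (r x) (r t)|]%O.
have [s'U s't s'max] : [/\ s' \in U, s' != t &
    forall x, x \in U -> x != t -> `|g (r x) (r t)| <= `|g (r s') (r t)|].
  rewrite /s'; case: arg_maxP => [|x /andP[xU xt] h]; first by rewrite sU st.
  by split=> // y yU yt; apply: h; rewrite yU yt.
have s'r := Ur s' s'U.
set k := g (r s') (r t).
have k1 : k ^+ 2 < 1 := reflects_neq gP actP s'r tr s't.
have [t1 _] := tr; have [s'1 _] := s'r.
have span' x : x \in U -> exists p q, r x = p *: r s' + q *: r t.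
  move=> xU; have [p [q e]] := span x xU; have [p' [q' e']] := span s' s'U.
  have p'0 : p' != 0.
    apply/eqP => p'0; move: e'; rewrite p'0 scale0r add0r => e'.
    by move: s'1 k1; rewrite /k e' !(ipE gP) t1 !mulr1 -expr2 => ->; rewrite ltxx.
  exists (p / p'), (q - p / p' * q').
  rewrite e e' scalerDr !scalerA divfK // scalerBl -addrA; congr (_ + _).
  by rewrite addrCA subrr addr0.
(* a unit root with coefficients of the wrong signs would be nearer to t *)
have coef x p q : x \in U -> r x = p *: r s' + q *: r t -> p * q * k <= 0.
  move=> xU e; have [x1 _] := Ur x xU.
  have [p0|p0] := eqVneq p 0; first by rewrite p0 !mul0r.
  have xt : x != t.
    apply/eqP => xt; move: e; rewrite xt => e.
    have [] := @reflects_free _ _ _ _ _ gP actP _ _ _ _ p (q - 1) s'r tr s't.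
      by rewrite scalerBl scale1r addrA -e subrr.
    by move/eqP: p0.
  have nx := s'max x xU xt.
  have gx : g (r x) (r t) = p * k + q by rewrite e !(ipE gP) t1 -/k; ring.
  have n1 : p ^+ 2 + q ^+ 2 + 2 * p * q * k = 1.
    by rewrite -[RHS]x1 e !(ipE gP) t1 s'1 (ipC gP (r t)) -/k; ring.
  have h1 : (p * k + q) ^+ 2 <= k ^+ 2.
    by rewrite -gx -[X in X <= _]real_normK ?num_real // -[X in _ <= X]real_normK
      ?num_real // lerXn2r ?nnegrE.
  have p2 : 0 < p ^+ 2 by rewrite exprn_even_gt0.
  have p21 : 1 <= p ^+ 2.
    have : (p * k + q) ^+ 2 = 1 - p ^+ 2 * (1 - k ^+ 2).
      transitivity ((p ^+ 2 + q ^+ 2 + 2 * p * q * k) - p ^+ 2 * (1 - k ^+ 2)).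
        by ring.
      by rewrite n1.
    by move=> h2; rewrite h2 in h1; nra.
  by have := sqr_ge0 q; nra.
have [sg' sg'1 ksg] : exists2 h : R, h * h = 1 & h * k = - `|k|.
  have [h|/ltW h] := leP 0 k.
    by exists (-1); [ring | rewrite ger0_norm //; ring].
  by exists 1; [ring | rewrite ler0_norm //; ring].
(* in the directions of b and of the root of t, all roots have a sign *)
pose b := sg' *: r s'.
have br : reflects g act s' b.
  rewrite /b; have : (sg' - 1) * (sg' + 1) = 0 by nra.
  move/eqP; rewrite mulf_eq0 => /orP[]/eqP h.
    by rewrite (_ : sg' = 1) ?scale1r //; lra.
  by rewrite (_ : sg' = -1) ?scaleN1r; [apply: (reflectsN gP)|lra].
have gbt : g b (r t) = - `|k| by rewrite /b (ipZl gP).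
have sgn x : x \in U -> exists p q, r x = p *: b + q *: r t /\
    (0 <= p /\ 0 <= q \/ p <= 0 /\ q <= 0).
  move=> xU; have [p [q e]] := span' x xU; have pq := coef x p q xU e.
  have [k0|k0] := eqVneq k 0; last first.
    exists (sg' * p), q; split.
      rewrite e /b scalerA; congr (_ *: _ + _).
      by transitivity (sg' * sg' * p); [rewrite sg'1|]; ring.
    apply: mul_ge0_sign; have nk : 0 < `|k| by rewrite normr_gt0.
    rewrite -(pmulr_lge0 _ nk) -oppr_le0.
    have -> : - (sg' * p * q * `|k|) = (sg' * sg') * (p * q * k).
      by rewrite -[`|k|]opprK -ksg; ring.
    by rewrite sg'1 mul1r.
  have [x1 _] := Ur x xU.
  have [xt|xt] := eqVneq x t.
    by exists 0, 1; rewrite xt scale0r scale1r add0r; split=> //; left; split; lra.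
  have gx0 : g (r x) (r t) = 0.
    have := s'max x xU xt; rewrite -/k k0 normr0 normr_le0 => /eqP; exact.
  have q0 : q = 0 by move: gx0; rewrite e !(ipE gP) -/k k0 t1; lra.
  exists (sg' * p), q; split.
    rewrite e /b scalerA; congr (_ *: _ + _).
    by transitivity (sg' * sg' * p); [rewrite sg'1|]; ring.
  by apply: mul_ge0_sign; rewrite q0 mulr0.
clearbody b.
have D'D : <<[set s'; t]%SET>>%g \subset D.
  rewrite gen_subG; apply/fintype.subsetP => x.
  by rewrite in_set2 => /orP[]/eqP ->; rewrite ?UD.
set D' := <<[set s'; t]%SET>>%g in D'D *.
have s'D' : s' \in D' by rewrite mem_gen // set21.
have tD' : t \in D' by rewrite mem_gen // set22.
have ad : adapted g act r s' t.
  move=> d y dD' yA.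
  have yU : y \in U by move: yA; rewrite in_set2 => /orP[]/eqP ->.
  have dD := fintype.subsetP D'D _ dD'.
  have [p [q e]] := span' _ (UJ d y dD yU).
  have h := reflects_conj gP actP d (Ur y yU).
  have pq := coef _ p q (UJ d y dD yU) e.
  case: (reflects_root gP (Ur _ (UJ d y dD yU)) h) => e'.
    by exists p, q; rewrite -e' e.
  exists (- p), (- q); rewrite mulrNN; split=> //.
  by rewrite -[LHS]opprK -e' e opprD !scaleNr.
exists s'; split=> //.
- by exists (r s').
- exact: UD.
- (* a conjugate under the smaller group of lowest positive height is simple *)
  pose y := b + r t.
  have k1' : `|k| < 1.
    by rewrite -(ltr_pXn2r (n := 2)) ?nnegrE // expr1n real_normK ?num_real.
  have [b1 bx] := br; have [_ tx] := tr.
  have yb : 0 < g y b by rewrite /y !(ipE gP) b1 (ipC gP (r t)) gbt; lra.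
  have yt : 0 < g y (r t) by rewrite /y !(ipE gP) t1 gbt; lra.
  clearbody y; have ypos x p q : x = p *: b + q *: r t -> 0 < g y x ->
      (0 <= p /\ 0 <= q \/ p <= 0 /\ q <= 0) -> 0 <= p /\ 0 <= q.
    by move=> ->; rewrite !(ipE gP) => h [//|[p0 q0]]; nra.
  have [s1 _] := sr.
  have ys : g y (r s) != 0.
    have [p [q [e sg]]] := sgn s sU; apply/eqP => h.
    have [p0 q0] : p = 0 /\ q = 0.
      by move: h; rewrite e !(ipE gP); case: sg => -[p0 q0] h; split; nra.
    by move: s1; rewrite e p0 q0 !scale0r addr0 (ip0l gP); lra.
  have [a [sa ya]] : exists a, reflects g act s a /\ 0 < g y a.
    have [h|h] := ltP 0 (g y (r s)); first by exists (r s).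
    exists (- r s); split; first exact: (reflectsN gP).
    by rewrite (ipNr gP) oppr_gt0 lt_neqAle ys.
  pose P v := (v \in D') && (0 < g y (act v a)).
  pose v0 := [arg min_(v < 1%g | P v) g y (act v a)]%O.
  have [/andP[v0D v0y] v0min] : P v0 /\ forall v, P v -> g y (act v0 a) <= g y (act v a).
    by rewrite /v0; case: arg_minP => //; rewrite /P group1 (act1l gP actP).
  have act_sgn v : v \in D' -> exists p q, act v a = p *: b + q *: r t /\
      (0 <= p /\ 0 <= q \/ p <= 0 /\ q <= 0).
    move=> vD'; have vD := fintype.subsetP D'D _ vD'.
    have [p [q [e sg]]] := sgn _ (UJ v s vD sU).
    have h := reflects_conj gP actP v sa.
    case: (reflects_root gP (Ur _ (UJ v s vD sU)) h) => e'.
      by exists p, q; rewrite -e' e.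
    exists (- p), (- q); split; first by rewrite -[LHS]opprK -e' e opprD !scaleNr.
    by case: sg => -[p0 q0]; [right|left]; split; lra.
  have [p [q [e sg]]] := act_sgn v0 v0D.
  have [p0 q0] := ypos _ p q e v0y sg.
  have [a1 _] := sa.
  have vv1 : g (act v0 a) (act v0 a) = 1 by rewrite (act_ip actP).
  have n1 : p * g (act v0 a) b + q * g (act v0 a) (r t) = 1.
    by rewrite -!(ipZr gP) -(ipDr gP) -e.
  (* descending by x in {s', t} with root c forces v0 a = c *)
  have fin x c : x \in D' -> x = s' \/ x = t -> reflects g act x c -> 0 < g y c ->
      0 < g (act v0 a) c -> g y (act (x * v0)%g a) <= 0.
    move=> xD' _ [c1 xc] yc gc; rewrite leNgt; apply/negP => h.
    have := v0min (x * v0)%g; rewrite /P groupM // h => /(_ isT).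
    by rewrite (actMl actP) xc /refl !(ipE gP); nra.
  have conc x : x \in D' -> reflects g act x (act v0 a) -> s \in D'.
    move=> xD' h; have := reflects_conj gP actP v0 sa.
    move/(reflects_uniq gP actP h) => xe.
    have -> : s = (v0^-1 * x * v0)%g by rewrite xe !mulgA mulVg mul1g mulgKV.
    by rewrite !groupM ?groupV.
  have sq1 (x : R) : 0 <= x -> x * x = 1 -> x = 1.
    move=> x0 xx; have : (x - 1) * (x + 1) = 0 by nra.
    by move/eqP; rewrite mulf_eq0 => /orP[]/eqP; lra.
  have [gb|gb] := ltP 0 (g (act v0 a) b).
    have h3 := fin s' b s'D' (or_introl erefl) br yb gb.
    have [p' [q' [e2 sg2]]] := act_sgn (s' * v0)%g (groupM s'D' v0D).
    move: (e2); rewrite (actMl actP) e (act_pair_l gP (r t) br).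
    move: (- p - _) => P1 e3; have : (P1 - p') *: b + (q - q') *: r t = 0.
      by rewrite !scalerBl addrACA e3 -opprD subrr.
    case/(reflects_free gP actP br tr s't) => h1 h2.
    have q00 : q = 0.
      by move: h3; rewrite e2 !(ipE gP); case: sg2 => -[p'0 q'0] h3; nra.
    have pp : p = 1.
      by apply: sq1 => //; move: vv1; rewrite e q00 scale0r addr0 !(ipE gP) b1 mulr1.
    apply: (conc s') => //; rewrite e q00 pp scale0r addr0 scale1r; exact: br.
  have gt : 0 < g (act v0 a) (r t).
    rewrite ltNge; apply/negP => gt.
    have h4 := mulr_ge0_le0 p0 gb; have h5 := mulr_ge0_le0 q0 gt.
    by move: h4 h5 n1; lra.
  have h3 := fin t (r t) tD' (or_intror erefl) tr yt gt.
  have [p' [q' [e2 sg2]]] := act_sgn (t * v0)%g (groupM tD' v0D).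
  move: (e2); rewrite (actMl actP) e (act_pair_r gP b tr).
  move: (- q - _) => P1 e3; have : (p - p') *: b + (P1 - q') *: r t = 0.
    by rewrite !scalerBl addrACA e3 -opprD subrr.
  case/(reflects_free gP actP br tr s't) => h1 h2.
  have p00 : p = 0.
    by move: h3; rewrite e2 !(ipE gP); case: sg2 => -[p'0 q'0] h3; nra.
  have qq : q = 1.
    by apply: sq1 => //; move: vv1; rewrite e p00 scale0r add0r !(ipE gP) t1 mulr1.
  apply: (conc t) => //; rewrite e p00 qq scale0r add0r scale1r; exact: tr.
- by split; [exact: ad | exact: span].
Qed.

End Rigidity.

Section RigidityStep.
Variables (R : realType) (E : lmodType R) (g : E -> E -> R).
Variables (W : finGroupType) (act : W -> E -> E).
Hypotheses (gP : inner_product g) (actP : orthogonal_action g act).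

Let is_refl t := exists a, reflects g act t a.
Variable r : W -> E.
Hypothesis rP : forall t, is_refl t -> reflects g act t (r t).
Variable S : {set W}.
Hypothesis SC : coxeter_system S.
Hypothesis Sr : forall s, s \in S -> is_refl s.

Let rS s : s \in S -> reflects g act s (r s). Proof. by move/Sr/rP. Qed.

Definition replaces_at (s s' u : W) : Prop :=
  #[s' * u]%g = #[s * u]%g /\ adapted g act r s' u.

(** Replacing s by s' in S preserves the Coxeter relations, makes all pairs
containing the new element adapted, and loses nothing. *)
Definition replaceable (s : W) : Prop := exists s',
  [/\ is_refl s', forall u, u \in (S :\ s)%SET -> replaces_at s s' u &
      s \in <<(s' |: (S :\ s))%SET>>%g].

Let nonadj_ip u v : u \in S -> v \in S -> u != v -> ~~ adjacent S u v ->
  g (r u) (r v) = 0.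
Proof.
move=> uS vS uv na; apply/(order2_ip gP actP (rS uS) (rS vS) uv).
exact: (nonadjacent_order SC).
Qed.

Lemma keeps_orth s s' a u : s \in S -> u \in S -> u != s -> ~~ adjacent S s u ->
  reflects g act s' a -> g a (r u) = 0 -> replaces_at s s' u.
Proof.
move=> sS uS us na s'a au; have ur := rS uS.
have s'u : s' != u.
  apply/eqP => e; have [a1 _] := s'a; have [u1 _] := ur.
  rewrite e in s'a; case: (reflects_root gP s'a ur) => h.
    by move: au; rewrite h u1 => /eqP; rewrite oner_eq0.
  by move: au; rewrite h (ipNl gP) u1 => /eqP; rewrite oppr_eq0 oner_eq0.
have s'r : reflects g act s' (r s') by apply: rP; exists a.
split.
  rewrite ((order2_ip gP actP s'a ur s'u).2 au) (nonadjacent_order SC) //.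
  by rewrite eq_sym.
apply: (adapted_orth gP actP s'r ur); apply/eqP; rewrite -normr_eq0.
by rewrite (norm_root gP rP (r u) s'a) au normr0.
Qed.

(** A product with absolute value cos (pi / 5) is the one of an adapted pair; the
wrong angle 2 pi / 5 gives (f - 1) / 2 instead. *)
Lemma keeps_five s s' a t f : t \in S -> #[s * t]%g = 5%N -> s' != t ->
  reflects g act s' a -> f * f = f + 1 -> 1 <= f -> g a (r t) = f / 2 ->
  replaces_at s s' t.
Proof.
move=> tS m5 s't s'a ff f1 gat; have tr := rS tS.
have s'r : reflects g act s' (r s') by apply: rP; exists a.
have o5 : #[s' * t]%g = 5%N.
  apply: (ip_order5 gP actP s'a tr s't); rewrite gat.
  rewrite (_ : 4 * (f / 2) ^+ 2 - 2 * (f / 2) - 1 = 0) ?mulr0 //.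
  have -> : 4 * (f / 2) ^+ 2 = f * f by field.
  by rewrite ff; field.
split; first by rewrite o5 m5.
have [//|[_ h]] := adapted_or_heavy gP actP s'r tr s't.
have := h o5; have n : `|g (r s') (r t)| = f / 2.
  by rewrite (norm_root gP rP (r t) s'a) gat ger0_norm //; lra.
have -> : g (r s') (r t) ^+ 2 = `|g (r s') (r t)| ^+ 2 by rewrite real_normK ?num_real.
rewrite n => h1; exfalso; move: h1.
have -> : 4 * (f / 2) ^+ 2 = f * f by field.
by rewrite ff; lra.
Qed.

Let half_ip u v : u \in S -> v \in S -> u != v -> #[u * v]%g = 3%N ->
  `|g (r u) (r v)| = 1 / 2.
Proof.
move=> uS vS uv m3; have := order3_ip gP actP (rS uS) (rS vS) uv m3.
rewrite -real_normK ?num_real //; have := normr_ge0 (g (r u) (r v)).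
move: `|_| => x x0 h; have : (2 * x - 1) * (2 * x + 1) = 0.
  by transitivity (4 * x ^+ 2 - 1); [ring | rewrite h subrr].
by move/eqP; rewrite mulf_eq0 => /orP[]/eqP; lra.
Qed.

(** A heavy edge with the wrong angle and with a neighbouring edge lies in a
diagram H3 or H4; the end of the heavy edge is replaced by its conjugate. *)
Lemma replace_heavy s t u : s \in S -> t \in S -> s != t ->
  ~ adapted g act r s t -> adjacent S t u -> s != u -> replaceable s.
Proof.
move=> sS tS st nad atu su; have [_ uS tu _] := and4P atu.
have [[sr tr] ur] := (rS sS, rS tS, rS uS).
have [/nad //|[m5 h5]] := adapted_or_heavy gP actP sr tr st.
have ast : adjacent S s t by rewrite /adjacent sS tS st (leq_trans _ m5).
have [ms mt nsu] := heavy_neighbour R SC ast m5 atu su.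
have iso v := heavy_isolated R SC ast m5 atu su (v := v).
have [a sa [ga ea]] := signed_root gP rP (r t) (Sr sS).
have [c uc [gc ec]] := signed_root gP rP (r t) (Sr uS).
pose x := `|g (r t) (r s)|; pose f := 1 + 2 * x.
have x0 : 0 <= x by exact: normr_ge0.
have ff : f * f = f + 1.
  have := h5 ms; rewrite -real_normK ?num_real // (ipC gP) -/x => h.
  by rewrite /f; nra.
have f1 : 1 <= f by rewrite /f; lra.
have gab : g a (r t) = (1 - f) / 2 by rewrite (ipC gP) ga -/x /f; field.
have gbc : g (r t) c = - 1 / 2 by rewrite gc half_ip //; field.
have zero_sgn y v y' v' : y = y' \/ y = - y' -> v = v' \/ v = - v' ->
    g y' v' = 0 -> g y v = 0.
  by move=> [->|->] [->|->] h; rewrite ?(ipNl gP) ?(ipNr gP) h ?oppr0.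
have neg_sgn (y y' : E) : y = y' \/ y = - y' -> y' = y \/ y' = - y.
  by case=> ->; [left|right; rewrite opprK].
have root_orth p v y : p \in S -> v \in S -> p != v -> ~~ adjacent S p v ->
    y = r p \/ y = - r p -> g y (r v) = 0.
  by move=> pS vS pv npv h; apply: zero_sgn h (or_introl erefl) _; apply: nonadj_ip.
have gac : g a c = 0 by apply: zero_sgn ea ec _; apply: nonadj_ip.
have [tc b1] : g (r t) (r t) = 1 /\ g c c = 1 by case: tr => ?; case: uc.
have f'f' : (1 - f) * (1 - f) = (1 - f) + 1 by move: ff; nra.
have inS' s' v : v \in S -> v != s -> v \in <<(s' |: (S :\ s))%SET>>%g.
  by move=> vS vs; rewrite mem_gen // in_setU1 in_setD1 vs vS orbT.
have s'in s' : s' \in <<(s' |: (S :\ s))%SET>>%g by rewrite mem_gen // setU11.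
have ts : t != s by rewrite eq_sym.
have us : u != s by rewrite eq_sym.
have genS v : v \in S -> v \in <<S>>%g by exact: mem_gen.
have s'nt s' a' : reflects g act s' a' -> g a' (r t) = f / 2 -> s' != t.
  move=> s'a' ga'; apply/eqP => e; rewrite e in s'a'.
  by case: (reflects_root gP s'a' tr) => h; move: ga'; rewrite h ?(ipNl gP) tc;
    move: ff; nra.
case: (pselect (exists2 w, adjacent S u w & w \notin [:: s; t])) => [[w auw wst]|now].
  have [_ wS uw _] := and4P auw.
  have [mu chain] := heavy_chain R SC ast m5 atu su auw wst.
  have [ws wt] : w != s /\ w != t.
    by move: wst; rewrite !in_cons in_nil orbF negb_or => /andP.
  have [sw tw] : ~~ adjacent S s w /\ ~~ adjacent S t w.
    apply: iso => //; rewrite !in_cons in_nil orbF !negb_or ws wt.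
    by rewrite eq_sym uw.
  have [d wd [gd ed]] := signed_root gP rP c (Sr wS).
  have gcd : g c d = - 1 / 2.
    have nc : `|g c (r w)| = `|g (r u) (r w)|.
      by case: ec => ->; rewrite ?(ipNl gP) ?normrN.
    by rewrite gd nc half_ip //; field.
  have gad : g a d = 0.
    by apply: zero_sgn ea ed _; apply: nonadj_ip; rewrite // eq_sym.
  have gbd : g (r t) d = 0.
    by apply: zero_sgn (or_introl erefl) ed _; apply: nonadj_ip; rewrite // eq_sym.
  have [s' _ s'a] := h4_root gP actP sa tr uc (genS _ sS) (genS _ tS) (genS _ uS)
    ff gab gbc gac wd (genS _ wS) gcd gad gbd.
  set a' := comb4 _ _ _ _ _ _ _ _ in s'a.
  have [d1 _] := wd.
  have ga'b : g a' (r t) = f / 2.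
    rewrite /a' /comb4 !(ipE gP) (ipC gP c) (ipC gP d) gab gbc gbd tc.
    by field: ff.
  have ga'c : g a' c = 0.
    by rewrite /a' /comb4 !(ipE gP) (ipC gP d) gac gbc gcd b1; field.
  have ga'd : g a' d = 0.
    by rewrite /a' /comb4 !(ipE gP) gad gbd gcd d1; field.
  have s't := s'nt _ _ s'a ga'b.
  exists s'; split; first by exists a'.
    move=> v; rewrite in_setD1 => /andP[vs vS].
    have [->|vt] := eqVneq v t; first exact: (keeps_five tS ms s't s'a ff f1 ga'b).
    have [->|vu] := eqVneq v u.
      apply: (keeps_orth sS uS us nsu s'a).
      by apply: zero_sgn (or_introl erefl) (neg_sgn _ _ ec) ga'c.
    have [->|vw] := eqVneq v w.
      apply: (keeps_orth sS wS ws sw s'a).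
      by apply: zero_sgn (or_introl erefl) (neg_sgn _ _ ed) ga'd.
    have [nsv ntv] : ~~ adjacent S s v /\ ~~ adjacent S t v.
      by apply: iso => //; rewrite !in_cons in_nil orbF !negb_or vs vt vu.
    have [nuv nwv] : ~~ adjacent S u v /\ ~~ adjacent S w v.
      by apply: chain => //; rewrite !in_cons in_nil orbF !negb_or vs vt vu vw.
    apply: (keeps_orth sS vS vs nsv s'a).
    have [sv [tv uv]] : s != v /\ t != v /\ u != v by rewrite ![_ == v]eq_sym.
    rewrite /a' /comb4 !(ipE gP) (root_orth _ _ _ sS vS sv nsv ea).
    have wv : w != v by rewrite eq_sym.
    rewrite (root_orth _ _ _ uS vS uv nuv ec) (root_orth _ _ _ wS vS wv nwv ed).
    rewrite (nonadj_ip tS vS tv ntv) //.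
    by rewrite !mulr0 !addr0.
  have ga'b' : g a' (r t) = (1 - (1 - f)) / 2 by rewrite ga'b; field.
  have [s'' s''A s''a] := h4_root gP actP s'a tr uc (s'in s') (inS' s' _ tS ts)
    (inS' s' _ uS us) f'f' ga'b' gbc ga'c wd (inS' s' _ wS ws) gcd ga'd gbd.
  suff e : comb4 a' (r t) c d (- 5 + 3 * (1 - f)) (6 - 3 * (1 - f))
      (4 - 2 * (1 - f)) (2 - (1 - f)) = a.
    by rewrite e in s''a; move: s''A; rewrite (reflects_uniq gP actP s''a sa).
  rewrite comb4_comb4 [LHS](_ : _ = comb4 a (r t) c d 1 0 0 0).
    by rewrite /comb4 !scale0r !addr0 scale1r.
  by congr comb4; ring: ff.
have [s' _ s'a] := h3_root gP actP sa tr uc (genS _ sS) (genS _ tS) (genS _ uS)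
  ff gab gbc gac.
set a' := comb4 _ _ _ _ _ _ _ _ in s'a.
have ga'b : g a' (r t) = f / 2.
  rewrite /a' /comb4 !(ipE gP) (ipC gP c) gab gbc tc.
  by field: ff.
have ga'c : g a' c = 0.
  by rewrite /a' /comb4 !(ipE gP) gac gbc b1; field.
have s't := s'nt _ _ s'a ga'b.
exists s'; split; first by exists a'.
  move=> v; rewrite in_setD1 => /andP[vs vS].
  have [->|vt] := eqVneq v t; first exact: (keeps_five tS ms s't s'a ff f1 ga'b).
  have [->|vu] := eqVneq v u.
    apply: (keeps_orth sS uS us nsu s'a).
    by apply: zero_sgn (or_introl erefl) (neg_sgn _ _ ec) ga'c.
  have [nsv ntv] : ~~ adjacent S s v /\ ~~ adjacent S t v.
    by apply: iso => //; rewrite !in_cons in_nil orbF !negb_or vs vt vu.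
  have nuv : ~~ adjacent S u v.
    by apply/negP => auv; apply: now; exists v; rewrite // !in_cons in_nil orbF negb_or vs vt.
  apply: (keeps_orth sS vS vs nsv s'a).
  have [sv [tv uv]] : s != v /\ t != v /\ u != v by rewrite ![_ == v]eq_sym.
    rewrite /a' /comb4 !(ipE gP) (root_orth _ _ _ sS vS sv nsv ea).
  rewrite (root_orth _ _ _ uS vS uv nuv ec) (nonadj_ip tS vS tv ntv) //.
  by rewrite !mulr0 !addr0.
have ga'b' : g a' (r t) = (1 - (1 - f)) / 2 by rewrite ga'b; field.
have [s'' s''A s''a] := h3_root gP actP s'a tr uc (s'in s') (inS' s' _ tS ts)
  (inS' s' _ uS us) f'f' ga'b' gbc ga'c.
suff e : comb4 a' (r t) c 0 (2 - (1 - f)) (- 2 + 2 * (1 - f)) (- 1 + (1 - f)) 0 = a.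
  by rewrite e in s''a; move: s''A; rewrite (reflects_uniq gP actP s''a sa).
rewrite comb4_comb4 [LHS](_ : _ = comb4 a (r t) c 0 1 0 0 0).
  by rewrite /comb4 !scale0r !addr0 scale1r.
by congr comb4; ring: ff.
Qed.

(** A heavy edge that is a component of the diagram: any two neighbouring mirrors
of its dihedral group will do. *)
Lemma replace_isolated s t : s \in S -> t \in S -> s != t ->
  (forall u, u \in S -> u != s -> u != t -> ~~ adjacent S s u /\ ~~ adjacent S t u) ->
  replaceable s.
Proof.
move=> sS tS st iso; have [sr tr] := (rS sS, rS tS).
have [s' [s'r s'D s't sD' [ad [p [q e]]]]] :=
  dihedral_adapted gP actP rP (Sr sS) (Sr tS) st.
have s'a := rP s'r.
have tS' : t \in (S :\ s)%SET by rewrite in_setD1 eq_sym st.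
exists s'; split=> //.
  move=> u; rewrite in_setD1 => /andP[us uS].
  have [->|ut] := eqVneq u t.
    split=> //; apply/eqP; rewrite -(eqn_pmul2r (isT : (0 < 2)%N)).
    have sq x : reflects g act x (r x) -> (x * x)%g = 1%g by exact: reflectsK.
    have n1 x : reflects g act x (r x) -> x <> 1%g by exact: reflects_neq1.
    have e2 : <<[set s'; t]%SET>>%g = <<[set s; t]%SET>>%g.
      apply/eqP; rewrite finset.eqEsubset !gen_subG; apply/andP; split;
        apply/fintype.subsetP => x; rewrite in_set2 => /orP[]/eqP -> //;
        by rewrite mem_gen ?set22.
    by rewrite -!dihedral_card ?e2 //; first [exact: sq | exact: n1].
  have [nsu ntu] := iso u uS us ut.
  apply: (keeps_orth sS uS us nsu s'a).
  rewrite e !(ipE gP) (nonadj_ip sS uS _ nsu) 1?eq_sym //.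
  by rewrite (nonadj_ip tS uS _ ntu) 1?eq_sym // !mulr0 addr0.
move: sD'; apply/fintype.subsetP; rewrite gen_subG; apply/fintype.subsetP => x.
by rewrite in_set2 => /orP[]/eqP ->; rewrite mem_gen // in_setU1 ?eqxx // tS' orbT.
Qed.

Lemma replace_bad s t : s \in S -> t \in S -> s != t -> ~ adapted g act r s t ->
  exists x y, [/\ x \in S, y \in (S :\ x)%SET, ~ adapted g act r x y & replaceable x].
Proof.
move=> sS tS st nad; have ts : t != s by rewrite eq_sym.
case: (pselect (exists2 u, adjacent S t u & s != u)) => [[u atu su]|no].
  exists s, t; split=> //; first by rewrite in_setD1 ts.
  exact: replace_heavy atu su.
have nad' : ~ adapted g act r t s by move/(adapted_sym gP).
case: (pselect (exists2 u, adjacent S s u & t != u)) => [[u asu tu]|no'].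
  exists t, s; split=> //; first by rewrite in_setD1 st.
  exact: replace_heavy asu tu.
exists s, t; split=> //; first by rewrite in_setD1 ts.
apply: (replace_isolated sS tS st) => u uS us ut.
split; apply/negP => a; [apply: no'|apply: no]; exists u => //; by rewrite eq_sym.
Qed.

End RigidityStep.

Section RigidityTheorem.
Variables (R : realType) (E : lmodType R) (g : E -> E -> R).
Variables (W : finGroupType) (act : W -> E -> E).
Hypotheses (gP : inner_product g) (actP : orthogonal_action g act).

(** A Coxeter system whose generators act as reflections is, up to an
automorphism of the group, formed by the reflections in the walls of a chamber.
The generators themselves need not be: two of them generating a dihedral group
of order ten may have mirrors at angle 2 pi / 5. Generators are replaced one by
one until all pairs of them are adapted. *)
Theorem reflection_rigidity (S : {set W}) : coxeter_system S ->
  (forall s, s \in S -> exists a, reflects g act s a) ->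
  exists al : W -> W, [/\ {morph al : v w / (v * w)%g}, bijective al &
    exists r z, simple_system g act (al @: S)%SET r z].
Proof.
have [r rP] : exists r : W -> E, forall t, (exists a, reflects g act t a) ->
    reflects g act t (r t).
  have /choice [r rP] : forall t, exists a,
      (exists a, reflects g act t a) -> reflects g act t a.
    move=> t; case: (pselect (exists a, reflects g act t a)) => [[a ta]|no].
      by exists a.
    by exists 0 => /no.
  by exists r.
pose bad (S : {set W}) := [set p : W * W | [&& p.1 \in S, p.2 \in S, p.1 != p.2 &
  `[< ~ adapted g act r p.1 p.2 >]]]%SET.
have [k] := ubnP #|bad S|; elim: k S => // k IH S; rewrite ltnS => Sk SC Sr.
case: (pselect (exists s t, [/\ s \in S, t \in S, s != t & ~ adapted g act r s t])); last first.
  move=> no; exists id; split=> //; first by exists id.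
  have -> : (id @: S)%SET = S by apply: imset_id.
  apply: (adapted_simple gP actP (r := r) SC) => [s /Sr /rP //|s t sS tS st].
  by apply: contrapT => nad; apply: no; exists s, t.
move=> [s0 [t0 [s0S t0S st0 nad0]]].
have [s [t [sS tS' nad [s' [s'r keep sgen]]]]] := replace_bad gP actP rP SC Sr s0S t0S st0 nad0.
have s's' := reflectsK gP actP (rP _ s'r).
have [al [alM alB als alu]] := coxeter_replace SC sS s's' (fun u uS => (keep u uS).1) sgen.
have al_inj : injective al by case: alB => be alK _; apply: can_inj alK.
have alS : (al @: S)%SET = (s' |: (S :\ s))%SET.
  rewrite -{1}(finset.setD1K sS) imsetU1 als; congr (_ :|: _)%SET.
  by rewrite -[RHS]imset_id; apply: eq_in_imset => u /alu.
have [||be [beM beB [r' [z sys]]]] := IH (al @: S)%SET _ (coxeter_aut alM alB SC).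
- apply: leq_trans Sk; apply: proper_card; apply/properP; split.
    apply/fintype.subsetP => -[u v]; rewrite !finset.in_set /= alS !in_setU1.
    move=> /and4P[uS vS uv /asboolP nuv]; apply/and4P.
    have vs' : v != s'.
      apply/eqP => vs'; case/orP: uS => [/eqP us'|/keep [_ h]].
        by rewrite us' vs' eqxx in uv.
      by apply: nuv; rewrite vs'; apply: (adapted_sym gP).
    have us' : u != s'.
      apply/eqP => us'; case/orP: vS => [/eqP e|/keep [_ h]].
        by rewrite e eqxx in vs'.
      by apply: nuv; rewrite us'.
    move: uS vS; rewrite (negPf us') (negPf vs') !in_setD1 /= => /andP[_ ->] /andP[_ ->].
    by split=> //; apply/asboolP.
  exists (s, t); rewrite !finset.in_set /=.
    move: tS'; rewrite in_setD1 sS eq_sym => /andP[-> ->] /=; exact/asboolP.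
  rewrite alS !in_setU1 in_setD1 eqxx /= orbF; apply/negP => /and4P[/eqP ss' _ _ /asboolP].
  by apply; rewrite ss'; have [_] := keep t tS'.
- move=> x; rewrite alS in_setU1 => /orP[/eqP -> //|].
  by rewrite in_setD1 => /andP[_ /Sr].
exists (be \o al); split.
- by move=> v w /=; rewrite alM beM.
- exact: bij_comp.
- by exists r', z; rewrite imset_comp.
Qed.

End RigidityTheorem.

(** * The quadric model of the space of curvature kappa *)

Section Dot.
Variable R : realType.

Lemma dotv_inner m : inner_product (@dotv R m).
Proof.
split.
- by move=> x y; apply: eq_bigr => i _; rewrite mulrC.
- move=> a x y z; rewrite /dotv mulr_sumr -big_split; apply: eq_bigr => i _ /=.
  by rewrite !mxE; ring.
- move=> x x0; rewrite /dotv lt0r; apply/andP; split; last first.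
    by apply: sumr_ge0 => i _; rewrite -expr2 sqr_ge0.
  apply: contraNneq x0 => /eqP; rewrite psumr_eq0 => [|i _]; last first.
    by rewrite -expr2 sqr_ge0.
  move=> /allP h; apply/eqP/rowP => i; rewrite mxE.
  by have := h i (mem_index_enum _); rewrite /= -expr2 sqrf_eq0 => /eqP.
Qed.

Definition mkcov n (x : R) (u : 'rV[R]_n) : 'rV[R]_(1 + n) := row_mx x%:M u.

Definition cov0 n (a : 'rV[R]_(1 + n)) : R := (@lsubmx R 1 1 n a) 0 0.
Definition covr n (a : 'rV[R]_(1 + n)) : 'rV[R]_n := @rsubmx R 1 1 n a.

Lemma mkcovE n (a : 'rV[R]_(1 + n)) : a = mkcov (cov0 a) (covr a).
Proof. by rewrite /mkcov /cov0 /covr -mx11_scalar hsubmxK. Qed.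

Lemma dotv_mkcov n x y (u v : 'rV[R]_n) :
  dotv (mkcov x u) (mkcov y v) = x * y + dotv u v.
Proof.
rewrite /dotv /mkcov big_split_ord /= big_ord1 !row_mxEl !mxE eqxx /= !mulr1n.
by congr (_ + _); apply: eq_bigr => i _; rewrite !row_mxEr.
Qed.

Lemma mkcovD n x y (u v : 'rV[R]_n) : mkcov x u + mkcov y v = mkcov (x + y) (u + v).
Proof. by rewrite /mkcov add_row_mx -raddfD. Qed.
Lemma mkcovZ n a x (u : 'rV[R]_n) : a *: mkcov x u = mkcov (a * x) (a *: u).
Proof. by rewrite /mkcov scale_row_mx scale_scalar_mx. Qed.
Lemma mkcovN n x (u : 'rV[R]_n) : - mkcov x u = mkcov (- x) (- u).
Proof. by rewrite -scaleN1r mkcovZ mulN1r scaleN1r. Qed.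
Lemma mkcovB n x y (u v : 'rV[R]_n) : mkcov x u - mkcov y v = mkcov (x - y) (u - v).
Proof. by rewrite mkcovN mkcovD. Qed.
Lemma mkcov_inj n x y (u v : 'rV[R]_n) : mkcov x u = mkcov y v -> x = y /\ u = v.
Proof.
move=> /eq_row_mx [h ->]; split=> //.
by have := congr1 (fun M : matrix R 1 1 => M ord0 ord0) h; rewrite !mxE eqxx !mulr1n.
Qed.

End Dot.

Section Model.
Variables (R : realType) (n : nat) (kappa : R).
Hypothesis k0 : kappa <= 0.
Let dP := @dotv_inner R n.
Let dP1 := @dotv_inner R (1 + n).
Local Notation EE := (matrix R 1 (1 + n)%N).
Local Notation ht := (height kappa).
Local Notation sh := (sheet kappa).
Implicit Types (u v p : 'rV[R]_n) (a : 'rV[R]_(1 + n)).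

Lemma sheetE v : sh v = mkcov (ht v) v. Proof. by []. Qed.

Lemma height_sqr v : ht v ^+ 2 = 1 - kappa * dotv v v.
Proof.
rewrite sqr_sqrtr // subr_ge0; apply: le_trans ler01.
by apply: mulr_le0_ge0 => //; apply: (ip_ge0 dP).
Qed.

Lemma height_ge1 v : 1 <= ht v.
Proof.
rewrite -(ler_pXn2r (n := 2)) ?nnegrE // ?sqrtr_ge0 // expr1n height_sqr.
by rewrite lerDl oppr_ge0; apply: mulr_le0_ge0 => //; apply: (ip_ge0 dP).
Qed.

Lemma height_gt0 v : 0 < ht v.
Proof. exact: lt_le_trans ltr01 (height_ge1 v). Qed.

(** The quadric x ^ 2 + kappa |v| ^ 2 = 1 is uniformly parametrised, also in the
flat case, by writing x = 1 + kappa * excess v. *)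
Definition excess v : R := - dotv v v / (ht v + 1).

Let h1 v : ht v + 1 != 0.
Proof. by apply: lt0r_neq0; rewrite addr_gt0 ?height_gt0. Qed.

Lemma height_excess v : ht v = 1 + kappa * excess v.
Proof.
apply: (mulIf (h1 v)); rewrite /excess mulrDl -mulrA mulfVK //.
by have := height_sqr v; rewrite expr2; lra.
Qed.

Lemma dotv_excess v : dotv v v = - excess v * (2 + kappa * excess v).
Proof.
have -> : 2 + kappa * excess v = ht v + 1 by rewrite height_excess; ring.
by rewrite /excess mulNr mulfVK // opprK.
Qed.

(** On covectors, sharp being the duality that it induces. *)
Definition qform a b : R :=
  kappa * (cov0 a * cov0 b) + dotv (covr a) (covr b).

Definition sharp a : EE := mkcov (kappa * cov0 a) (covr a).

Definition qlift v : EE := mkcov (excess v) v.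

Lemma mkcov_l x u : cov0 (mkcov x u) = x.
Proof. by rewrite /cov0 /mkcov row_mxKl mxE eqxx mulr1n. Qed.
Lemma mkcov_r x u : covr (mkcov x u) = u.
Proof. by rewrite /covr /mkcov row_mxKr. Qed.

Lemma qform_mkcov x y u v : qform (mkcov x u) (mkcov y v) = kappa * (x * y) + dotv u v.
Proof. by rewrite /qform !mkcov_l !mkcov_r. Qed.

Lemma sharp_mkcov x u : sharp (mkcov x u) = mkcov (kappa * x) u.
Proof. by rewrite /sharp mkcov_l mkcov_r. Qed.

Lemma sheet_lift v : sh v = mkcov 1 0 + sharp (qlift v).
Proof. by rewrite sharp_mkcov mkcovD add0r -height_excess sheetE. Qed.

Lemma sheet_inj u v : sh u = sh v -> u = v.
Proof. by rewrite !sheetE => /mkcov_inj []. Qed.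

(** The squared chord, of which the distance is an increasing function. *)
Definition chord u v : R := qform (qlift u - qlift v) (qlift u - qlift v).

Lemma chordE u v :
  chord u v = - 2 * (kappa * (excess u * excess v) + excess u + excess v + dotv u v).
Proof.
rewrite /chord mkcovB qform_mkcov !(ipE dP) (ipC dP v u) !dotv_excess.
by ring.
Qed.

(** The points equidistant from u and v form the trace of a linear hyperplane. *)
Lemma chord_bisector u v p :
  chord u p - chord v p = - 2 * dotv (qlift u - qlift v) (sh p).
Proof.
rewrite !chordE sheetE mkcovB dotv_mkcov height_excess !(ipE dP).
by ring.
Qed.

Lemma chord_ge u v : 2 * dotv (u - v) (u - v) <= (ht u + ht v) ^+ 2 * chord u v.
Proof.
have hu := height_gt0 u; have hv := height_gt0 v.
have e : (ht u + ht v) * (excess u - excess v) = - dotv (u - v) (u + v).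
  rewrite !(ipE dP) (ipC dP v u) !dotv_excess !height_excess; ring.
have -> : chord u v = kappa * (excess u - excess v) ^+ 2 + dotv (u - v) (u - v).
  by rewrite /chord mkcovB qform_mkcov expr2.
have -> : (ht u + ht v) ^+ 2 * (kappa * (excess u - excess v) ^+ 2 + dotv (u - v) (u - v)) =
   kappa * ((ht u + ht v) * (excess u - excess v)) ^+ 2
   + (ht u + ht v) ^+ 2 * dotv (u - v) (u - v) by ring.
rewrite e sqrrN.
have cs := cauchy_schwarz dP (u - v) (u + v).
have b : 0 <= ht u * ht v + kappa * dotv u v.
  have cs' := cauchy_schwarz dP u v.
  have [//|h] := leP 0 (ht u * ht v + kappa * dotv u v).
  have uu := ip_ge0 dP u; have vv := ip_ge0 dP v.
  have sq : (ht u * ht v) ^+ 2 = (1 - kappa * dotv u u) * (1 - kappa * dotv v v).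
    by rewrite exprMn !height_sqr.
  have huv : 0 < ht u * ht v by rewrite mulr_gt0.
  have lt1 : ht u * ht v < - (kappa * dotv u v) by lra.
  have lt2 : (ht u * ht v) ^+ 2 < (kappa * dotv u v) ^+ 2.
    by rewrite -[X in _ < X]sqrrN ltr_pXn2r // nnegrE ltW // (lt_trans huv).
  have ku : 0 <= - kappa * dotv u u by rewrite mulNr oppr_ge0 mulr_le0_ge0.
  have kv : 0 <= - kappa * dotv v v by rewrite mulNr oppr_ge0 mulr_le0_ge0.
  have kk : kappa ^+ 2 * dotv u v ^+ 2 <= kappa ^+ 2 * (dotv u u * dotv v v).
    by rewrite ler_wpM2l // sqr_ge0.
  exfalso; move: lt2; rewrite sq exprMn => lt2; nra.
have sumE : (ht u + ht v) ^+ 2 + kappa * dotv (u + v) (u + v) =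
    2 + 2 * (ht u * ht v + kappa * dotv u v).
  by rewrite !(ipE dP) (ipC dP v u) sqrrD !height_sqr; ring.
have nn := ip_ge0 dP (u - v).
have h2 : 2 * dotv (u - v) (u - v) <=
    ((ht u + ht v) ^+ 2 + kappa * dotv (u + v) (u + v)) * dotv (u - v) (u - v).
  by rewrite sumE ler_wpM2r //; lra.
have h3 : kappa * (dotv (u - v) (u - v) * dotv (u + v) (u + v)) <=
    kappa * dotv (u - v) (u + v) ^+ 2 by rewrite ler_wnM2l.
by apply: le_trans h2 _; lra.
Qed.

Lemma chord_ge0 u v : 0 <= chord u v.
Proof.
have h := chord_ge u v; have nn := ip_ge0 dP (u - v).
have p : 0 < (ht u + ht v) ^+ 2 by rewrite exprn_gt0 // addr_gt0 ?height_gt0.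
by rewrite -(pmulr_rge0 _ p); lra.
Qed.

Lemma chord_eq0 u v : chord u v = 0 -> u = v.
Proof.
move=> h; have := chord_ge u v; rewrite h mulr0 => h2.
apply/eqP; rewrite -subr_eq0; apply/eqP/(ip_eq0 dP).
by have := ip_ge0 dP (u - v); lra.
Qed.

Let coshE u v : ht u * ht v + kappa * dotv u v = 1 - kappa / 2 * chord u v.
Proof. by rewrite chordE !height_excess; field. Qed.

Definition expcosh (z : R) : R := z + Num.sqrt (z ^+ 2 - 1).

Lemma expcosh_ge1 z : 1 <= z -> 1 <= expcosh z.
Proof. by move=> z1; rewrite ler_wpDr // sqrtr_ge0. Qed.

Lemma expcoshV z : 1 <= z -> expcosh z * (z - Num.sqrt (z ^+ 2 - 1)) = 1.
Proof.
move=> z1; rewrite /expcosh mulrC -subr_sqr sqr_sqrtr; first by ring.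
by rewrite subr_ge0 expr_ge1 // (le_trans ler01).
Qed.

Lemma expcosh_inj y z : 1 <= y -> 1 <= z -> expcosh y = expcosh z -> y = z.
Proof.
move=> y1 z1 e; have ey := expcoshV y1; have ez := expcoshV z1.
have e0 : expcosh y != 0 by apply: lt0r_neq0; apply: lt_le_trans ltr01 (expcosh_ge1 y1).
have e2 : y - Num.sqrt (y ^+ 2 - 1) = z - Num.sqrt (z ^+ 2 - 1).
  by apply: (mulfI e0); rewrite ey e ez.
by move: e; rewrite /expcosh; lra.
Qed.

Let cosh_ge1 u v : 1 <= 1 - kappa / 2 * chord u v.
Proof.
rewrite lerDl oppr_ge0; apply: mulr_le0_ge0; last exact: chord_ge0.
by rewrite pmulr_lle0 // invr_gt0.
Qed.

Lemma dist_flat u v : kappa = 0 -> dist kappa u v = Num.sqrt (chord u v).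
Proof.
move=> e; rewrite /dist e eqxx /chord mkcovB qform_mkcov e mul0r add0r; done.
Qed.

Lemma dist_hyp u v : kappa != 0 ->
  dist kappa u v = ln (expcosh (1 - kappa / 2 * chord u v)) / Num.sqrt (- kappa).
Proof. by move=> e; rewrite /dist (negPf e) coshE. Qed.

Lemma dist_chord u v u' v' :
  dist kappa u v = dist kappa u' v' <-> chord u v = chord u' v'.
Proof.
have [e|e] := eqVneq kappa 0.
  rewrite !dist_flat //; split=> [h|-> //].
  have := congr1 (fun x => x ^+ 2) h; rewrite !sqr_sqrtr ?chord_ge0 //.
rewrite !dist_hyp //; split=> [h|-> //].
have sk : Num.sqrt (- kappa) != 0.
  by apply: lt0r_neq0; rewrite sqrtr_gt0 oppr_gt0 lt_neqAle e.
move: h => /(mulIf (invr_neq0 sk)) h.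
have p x y : expcosh (1 - kappa / 2 * chord x y) \is Num.pos.
  by rewrite posrE; apply: lt_le_trans ltr01 (expcosh_ge1 (cosh_ge1 x y)).
have := expcosh_inj (cosh_ge1 u v) (cosh_ge1 u' v') (ln_inj (p u v) (p u' v') h).
have k2 : kappa / 2 != 0 by rewrite mulf_neq0 // invr_neq0.
move=> h2; apply: (mulfI k2); lra.
Qed.

Definition incone (X : EE) : Prop :=
  0 < cov0 X /\ 0 < cov0 X ^+ 2 + kappa * dotv (covr X) (covr X).

Lemma sheet_incone v : incone (sh v).
Proof.
rewrite /incone sheetE mkcov_l mkcov_r; split; first exact: height_gt0.
by rewrite height_sqr; lra.
Qed.

Lemma incone_sheet X : incone X -> exists q v, 0 < q /\ X = q *: sh v.
Proof.
move=> [x0 q0]; rewrite [X]mkcovE; move: (cov0 X) (covr X) x0 q0 => x w x0 q0.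
have [q qp qq] : exists2 q, 0 < q & q ^+ 2 = x ^+ 2 + kappa * dotv w w.
  by exists (Num.sqrt (x ^+ 2 + kappa * dotv w w)); rewrite ?sqrtr_gt0 ?sqr_sqrtr ?ltW.
exists q, (q^-1 *: w); split=> //.
have -> : sh (q^-1 *: w) = mkcov (x / q) (q^-1 *: w).
  rewrite sheetE; congr mkcov; apply/eqP.
  rewrite -(eqrXn2 (n := 2)) //; last by rewrite divr_ge0 ?ltW.
    rewrite height_sqr !(ipE dP); apply/eqP.
    have q1 : q != 0 by apply: lt0r_neq0.
    apply: (mulIf (expf_neq0 2 q1)).
    transitivity (q ^+ 2 - kappa * dotv w w); first by field.
    by transitivity (x ^+ 2); [rewrite qq; ring | field].
  by rewrite ltW // height_gt0.
by rewrite mkcovZ scalerA mulrC divfK ?mulfV ?scale1r // lt0r_neq0.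
Qed.

Lemma incone_open v (X : EE) : exists2 e, 0 < e & incone (sh v + e *: X) /\ incone (sh v - e *: X).
Proof.
rewrite sheetE [X]mkcovE; set x := cov0 X; set w := covr X.
pose be := ht v * x + kappa * dotv v w; pose ga := x ^+ 2 + kappa * dotv w w.
pose M := 1 + 2 * `|be| + `|ga| + `|x|.
have [b0 g0 x0] : [/\ 0 <= `|be|, 0 <= `|ga| & 0 <= `|x|] by split; apply: normr_ge0.
have M1 : 1 <= M by rewrite /M; lra.
have M0 : 0 < M by lra.
exists M^-1; first by rewrite invr_gt0.
set e := M^-1; have eM : e * M = 1 by rewrite /e mulVf // lt0r_neq0.
have e0 : 0 < e by rewrite invr_gt0.
have e1 : e <= 1 by rewrite /e invf_le1.
have key (s : R) : s = e \/ s = - e -> incone (mkcov (ht v) v + s *: mkcov x w).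
  move=> hs; have ns : `|s| = e by case: hs => ->; rewrite ?normrN gtr0_norm.
  rewrite mkcovZ mkcovD /incone mkcov_l mkcov_r; have h := height_ge1 v.
  have sx : - (e * `|x|) <= s * x.
    by rewrite -ns -normrM lerNl -normrN ler_norm.
  have sb : - (e * `|be|) <= s * be.
    by rewrite -ns -normrM lerNl -normrN ler_norm.
  have sg : - (e * `|ga|) <= s ^+ 2 * ga.
    rewrite lerNl; apply: le_trans (ler_norm _) _; rewrite normrN normrM normrX ns.
    by rewrite ler_wpM2r // expr2 ler_piMr // ltW.
  have eE : e + 2 * (e * `|be|) + e * `|ga| + e * `|x| = 1.
    by transitivity (e * M); [rewrite /M; ring | exact: eM].
  have ex : 0 <= e * `|x| by rewrite mulr_ge0 // ltW.
  have eb : 0 <= e * `|be| by rewrite mulr_ge0 // ltW.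
  have eg : 0 <= e * `|ga| by rewrite mulr_ge0 // ltW.
  split; first lra.
  have -> : (ht v + s * x) ^+ 2 + kappa * dotv (v + s *: w) (v + s *: w) =
      ht v ^+ 2 + kappa * dotv v v + 2 * (s * be) + s ^+ 2 * ga.
    by rewrite !(ipE dP) (ipC dP w v) /be /ga; ring.
  by rewrite height_sqr; lra.
by split; [apply: key; left | rewrite -scaleNr; apply: key; right].
Qed.

Lemma proper_qform a : proper_covector kappa a -> 0 < qform a a.
Proof.
move=> [a0 [v]]; rewrite /hplane /= sheetE [a]mkcovE dotv_mkcov qform_mkcov.
set x := cov0 a; set w := covr a => h.
have w0 : w != 0.
  apply/eqP => w0; move: h; rewrite w0 (ip0l dP) addr0 => /eqP.
  rewrite mulf_eq0 (gt_eqF (height_gt0 v)) orbF => /eqP x0.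
  by move/eqP: a0; apply; rewrite [a]mkcovE -/x -/w x0 w0 /mkcov raddf0 row_mx0.
have ww : 0 < dotv w w by case: dP => _ _; apply.
have cs := cauchy_schwarz dP w v; have hv := height_sqr v; have hp := height_gt0 v.
have sq : (x * ht v) ^+ 2 = dotv w v ^+ 2.
  have -> : x * ht v = - dotv w v by lra.
  by rewrite sqrrN.
have h2 : 0 < ht v ^+ 2 by rewrite exprn_gt0.
rewrite -(pmulr_rgt0 _ h2).
have -> : ht v ^+ 2 * (kappa * (x * x) + dotv w w) =
    kappa * (x * ht v) ^+ 2 + ht v ^+ 2 * dotv w w by ring.
rewrite sq hv; have : kappa * (dotv w w * dotv v v) <= kappa * dotv w v ^+ 2.
  by rewrite ler_wnM2l.
lra.
Qed.

(** The covector of a hyperplane is unique up to scalars, because the points of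
the sheet in a proper linear hyperplane span it. *)
Lemma hplane_span a (c : EE) : proper_covector kappa a ->
  (forall p, hplane kappa a p -> dotv c (sh p) = 0) -> exists l, c = l *: a.
Proof.
move=> ap h; have [a0 [v av]] := ap.
have aa : 0 < dotv a a by case: dP1 => _ _; apply.
exists (dotv c a / dotv a a).
have perp (X : EE) : dotv a X = 0 -> dotv c X = 0.
  move=> aX; have [e e0 [inc _]] := incone_open v X.
  have [q [p [q0 pE]]] := incone_sheet inc.
  have ap0 : hplane kappa a p.
    rewrite /hplane /=; apply: (mulfI (lt0r_neq0 q0)); rewrite mulr0.
    rewrite -(ipZr dP1) -pE (ipDr dP1) (ipZr dP1) aX mulr0 addr0; exact: av.
  have := congr1 (dotv c) pE; rewrite (ipDr dP1) !(ipZr dP1) (h v av) (h p ap0) mulr0 add0r.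
  by move/eqP; rewrite mulf_eq0 (gt_eqF e0) => /eqP.
apply/eqP; rewrite -subr_eq0; apply/eqP/(ip_eq0 dP1).
set d := c - _; have ad : dotv a d = 0.
  by rewrite /d !(ipE dP1) (ipC dP1 a c) divfK ?subrr ?lt0r_neq0.
by rewrite {1}/d (ipBl dP1) (ipZl dP1) ad mulr0 (perp d ad) subr0.
Qed.

(** The linear reflection orthogonal for the quadratic form of the sheet. *)
Definition hrefl a (X : EE) : EE := X - (2 * dotv a X / qform a a) *: sharp a.

Lemma isometry_chord f : isometry kappa f -> forall u v, chord (f u) (f v) = chord u v.
Proof. by case=> _ h u v; apply/dist_chord. Qed.

Lemma lift_inj u v : qlift u = qlift v -> u = v.
Proof. by move/mkcov_inj => []. Qed.

Lemma sharpB a b : sharp (a - b) = sharp a - sharp b.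
Proof.
rewrite [a]mkcovE [b]mkcovE mkcovB !sharp_mkcov mkcovB; congr mkcov; ring.
Qed.
Lemma sharpZ l a : sharp (l *: a) = l *: sharp a.
Proof. by rewrite [a]mkcovE mkcovZ !sharp_mkcov mkcovZ; congr mkcov; ring. Qed.

(** A reflection is given by a linear reflection of the ambient space: a moved
point and its image have the mirror as bisector, which determines the image. *)
Lemma reflection_hrefl r : reflection kappa r ->
  exists a, [/\ proper_covector kappa a,
    forall v, sh (r v) = hrefl a (sh v) & forall v, r v = v <-> hplane kappa a v].
Proof.
move=> [isr nid [_ [a ap ->] fixH]].
have qa := proper_qform ap; have qa0 : qform a a != 0 by rewrite lt0r_neq0.
have ch := isometry_chord isr.
have moved p : r p <> p -> exists2 l, l != 0 & qlift p - qlift (r p) = l *: a.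
  move=> rp; have [l e] : exists l, qlift p - qlift (r p) = l *: a.
    apply: hplane_span => // h hH.
    have := chord_bisector p (r p) h; rewrite -{2}(fixH h hH) ch subrr => /eqP.
    by rewrite eq_sym mulf_eq0 oppr_eq0 pnatr_eq0 /= => /eqP.
  exists l => //; apply/eqP => l0; apply: rp; apply: lift_inj.
  by apply/esym/eqP; rewrite -subr_eq0 e l0 scale0r.
have [p0 rp0] : exists p, r p <> p.
  by apply: contrapT => no; apply: nid; apply: funext => p; apply: contrapT => h; apply: no; exists p.
have fixP v : r v = v <-> hplane kappa a v.
  split=> [rv|]; last exact: fixH.
  have [l l0 e] := moved p0 rp0.
  have := chord_bisector p0 (r p0) v; rewrite -{2}rv ch subrr e (ipZl dP1) => /eqP.
  by rewrite eq_sym !mulf_eq0 oppr_eq0 pnatr_eq0 (negPf l0) /= => /eqP.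
exists a; split=> // v.
case: (pselect (r v = v)) => rv.
  by rewrite rv /hrefl ((fixP v).1 rv) mulr0 mul0r scale0r subr0.
have [l l0 e] := moved v rv.
rewrite /hrefl; suff -> : 2 * dotv a (sh v) / qform a a = l.
  rewrite -sharpZ -e sharpB !sheet_lift opprB -addrA; congr (_ + _).
  by rewrite addrCA subrr addr0.
have e2 : qlift (r v) = qlift v - l *: a by rewrite -e opprB addrCA subrr addr0.
move: e2; rewrite [a]mkcovE; set x := cov0 a; set w := covr a.
rewrite mkcovZ mkcovB => /mkcov_inj [ex ev].
have q1 := dotv_excess (r v); have q2 := dotv_excess v.
rewrite ex in q1; rewrite {1 2}ev in q1; rewrite !(ipE dP) (ipC dP w v) q2 in q1.
rewrite sheetE dotv_mkcov height_excess qform_mkcov.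
rewrite [a]mkcovE -/x -/w qform_mkcov in qa0.
apply: (mulIf qa0); rewrite mulfVK //; apply: (mulfI l0).
by rewrite (ipC dP w v); lra.
Qed.

Lemma hreflZ l a X : l != 0 -> hrefl (l *: a) X = hrefl a X.
Proof.
move=> l0; rewrite /hrefl sharpZ scalerA; congr (_ - _ *: _).
have -> : qform (l *: a) (l *: a) = l ^+ 2 * qform a a.
  by rewrite [a]mkcovE mkcovZ !qform_mkcov !(ipE dP); ring.
have [->|q0] := eqVneq (qform a a) 0; first by rewrite mulr0 !invr0 !mulr0 mul0r.
by rewrite (ipZl dP1); field; rewrite l0 q0.
Qed.

(** The mirror consists of points equidistant from u and v, hence is their
bisector. *)
Lemma exchanging_hrefl u v r : u <> v -> exchanging_reflection kappa u v r ->
  forall p, sh (r p) = hrefl (qlift u - qlift v) (sh p).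
Proof.
move=> uv [rr ru rv] p; have [a [ap ra fixP]] := reflection_hrefl rr.
have [isr _ _] := rr; have [l e] : exists l, qlift u - qlift v = l *: a.
  apply: hplane_span => // h /fixP rh.
  have := chord_bisector u v h; rewrite -{1}rh -rv (isometry_chord isr) subrr.
  by move=> /eqP; rewrite eq_sym mulf_eq0 oppr_eq0 pnatr_eq0 /= => /eqP.
have l0 : l != 0.
  apply/eqP => l0; apply: uv; apply: lift_inj.
  by apply/eqP; rewrite -subr_eq0 e l0 scale0r.
by rewrite ra e hreflZ.
Qed.

Lemma exchanging_uniq u v r r' : u <> v ->
  exchanging_reflection kappa u v r -> exchanging_reflection kappa u v r' -> r = r'.
Proof.
move=> uv h h'; apply: funext => p; apply: sheet_inj.
by rewrite (exchanging_hrefl uv h) (exchanging_hrefl uv h').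
Qed.

End Model.

(** The case of equality in the triangle inequality. *)
Lemma triangle_eq (R : realType) (E : lmodType R) (g : E -> E -> R) (x y : E) :
  inner_product g ->
  Num.sqrt (g x x) + Num.sqrt (g y y) = Num.sqrt (g (x + y) (x + y)) ->
  Num.sqrt (g y y) *: x = Num.sqrt (g x x) *: y.
Proof.
move=> gP; set a := Num.sqrt (g x x); set b := Num.sqrt (g y y).
have aa : a ^+ 2 = g x x by rewrite sqr_sqrtr ?(ip_ge0 gP).
have bb : b ^+ 2 = g y y by rewrite sqr_sqrtr ?(ip_ge0 gP).
move=> /(congr1 (fun z => z ^+ 2)); rewrite sqr_sqrtr ?(ip_ge0 gP) //.
rewrite (ipDl gP) !(ipDr gP) (ipC gP y x) -aa -bb => h.
have ab : g x y = a * b by move: h; rewrite sqrrD; lra.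
apply/eqP; rewrite -subr_eq0; apply/eqP/(ip_eq0 gP).
rewrite (ipBl gP) !(ipBr gP) !(ipZl gP) !(ipZr gP).
by rewrite (ipC gP y x) -aa -bb ab; ring.
Qed.

Section Segments.
Variables (R : realType) (n : nat) (kappa : R).
Hypothesis k0 : kappa <= 0.
Let dP := @dotv_inner R n.
Let dP1 := @dotv_inner R (1 + n).
Local Notation EE := (matrix R 1 (1 + n)%N).
Local Notation ht := (height kappa).
Local Notation sh := (sheet kappa).
Implicit Types (u v p : 'rV[R]_n).

(** The quadratic form of the ambient space that equals 1 on the sheet. *)
Definition sheet_form (X Y : EE) : R := cov0 X * cov0 Y + kappa * dotv (covr X) (covr Y).

Let sf_mkcov x y u v : sheet_form (mkcov x u) (mkcov y v) = x * y + kappa * dotv u v.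
Proof. by rewrite /sheet_form !mkcov_l !mkcov_r. Qed.

Let sfC X Y : sheet_form X Y = sheet_form Y X.
Proof. by rewrite /sheet_form mulrC (ipC dP). Qed.
Let sfD X Y Z : sheet_form (X + Y) Z = sheet_form X Z + sheet_form Y Z.
Proof.
by rewrite [X]mkcovE [Y]mkcovE [Z]mkcovE mkcovD !sf_mkcov (ipDl dP); ring.
Qed.
Let sfZ a X Z : sheet_form (a *: X) Z = a * sheet_form X Z.
Proof. by rewrite [X]mkcovE [Z]mkcovE mkcovZ !sf_mkcov (ipZl dP); ring. Qed.
Let sfDr X Y Z : sheet_form Z (X + Y) = sheet_form Z X + sheet_form Z Y.
Proof. by rewrite sfC sfD !(sfC Z). Qed.
Let sfZr a X Z : sheet_form Z (a *: X) = a * sheet_form Z X.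
Proof. by rewrite sfC sfZ (sfC Z). Qed.
Let sfE := (sfD, sfDr, sfZ, sfZr).

Lemma sheet_form1 v : sheet_form (sh v) (sh v) = 1.
Proof. by rewrite sheetE sf_mkcov -expr2 height_sqr //; ring. Qed.

Lemma sheet_form_chord u v : sheet_form (sh u) (sh v) = 1 - kappa / 2 * chord kappa u v.
Proof. by rewrite !sheetE sf_mkcov chordE // !height_excess //; field. Qed.

Lemma sheet_form_ge1 u v : 1 <= sheet_form (sh u) (sh v).
Proof.
rewrite sheet_form_chord lerDl oppr_ge0; apply: mulr_le0_ge0; last exact: chord_ge0.
by rewrite pmulr_lle0 // invr_gt0.
Qed.

(** For negative curvature, the form is negative definite on tangent spaces. *)
Lemma tangent_eq0 p X : kappa != 0 -> sheet_form X (sh p) = 0 ->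
  sheet_form X X = 0 -> X = 0.
Proof.
move=> kn; rewrite [X]mkcovE sheetE !sf_mkcov; move: (cov0 X) (covr X) => x w h1 h2.
have k1 : kappa < 0 by rewrite lt_neqAle kn.
have cs := cauchy_schwarz dP w p; have ww := ip_ge0 dP w.
have hp := height_sqr k0 p; have hp0 := height_gt0 k0 p.
have e : (x * ht p) ^+ 2 = kappa ^+ 2 * dotv w p ^+ 2.
  have -> : x * ht p = - (kappa * dotv w p) by lra.
  by rewrite sqrrN exprMn.
have e2 : ht p ^+ 2 * (x * x + kappa * dotv w w) = 0 by rewrite h2 mulr0.
have e3 : kappa ^+ 2 * dotv w p ^+ 2 + (1 - kappa * dotv p p) * (kappa * dotv w w) = 0.
  by rewrite -e -hp -[RHS]e2; ring.
have e4 : kappa ^+ 2 * dotv w p ^+ 2 <= kappa ^+ 2 * (dotv w w * dotv p p).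
  by rewrite ler_wpM2l // sqr_ge0.
have e5 : 0 <= kappa * dotv w w by lra.
have w0 : w = 0.
  apply: (ip_eq0 dP); apply/eqP; rewrite eq_le ww andbT.
  by rewrite -(nmulr_rge0 _ k1).
move: h1; rewrite w0 (ip0l dP) mulr0 addr0 => /eqP.
rewrite mulf_eq0 (gt_eqF hp0) orbF => /eqP ->.
by rewrite /mkcov raddf0 row_mx0.
Qed.

Let expcoshM (y z : R) : 1 <= y -> 1 <= z ->
  expcosh y * expcosh z =
  expcosh (y * z + Num.sqrt (y ^+ 2 - 1) * Num.sqrt (z ^+ 2 - 1)).
Proof.
move=> y1 z1; rewrite /expcosh; set a := Num.sqrt (y ^+ 2 - 1).
set b := Num.sqrt (z ^+ 2 - 1).
have aa : a ^+ 2 = y ^+ 2 - 1 by rewrite sqr_sqrtr // subr_ge0 expr_ge1 // (le_trans ler01).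
have bb : b ^+ 2 = z ^+ 2 - 1 by rewrite sqr_sqrtr // subr_ge0 expr_ge1 // (le_trans ler01).
have a0 : 0 <= a := sqrtr_ge0 _; have b0 : 0 <= b := sqrtr_ge0 _.
have -> : (y * z + a * b) ^+ 2 - 1 = (y * b + a * z) ^+ 2.
  have -> : (y * z + a * b) ^+ 2 - 1 = y ^+ 2 * z ^+ 2 + a ^+ 2 * b ^+ 2 + 2 * y * z * a * b - 1 by ring.
  have -> : (y * b + a * z) ^+ 2 = y ^+ 2 * b ^+ 2 + a ^+ 2 * z ^+ 2 + 2 * y * z * a * b by ring.
  by rewrite aa bb; ring.
rewrite sqrtr_sqr ger0_norm; first by ring.
by rewrite addr_ge0 // mulr_ge0 // (le_trans ler01).
Qed.

Let segment_hyp u v p : kappa != 0 -> segment kappa u v p <->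
  sheet_form (sh u) (sh v) =
    sheet_form (sh u) (sh p) * sheet_form (sh p) (sh v) +
    Num.sqrt (sheet_form (sh u) (sh p) ^+ 2 - 1) * Num.sqrt (sheet_form (sh p) (sh v) ^+ 2 - 1).
Proof.
move=> kn; rewrite /segment /= !dist_hyp // -!sheet_form_chord -mulrDl.
have sk : Num.sqrt (- kappa) != 0.
  by apply: lt0r_neq0; rewrite sqrtr_gt0 oppr_gt0 lt_neqAle kn.
set al := sheet_form _ _; set be := sheet_form (sh p) _; set ga := sheet_form _ _.
have [al1 be1 ga1] : [/\ 1 <= al, 1 <= be & 1 <= ga] by split; apply: sheet_form_ge1.
have p1 (z : R) : 1 <= z -> expcosh z \is Num.pos.
  by move=> z1; rewrite posrE; apply: lt_le_trans ltr01 (expcosh_ge1 z1).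
rewrite -lnM ?p1 // expcoshM //.
set de := al * be + _; have de1 : 1 <= de.
  by rewrite /de ler_wpDr ?mulr_ge0 ?sqrtr_ge0 // -[1]mulr1 ler_pM.
split=> [/(mulIf (invr_neq0 sk)) h | -> //].
by apply/esym/expcosh_inj => //; apply: ln_inj h; apply: p1.
Qed.

(** The equality case of the triangle inequality: in the flat case the one of the
Euclidean norm; otherwise the addition formula of cosh makes a combination of the
three vectors isotropic and tangent, hence zero. *)
Lemma segment_sheet u v p : segment kappa u v p <->
  exists x y, [/\ 0 <= x, 0 <= y & sh p = x *: sh u + y *: sh v].
Proof.
have [e|kn] := eqVneq kappa 0.
  have h1 w : ht w = 1 by rewrite /height e mul0r subr0 sqrtr1.
  have cE w z : chord kappa w z = dotv (w - z) (w - z).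
    by rewrite /chord mkcovB qform_mkcov e mul0r add0r.
  rewrite /segment /= !dist_flat // !cE.
  have uvE : u - v = (u - p) + (p - v) by rewrite addrA subrK.
  set a := Num.sqrt (dotv (u - p) (u - p)); set b := Num.sqrt (dotv (p - v) (p - v)).
  have a0 : 0 <= a := sqrtr_ge0 _; have b0 : 0 <= b := sqrtr_ge0 _.
  have aa : a ^+ 2 = dotv (u - p) (u - p) by rewrite sqr_sqrtr ?(ip_ge0 dP).
  have bb : b ^+ 2 = dotv (p - v) (p - v) by rewrite sqr_sqrtr ?(ip_ge0 dP).
  split.
    rewrite uvE => /(triangle_eq dP); rewrite -/a -/b => z.
    have z2 : (a + b) *: p = b *: u + a *: v.
      move/eqP: z; rewrite !scalerBr subr_eq => /eqP ->; rewrite scalerDl.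
      by rewrite [RHS](ACl (1 * 3 * (4 * 2)))%AC /= subrr addr0.
    have [ab0|ab0] := eqVneq (a + b) 0.
      have a00 : a = 0 by lra.
      have up : u - p = 0 by apply: (ip_eq0 dP); rewrite -aa a00 expr0n.
      exists 1, 0; split=> //; rewrite scale1r scale0r addr0.
      by move/eqP: up; rewrite subr_eq0 => /eqP ->.
    have abp : 0 < a + b by rewrite lt0r ab0 addr_ge0.
    exists (b / (a + b)), (a / (a + b)).
    split; [exact: divr_ge0 (ltW abp)|exact: divr_ge0 (ltW abp)|].
    rewrite !sheetE !h1 !mkcovZ mkcovD; congr mkcov; first by field.
    apply: (scalerI ab0); rewrite z2 scalerDr !scalerA !(mulrC (a + b)) !divfK //.
  move=> [x [y [x0 y0]]]; rewrite !sheetE !h1 !mkcovZ mkcovD !mulr1.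
  move=> /mkcov_inj [xy pE].
  have up : u - p = y *: (u - v).
    rewrite pE scalerBr opprD addrA; congr (_ - _).
    by rewrite -{1}[u]scale1r -scalerBl; congr (_ *: _); lra.
  have pv : p - v = x *: (u - v).
    rewrite pE scalerBr -addrA; congr (_ + _).
    by rewrite -{2}[v]scale1r -scalerBl -scaleNr; congr (_ *: _); lra.
  have sc (c : R) (w : 'rV[R]_n) : 0 <= c ->
      Num.sqrt (dotv (c *: w) (c *: w)) = c * Num.sqrt (dotv w w).
    move=> c0; rewrite (ipZl dP) (ipZr dP) mulrA -expr2 sqrtrM ?sqr_ge0 //.
    by rewrite sqrtr_sqr ger0_norm.
  rewrite /a /b up pv !sc // -mulrDl.
  by rewrite (_ : y + x = 1) ?mul1r //; lra.
rewrite (segment_hyp u v p kn).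
set al := sheet_form (sh u) (sh p); set be := sheet_form (sh p) (sh v).
set ga := sheet_form (sh u) (sh v).
have [al1 be1 ga1] : [/\ 1 <= al, 1 <= be & 1 <= ga] by split; apply: sheet_form_ge1.
have sq (z : R) : 1 <= z -> Num.sqrt (z ^+ 2 - 1) ^+ 2 = z ^+ 2 - 1.
  by move=> z1; rewrite sqr_sqrtr // subr_ge0 expr_ge1 // (le_trans ler01).
split.
  set a := Num.sqrt (al ^+ 2 - 1); set b := Num.sqrt (be ^+ 2 - 1) => h.
  have a0 : 0 <= a := sqrtr_ge0 _; have b0 : 0 <= b := sqrtr_ge0 _.
  have aa : a ^+ 2 = al ^+ 2 - 1 := sq _ al1.
  have bb : b ^+ 2 = be ^+ 2 - 1 := sq _ be1.
  pose X := b *: sh u + a *: sh v + (- (b * al + a * be)) *: sh p.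
  have Xp : sheet_form X (sh p) = 0.
    by rewrite /X !sfE (sfC (sh v)) -/al -/be sheet_form1; ring.
  have XX : sheet_form X X = 0.
    rewrite {2}/X !sfDr !sfZr Xp mulr0 addr0 /X !sfE !sheet_form1.
    rewrite (sfC (sh v) (sh u)) (sfC (sh p) (sh u)) -/al -/be -/ga h.
    have -> : b * (b * 1 + a * (al * be + a * b) + - (b * al + a * be) * al) +
              a * (b * (al * be + a * b) + a * 1 + - (b * al + a * be) * be) =
      b ^+ 2 * (1 - al ^+ 2) + a ^+ 2 * (1 - be ^+ 2) + 2 * (a ^+ 2 * b ^+ 2) by ring.
    by rewrite aa bb; ring.
  have X0 := tangent_eq0 kn Xp XX.
  have pE : (b * al + a * be) *: sh p = b *: sh u + a *: sh v.
    by apply/eqP; rewrite eq_sym -subr_eq0 -scaleNr -/X X0.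
  have [s0|s0] := eqVneq (b * al + a * be) 0.
    have a00 : a = 0 by nra.
    have al11 : al = 1 by move: aa; rewrite a00; nra.
    exists 1, 0; split=> //; rewrite scale1r scale0r addr0; congr sheet.
    apply/esym/(chord_eq0 k0); move: al11; rewrite /al sheet_form_chord => h2.
    have k2 : kappa / 2 != 0 by rewrite mulf_neq0 // invr_neq0.
    by apply: (mulfI k2); lra.
  have sp : 0 < b * al + a * be.
    by rewrite lt0r s0 addr_ge0 // mulr_ge0 // (le_trans ler01).
  exists (b / (b * al + a * be)), (a / (b * al + a * be)).
  split; [exact: divr_ge0 (ltW sp)|exact: divr_ge0 (ltW sp)|].
  by apply: (scalerI s0); rewrite pE scalerDr !scalerA !(mulrC (b * al + _)) !divfK.
move=> [x [y [x0 y0 pE]]].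
have alE : al = x + y * ga by rewrite /al pE !sfE sheet_form1 mulr1.
have beE : be = x * ga + y by rewrite /be pE !sfE sheet_form1 mulr1.
have one : x ^+ 2 + 2 * x * y * ga + y ^+ 2 = 1.
  have := sheet_form1 p; rewrite {1}pE !sfE (sfC (sh v)) -/al -/be alE beE => h.
  by rewrite -[RHS]h; ring.
pose q := Num.sqrt (ga ^+ 2 - 1).
have qq : q ^+ 2 = ga ^+ 2 - 1 := sq _ ga1.
have q0 : 0 <= q := sqrtr_ge0 _.
have -> : Num.sqrt (al ^+ 2 - 1) = y * q.
  have -> : al ^+ 2 - 1 = (y * q) ^+ 2.
    transitivity ((x + y * ga) ^+ 2 - (x ^+ 2 + 2 * x * y * ga + y ^+ 2)).
      by rewrite one alE.
    by rewrite exprMn qq; ring.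
  by rewrite sqrtr_sqr ger0_norm // mulr_ge0.
have -> : Num.sqrt (be ^+ 2 - 1) = x * q.
  have -> : be ^+ 2 - 1 = (x * q) ^+ 2.
    transitivity ((x * ga + y) ^+ 2 - (x ^+ 2 + 2 * x * y * ga + y ^+ 2)).
      by rewrite one beE.
    by rewrite exprMn qq; ring.
  by rewrite sqrtr_sqr ger0_norm // mulr_ge0.
have -> : y * q * (x * q) = x * y * (ga ^+ 2 - 1) by rewrite -qq; ring.
rewrite alE beE; transitivity (ga * (x ^+ 2 + 2 * x * y * ga + y ^+ 2)); last by ring.
by rewrite one mulr1.
Qed.

Lemma halfspace_convex (a : EE) : geodesically_convex kappa (halfspace kappa a).
Proof.
move=> u v hu hv p /segment_sheet [x [y [x0 y0 e]]].
rewrite /halfspace /= e (ipDr dP1) !(ipZr dP1).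
by apply: addr_ge0; apply: mulr_ge0.
Qed.

Lemma open_halfspace_convex (a : EE) :
  geodesically_convex kappa [set v | 0 < dotv a (sh v)].
Proof.
move=> u v hu hv p /segment_sheet [x [y [x0 y0 e]]].
rewrite /= in hu hv *; have : 0 <= dotv a (sh p).
  by rewrite e (ipDr dP1) !(ipZr dP1) addr_ge0 // mulr_ge0 // ltW.
rewrite le_eqVlt => /orP[/eqP h|//]; exfalso.
move: h; rewrite e (ipDr dP1) !(ipZr dP1) => h.
have [x00 y00] : x = 0 /\ y = 0 by split; nra.
have := height_gt0 k0 p; move: e; rewrite x00 y00 !scale0r addr0 sheetE => e.
have e0 : mkcov (ht p) p = mkcov 0 0 by rewrite e /mkcov raddf0 row_mx0.
by have [-> _] := mkcov_inj e0; rewrite ltxx.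
Qed.

Lemma segment_l u v : segment kappa u v u.
Proof. by apply/segment_sheet; exists 1, 0; rewrite scale1r scale0r addr0. Qed.
Lemma segment_r u v : segment kappa u v v.
Proof. by apply/segment_sheet; exists 0, 1; rewrite scale1r scale0r add0r. Qed.

Lemma sheet_comb_uniq u v x y : u <> v -> 0 <= x -> 0 <= y ->
  sh u = x *: sh u + y *: sh v -> x = 1 /\ y = 0.
Proof.
move=> uv x0 y0 e.
have [y00|yn] := eqVneq y 0.
  split=> //; move: e; rewrite y00 scale0r addr0 => e.
  have : (x - 1) *: sh u = 0 by rewrite scalerBl scale1r -e subrr.
  rewrite sheetE mkcovZ => h; have h0 : mkcov ((x - 1) * ht u) ((x - 1) *: u) = mkcov 0 0.
    by rewrite h /mkcov raddf0 row_mx0.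
  have [/eqP] := mkcov_inj h0; rewrite mulf_eq0 (gt_eqF (height_gt0 k0 u)) orbF.
  by rewrite subr_eq0 => /eqP.
have yp : 0 < y by rewrite lt0r yn.
exfalso; apply: uv; apply: (sheet_inj (kappa := kappa)).
have e2 : sh v = ((1 - x) / y) *: sh u.
  apply: (scalerI yn); rewrite scalerA mulrC divfK // scalerBl scale1r.
  by rewrite {1}e addrC addKr.
set k := _ / _ in e2.
have kp : 0 < k.
  have := height_gt0 k0 v; move: e2; rewrite !sheetE mkcovZ => /mkcov_inj [-> _].
  by rewrite pmulr_lgt0 // height_gt0.
have kk : k * k = 1.
  by have := sheet_form1 v; rewrite e2 !sfE sheet_form1 mulr1.
have : (k - 1) * (k + 1) = 0.
  by transitivity (k * k - 1); [ring | rewrite kk subrr].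
move/eqP; rewrite mulf_eq0 => /orP[]/eqP h; last by exfalso; lra.
have k1 : k = 1 by lra.
by rewrite e2 k1 scale1r.
Qed.

End Segments.

(** * Finite groups of isometries acting on the ambient space *)

Lemma functional_dotv (R : realType) m (l : 'rV[R]_m -> R) :
  (forall a x y, l (a *: x + y) = a * l x + l y) ->
  exists c, forall x, l x = dotv c x.
Proof.
move=> lin; have l0 : l 0 = 0 by have := lin 1 0 0; rewrite scale1r addr0; lra.
have lD x y : l (x + y) = l x + l y by have := lin 1 x y; rewrite scale1r mul1r.
have lZ a x : l (a *: x) = a * l x by have := lin a x 0; rewrite !addr0 l0 addr0.
exists (\row_j l (delta_mx 0 j)) => x; rewrite {1}(row_sum_delta x).
rewrite (big_morph l lD l0); apply: eq_bigr => j _.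
by rewrite lZ mxE mulrC.
Qed.

Section Representation.
Variables (R : realType) (n : nat) (kappa : R).
Hypothesis k0 : kappa <= 0.
Let dP1 := @dotv_inner R (1 + n).
Local Notation EE := (matrix R 1 (1 + n)%N).
Local Notation ht := (height kappa).
Local Notation sh := (sheet kappa).
Implicit Types (u v p : 'rV[R]_n).

(** A linear extension to the ambient space. *)
Definition linext (f : 'rV[R]_n -> 'rV[R]_n) (F : EE -> EE) : Prop :=
  (forall a X Y, F (a *: X + Y) = a *: F X + F Y) /\
  forall v, F (sh v) = sh (f v).

Lemma sheet_span (X : EE) : exists v c, X = 1 *: sh v + c *: sh (0 : 'rV[R]_n).
Proof.
exists (@covr R n X), ((@cov0 R n X - ht (@covr R n X)) / ht (0 : 'rV[R]_n)).
rewrite [LHS]mkcovE scale1r !sheetE mkcovZ mkcovD scaler0 addr0 divfK; last first.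
  by rewrite lt0r_neq0 // height_gt0.
by congr mkcov; ring.
Qed.

Lemma linext_uniq f F F' : linext f F -> linext f F' -> F =1 F'.
Proof.
move=> [Fl Fs] [Fl' Fs'] X; have [v [c ->]] := sheet_span X.
have z (G : EE -> EE) : (forall a X Y, G (a *: X + Y) = a *: G X + G Y) -> G (0 : EE) = 0.
  move=> Gl; have := Gl 1 0 0; rewrite !scale1r addr0 => h.
  by apply: (addIr (G 0)); rewrite add0r -h.
have Z (G : EE -> EE) a Y : (forall a X Y, G (a *: X + Y) = a *: G X + G Y) -> G (a *: Y : EE) = a *: G Y.
  by move=> Gl; have := Gl a Y 0; rewrite !addr0 z // addr0.
by rewrite Fl Fl' (Z F c _ Fl) (Z F' c _ Fl') !Fs !Fs'.
Qed.

Lemma hrefl_lin (a : EE) k (X Y : EE) : hrefl kappa a (k *: X + Y) = k *: hrefl kappa a X + hrefl kappa a Y.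
Proof.
rewrite /hrefl scalerBr !scalerA addrACA -opprD -scalerDl.
congr (_ - _ *: _); rewrite (ipDr dP1) (ipZr dP1); ring.
Qed.

Lemma linext_reflection r : reflection kappa r -> exists F, linext r F.
Proof.
move=> /(reflection_hrefl k0) [a [_ e _]]; exists (hrefl kappa a).
by split=> [|v]; [exact: hrefl_lin | rewrite e].
Qed.

Lemma linext_comp f F f' F' : linext f F -> linext f' F' -> linext (f \o f') (F \o F').
Proof.
move=> [Fl Fs] [Fl' Fs']; split=> [a X Y|v] /=; first by rewrite Fl' Fl.
by rewrite Fs' Fs.
Qed.

Lemma sheet_scale c u v : sh u = c *: sh v -> u = v.
Proof.
move=> e; have [//|uv] := eqVneq u v; exfalso.
have c0 : 0 < c.
  have := height_gt0 k0 u; move: e; rewrite !sheetE mkcovZ => /mkcov_inj [-> _].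
  by rewrite pmulr_lgt0 // height_gt0.
have [] := @sheet_comb_uniq R n kappa k0 u v 0 c.
- by apply/eqP.
- by [].
- exact: ltW.
- by rewrite scale0r add0r.
by move/eqP; rewrite eq_sym oner_eq0.
Qed.

Variables (W : finGroupType) (rho : W -> 'rV[R]_n -> 'rV[R]_n).
Hypothesis rho1 : forall v, rho 1%g v = v.
Hypothesis rhoM : forall w w' v, rho (w * w')%g v = rho w (rho w' v).
Hypothesis rho_faithful : forall w, (forall v, rho w v = v) -> w = 1%g.
Hypothesis rho_ext : forall w, exists F, linext (rho w) F.

(** The action extends linearly to the ambient space, where averaging over the
group provides an invariant scalar product and an
invariant linear form that is positive on the sheet. *)
Lemma representation_action : exists (act : W -> EE -> EE) (g : EE -> EE -> R) (tau : EE -> R),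
  [/\ inner_product g, orthogonal_action g act,
      forall w v, act w (sh v) = sh (rho w v) &
      [/\ forall a X Y, tau (a *: X + Y) = a * tau X + tau Y,
          forall w X, tau (act w X) = tau X & forall v, 0 < tau (sh v)]].
Proof.
have [act actP] := choice rho_ext.
have actL w := (actP w).1; have actS w := (actP w).2.
have actM (t w : W) (X : EE) : act (t * w)%g X = act t (act w X).
  have h := linext_comp (actP t) (actP w).
  apply: (linext_uniq (f := rho (t * w)%g) (F' := act t \o act w)) => //.
  split; first exact: h.1.
  by move=> u; rewrite h.2 rhoM.
have act1 (X : EE) : act 1%g X = X.
  apply: (linext_uniq (f := rho 1%g) (F' := id)) => //.
  by split=> // v; rewrite rho1.
pose g (X Y : EE) := \sum_w dotv (act w X) (act w Y).
pose tau (X : EE) := \sum_w cov0 (act w X).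
exists act, g, tau; split.
- split.
  + by move=> X Y; apply: eq_bigr => w _; rewrite (ipC dP1).
  + move=> a X Y Z; rewrite /g mulr_sumr -big_split; apply: eq_bigr => w _ /=.
    by rewrite actL (ipDl dP1) (ipZl dP1).
  + move=> X X0; rewrite /g (bigD1 1%g) //= act1; apply: ltr_wpDr.
      by apply: sumr_ge0 => w _; apply: (ip_ge0 dP1).
    by case: dP1 => _ _; apply.
- split=> //.
  + move=> w X Y; rewrite /g [RHS](reindex_inj (mulIg w)).
    by apply: eq_bigr => t _ /=; rewrite !actM.
  + move=> w h; apply: rho_faithful => v; apply: (sheet_inj (kappa := kappa)).
    by rewrite -actS h.
- exact: actS.
- split.
  + move=> a X Y; rewrite /tau mulr_sumr -big_split; apply: eq_bigr => w _ /=.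
    by rewrite actL /cov0 !mxE.
  + move=> w X; rewrite /tau [RHS](reindex_inj (mulIg w)).
    by apply: eq_bigr => t _ /=; rewrite !actM.
  + move=> v; rewrite /tau (bigD1 1%g) //= act1; apply: ltr_wpDr.
      apply: sumr_ge0 => w _; rewrite actS sheetE mkcov_l.
      by apply/ltW/height_gt0.
    by rewrite sheetE mkcov_l height_gt0.
Qed.

Variables (act : W -> EE -> EE) (g : EE -> EE -> R).
Hypotheses (gP : inner_product g) (actP : orthogonal_action g act).
Hypothesis actS : forall w v, act w (sh v) = sh (rho w v).

Lemma reflects_fix t a v : reflects g act t a -> rho t v = v <-> g a (sh v) = 0.
Proof.
move=> [a1 ta]; split=> [h|h].
  have := actS t v; rewrite h ta /refl => /eqP; rewrite -subr_eq0 addrAC subrr add0r.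
  rewrite oppr_eq0 scaler_eq0 mulf_eq0 pnatr_eq0 /= => /orP[/eqP h2|/eqP a0].
    by rewrite (ipC gP).
  by move: a1; rewrite a0 (ip0l gP) => /eqP; rewrite eq_sym oner_eq0.
apply: (sheet_inj (kappa := kappa)).
by rewrite -actS ta /refl (ipC gP) h mulr0 scale0r subr0.
Qed.

(** A reflection of the space acts as an orthogonal reflection: it is a linear
involution with a fixed hyperplane, and the scalar product is invariant. *)
Lemma reflection_reflects t : reflection kappa (rho t) -> exists a, reflects g act t a.
Proof.
move=> rt; have [a [ap e _]] := reflection_hrefl k0 rt.
have qa := proper_qform k0 ap; set b := sharp kappa a.
have tE X : act t X = X - (2 * dotv a X / qform kappa a a) *: b.
  apply: (linext_uniq (f := rho t) (F' := hrefl kappa a)).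
    by split; [case: actP | move=> v; rewrite actS].
  by split; [exact: hrefl_lin | move=> v; rewrite e].
have ab : dotv a b = qform kappa a a.
  rewrite /b [a]mkcovE sharp_mkcov dotv_mkcov qform_mkcov; ring.
have tb : act t b = - b.
  rewrite tE ab mulfK ?gt_eqF // scaler_nat mulr2n opprD addrA subrr add0r //.
have b0 : 0 < g b b.
  case: gP => _ _; apply; apply/eqP => b0; move: ab; rewrite b0 (ip0r dP1).
  by move: qa => /[swap] <-; rewrite ltxx.
have gb X : g X b = dotv a X / qform kappa a a * g b b.
  have := act_ip actP t X b; rewrite tb tE (ipNr gP) (ipBl gP) (ipZl gP).
  by rewrite -mulrA; lra.
have [l l0 ll] : exists2 l, 0 < l & l * l = g b b.
  by exists (Num.sqrt (g b b)); rewrite ?sqrtr_gt0 // -expr2 sqr_sqrtr // ltW.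
exists (l^-1 *: b); split.
  by rewrite (ipZl gP) (ipZr gP) -ll; field; rewrite gt_eqF.
move=> X; rewrite tE /refl (ipZr gP) scalerA gb -ll; congr (_ - _ *: _).
by field; rewrite !gt_eqF.
Qed.

Lemma reflects_reflection x t a : isometry kappa (rho t) -> rho t x = x ->
  reflects g act t a -> reflection kappa (rho t).
Proof.
move=> it tx ta; have [c cE] : exists c, forall X, g a X = dotv c X.
  by apply: functional_dotv => k X Y; rewrite (ipDr gP) (ipZr gP).
split=> //.
  move=> h; apply: (reflects_neq1 gP actP ta); apply: rho_faithful => v.
  by rewrite h.
exists (hplane kappa c); last first.
  by move=> p; rewrite /hplane /= -cE => h; apply/(reflects_fix _ ta).
exists c => //; split; last by exists x; rewrite /hplane /= -cE; apply/(reflects_fix _ ta).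
apply/eqP => c0; have [a1 _] := ta; move: a1; rewrite cE c0 (ip0l dP1) => /eqP.
by rewrite eq_sym oner_eq0.
Qed.

End Representation.

(** * The convex hull of a generic orbit *)

Section OrbitHull.
Variables (R : realType) (n : nat) (kappa : R).
Hypothesis k0 : kappa <= 0.
Let dP1 := @dotv_inner R (1 + n).
Local Notation EE := (matrix R 1 (1 + n)%N).
Local Notation sh := (sheet kappa).

Variables (W : finGroupType) (rho : W -> 'rV[R]_n -> 'rV[R]_n).
Hypothesis rhoM : forall w w' v, rho (w * w')%g v = rho w (rho w' v).
Variables (act : W -> EE -> EE) (g : EE -> EE -> R) (tau : EE -> R).
Hypotheses (gP : inner_product g) (actP : orthogonal_action g act).
Hypothesis actS : forall w v, act w (sh v) = sh (rho w v).
Hypothesis tau_lin : forall a X Y, tau (a *: X + Y) = a * tau X + tau Y.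
Hypothesis tau_act : forall w X, tau (act w X) = tau X.
Hypothesis tau_gt0 : forall v, 0 < tau (sh v).
Variables (S : {set W}) (r : W -> EE) (y : 'rV[R]_n).
Hypothesis Sy : simple_system g act S r (sh y).

Local Notation Y w := (sh (rho w y)).
Let C := convex_hull kappa (range (fun w => rho w y)).

Let tauZ a X : tau (a *: X) = a * tau X.
Proof.
have t0 : tau 0 = 0 by have := tau_lin 1 0 0; rewrite scale1r addr0; lra.
by have := tau_lin a X 0; rewrite addr0 t0 addr0.
Qed.
Let tauD X X' : tau (X + X') = tau X + tau X'.
Proof. by have := tau_lin 1 X X'; rewrite scale1r mul1r. Qed.

Let tauY w : tau (Y w) = tau (sh y).
Proof. by rewrite -actS tau_act. Qed.
Let gYY w : g (Y w) (Y w) = g (sh y) (sh y).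
Proof. by rewrite -actS (act_ip actP). Qed.
Let YM w u : Y (w * u)%g = act w (Y u).
Proof. by rewrite actS rhoM. Qed.
Let Y1 : Y 1%g = sh y.
Proof. by rewrite -actS (act1l gP actP). Qed.

Lemma orbit_free w u : rho w y = rho u y -> w = u.
Proof.
move=> e; have : act (u^-1 * w)%g (sh y) = sh y.
  by rewrite (actMl actP) (actS w) e -(actS u) (actK gP actP).
move/(dominant_free gP actP Sy (simple_pos Sy)) => h.
by rewrite -[w]mul1g -(mulgV u) -mulgA h mulg1.
Qed.

Lemma orbit_hull w : C (rho w y).
Proof. by move=> A [_ sub]; apply: sub; exists w. Qed.

Lemma hull_min A : geodesically_convex kappa A -> (forall w, A (rho w y)) -> C `<=` A.
Proof. by move=> cA sub p; apply; split=> // _ [w _ <-]. Qed.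

Lemma hull_convex : geodesically_convex kappa C.
Proof.
move=> u v uC vC p up A AP; have [cA _] := AP.
by apply: (cA u v) => //; [exact: uC | exact: vC].
Qed.

Lemma hull_comb p : C p -> exists2 c : W -> R,
  (forall w, 0 <= c w) & sh p = \sum_w c w *: Y w.
Proof.
move: p; apply: hull_min => [u v [c c0 e] [d d0 e'] p|w].
  move=> /(segment_sheet k0) [a [b [a0 b0 pE]]].
  exists (fun w => a * c w + b * d w).
    by move=> w; rewrite addr_ge0 // mulr_ge0.
  rewrite pE e e' !scaler_sumr -big_split; apply: eq_bigr => w _ /=.
  by rewrite scalerDl !scalerA.
exists (fun u => (u == w)%:R); first by move=> u; rewrite ler0n.
rewrite (bigD1 w) //= eqxx scale1r big1 ?addr0 // => u /negPf ->.
by rewrite scale0r.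
Qed.

Lemma orbit_face (c : EE) w : (forall u, 0 <= dotv c (Y u)) -> dotv c (Y w) = 0 ->
  face kappa C (C `&` hplane kappa c).
Proof.
move=> c_ge cw; have Fw : (C `&` hplane kappa c) (rho w y).
  by split=> //; exact: orbit_hull.
split; first by exists (rho w y).
have [c0|cn] := eqVneq c 0.
  left; apply/seteqP; split=> [p []//|p pC]; split=> //.
  by rewrite /hplane /= c0 (ip0l dP1).
right; exists c; split=> //; first by split=> //; exists (rho w y).
by apply: hull_min => //; exact: (halfspace_convex k0).
Qed.

(** A nonnegative linear form vanishes on a combination with nonnegative
coefficients only if it vanishes on all points that occur. *)
Lemma face_comb (c : EE) p : (forall u, 0 <= dotv c (Y u)) -> C p ->
  hplane kappa c p -> exists2 d : W -> R, (forall w, 0 <= d w) &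
  sh p = \sum_w d w *: Y w /\ forall w, d w != 0 -> dotv c (Y w) = 0.
Proof.
move=> c_ge /hull_comb [d d0 e] cp; exists d => //; split=> // w dw.
move: cp; rewrite /hplane /= e (ip_sumr dP1) => /eqP; rewrite psumr_eq0.
  move=> /allP /(_ w (mem_index_enum _)) /=; rewrite (ipZr dP1) mulf_eq0.
  by rewrite (negPf dw) => /eqP.
by move=> u _; rewrite (ipZr dP1) mulr_ge0.
Qed.

Let functional (l : EE -> R) : (forall a X X', l (a *: X + X') = a * l X + l X') ->
  exists c : EE, forall X, l X = dotv c X.
Proof. exact: functional_dotv. Qed.

Lemma orbit_dot w u : g (Y w) (Y u) <= g (sh y) (sh y) ?= iff (w == u).
Proof.
have h : g (Y w - Y u) (Y w - Y u) = 2 * (g (sh y) (sh y) - g (Y w) (Y u)).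
  by rewrite !(ipE gP) (ipC gP (Y u)) !gYY; ring.
have h0 := ip_ge0 gP (Y w - Y u); split; first by lra.
apply/eqP/eqP => [e|<-]; last by rewrite gYY.
apply: orbit_free; apply: (sheet_inj (kappa := kappa)).
by apply/eqP; rewrite -subr_eq0; apply/eqP/(ip_eq0 gP); rewrite h e subrr mulr0.
Qed.

(** The orbit lies on a sphere for g, inside an affine hyperplane: linear forms
m * tau - g (Y w) expose its points. *)
Lemma orbit_vertex w : vertex kappa C (rho w y).
Proof.
have t0 := tau_gt0 y; set N := g (sh y) (sh y).
have [c cE] : exists c, forall X, N / tau (sh y) * tau X - g (Y w) X = dotv c X.
  by apply: functional => a X X'; rewrite tau_lin (ipDr gP) (ipZr gP); ring.
have cY u : dotv c (Y u) = N - g (Y w) (Y u).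
  by rewrite -cE tauY divfK // gt_eqF.
have c_ge u : 0 <= dotv c (Y u) by rewrite cY subr_ge0 orbit_dot.
rewrite /vertex; suff -> : [set rho w y] = C `&` hplane kappa c.
  by apply: (@orbit_face c w) => //; rewrite cY gYY subrr.
apply/seteqP; split=> [_ ->|p [pC cp]].
  by split; [exact: orbit_hull | rewrite /hplane /= cY gYY subrr].
have [d d0 [e dw]] := face_comb c_ge pC cp.
apply: (@sheet_scale _ _ _ k0 (d w)); rewrite e (bigD1 w) //= big1 ?addr0 // => u uw.
apply/eqP; rewrite scaler_eq0; apply/orP; left; apply: contraT => /dw.
rewrite cY => /eqP; rewrite subr_eq0 eq_sym (orbit_dot w u).2 => /eqP h.
by move: uw; rewrite h eqxx.
Qed.

(** A hyperplane that misses the orbit has the whole hull strictly on one side. *)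
Lemma vertex_orbit v : vertex kappa C v -> exists w, v = rho w y.
Proof.
move=> [_ []].
  by move=> e; exists 1%g; have := orbit_hull 1%g; rewrite -e => <-.
move=> [a [ap Ca e]]; apply: contrapT => no.
have sub : C `<=` [set p | 0 < dotv a (sh p)].
  apply: hull_min => [|w]; first exact: (open_halfspace_convex k0).
  have aw := Ca _ (orbit_hull w).
  rewrite /= lt_neqAle eq_sym; apply/andP; split=> //; apply/eqP => aw0.
  apply: no; exists w; have : (C `&` hplane kappa a) (rho w y).
    by split=> //; exact: orbit_hull.
  by rewrite -e => ->.
have : (C `&` hplane kappa a) v by rewrite -e.
by move=> [/sub /=]; rewrite /hplane /= => + h; rewrite h ltxx.
Qed.

Let simple_image_pos s t : s \in S -> t \in S -> t != s -> 0 < g (sh y) (act s (r t)).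
Proof.
move=> sS tS ts; case: (root_sign gP actP Sy s tS) => // h; exfalso.
have e : act 1%g (r t) = r s.
  apply: (simple_perm gP actP Sy sS tS); last by rewrite mulg1.
  by rewrite (act1l gP actP) (simple_pos Sy).
rewrite (act1l gP actP) in e; move/eqP: ts; apply.
by apply: (reflects_uniq gP actP (simple_refl Sy tS)); rewrite e; apply: (simple_refl Sy).
Qed.

(** The sum L of y and s y is dominant, orthogonal to the root of s and to no
other simple root. Since y - u y is a positive combination of simple roots, only
y and s y maximise the product with L on the orbit. *)
Lemma edge_dot s u : s \in S ->
  g (sh y + Y s) (Y u) <= g (sh y + Y s) (sh y) /\
  (g (sh y + Y s) (Y u) = g (sh y + Y s) (sh y) -> u = 1%g \/ u = s).
Proof.
move=> sS; set L := sh y + Y s.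
have [s1 sx] := simple_refl Sy sS; have sy := simple_pos Sy sS.
have YsE : Y s = sh y - (2 * g (sh y) (r s)) *: r s by rewrite -actS sx.
have Ls : g L (r s) = 0 by rewrite /L YsE !(ipE gP) s1; ring.
have Lt t : t \in S -> t != s -> 0 < g L (r t).
  move=> tS ts; rewrite /L (ipDl gP) addr_gt0 ?(simple_pos Sy) //.
  rewrite -actS -(act_ip actP s) -(actMl actP) (reflectsK gP actP (simple_refl Sy sS)).
  by rewrite (act1l gP actP) simple_image_pos.
have [c c0 e] := dominant_cone gP actP Sy u (fun t tS => ltW (simple_pos Sy tS)).
rewrite actS in e.
have LE : g L (sh y) - g L (Y u) = \sum_(t in S) c t * g L (r t).
  by rewrite -(ipBr gP) e (ip_sumr gP); apply: eq_bigr => t _; rewrite (ipZr gP).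
have pos t : t \in S -> 0 <= c t * g L (r t).
  move=> tS; have [->|ts] := eqVneq t s; first by rewrite Ls mulr0.
  by rewrite mulr_ge0 ?c0 // ltW // Lt.
split; first by rewrite -subr_ge0 LE sumr_ge0.
move=> eqL; move: LE; rewrite eqL subrr => /esym/eqP; rewrite psumr_eq0 // => /allP z.
have ct t : t \in S -> t != s -> c t = 0.
  move=> tS ts; have := z t (mem_index_enum _); rewrite tS /= mulf_eq0.
  by rewrite (gt_eqF (Lt t tS ts)) orbF => /eqP.
have e2 : sh y - Y u = c s *: r s.
  rewrite e (bigD1 s) //= big1 ?addr0 // => t /andP[tS ts].
  by rewrite ct // scale0r.
have YuE : Y u = sh y - c s *: r s by rewrite -e2 opprB addrC subrK.
have : c s * (c s - 2 * g (sh y) (r s)) = 0.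
  have := gYY u; rewrite YuE !(ipE gP) (ipC gP (r s)) s1; nra.
move=> /eqP; rewrite mulf_eq0 => /orP[]/eqP h; [left|right]; apply: orbit_free;
  apply: (sheet_inj (kappa := kappa)); rewrite YuE.
  by rewrite h scale0r subr0 Y1.
by rewrite YsE; congr (_ - _ *: _); lra.
Qed.

Lemma orbit_edge w s : s \in S -> edge kappa C (rho w y) (rho (w * s)%g y).
Proof.
move=> sS; have ss := simple_refl Sy sS; split.
  move=> /orbit_free h; apply: (reflects_neq1 gP actP ss).
  by apply: (mulgI w); rewrite mulg1 -h.
have t0 := tau_gt0 y; set L := sh y + Y s; set m := g L (sh y) / tau (sh y).
have [c cE] : exists c, forall X, m * tau X - g (act w L) X = dotv c X.
  by apply: functional => a X X'; rewrite tau_lin (ipDr gP) (ipZr gP); ring.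
have cY u : dotv c (Y (w * u)%g) = g L (sh y) - g L (Y u).
  by rewrite -cE tauY YM (act_ip actP) /m divfK // gt_eqF.
have Lu u := edge_dot u sS; rewrite -/L in Lu.
have c_ge u : 0 <= dotv c (Y u).
  by rewrite -[u]mul1g -(mulgV w) -mulgA cY subr_ge0 (Lu _).1.
have cw : dotv c (Y w) = 0 by rewrite -{1}[w]mulg1 cY Y1 subrr.
have cws : dotv c (Y (w * s)%g) = 0.
  rewrite cY; apply/eqP; rewrite subr_eq0; apply/eqP.
  rewrite -[RHS](act_ip actP s) actS /L (actD actP) !actS.
  by rewrite -rhoM (reflectsK gP actP ss) Y1 addrC.
suff -> : segment kappa (rho w y) (rho (w * s)%g y) = C `&` hplane kappa c.
  exact: (@orbit_face c w).
apply/seteqP; split=> p.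
  move=> ps; split; first by apply: hull_convex ps; exact: orbit_hull.
  move: ps => /(segment_sheet k0) [a [b [_ _ e]]].
  by rewrite /hplane /= e (ipDr dP1) !(ipZr dP1) cw cws !mulr0 addr0.
move=> [pC cp]; have [d d0 [e dw]] := face_comb c_ge pC cp.
apply/(segment_sheet k0); rewrite e.
have wsw : (w * s != w)%g.
  apply/eqP => h; apply: (reflects_neq1 gP actP ss).
  by apply: (mulgI w); rewrite mulg1 h.
exists (d w), (d (w * s)%g); split=> //.
rewrite (bigD1 w) //= (bigD1 (w * s)%g) //= big1 ?addr0 // => u /andP[uw uws].
apply/eqP; rewrite scaler_eq0; apply/orP; left; apply: contraT => /dw.
rewrite -[u]mul1g -(mulgV w) -mulgA cY => /eqP; rewrite subr_eq0 => /eqP /esym /(Lu _).2.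
have uE : u = (w * (w^-1 * u))%g by rewrite mulgA mulgV mul1g.
by case=> h; move: uw uws; rewrite uE h ?mulg1 eqxx.
Qed.

(** An endpoint of the segment is a combination of points of the orbit in the
segment, and it is extreme in the segment. *)
Lemma endpoint_orbit (c : EE) u v : u <> v -> (forall w, 0 <= dotv c (Y w)) ->
  segment kappa u v = C `&` hplane kappa c -> exists w, u = rho w y.
Proof.
move=> uv c_ge F.
have [uC cu] : (C `&` hplane kappa c) u by rewrite -F; exact: (segment_l k0).
have [d d0 [e dw]] := face_comb c_ge uC cu.
have seg w : d w != 0 -> exists ab : R * R,
    [/\ 0 <= ab.1, 0 <= ab.2 & Y w = ab.1 *: sh u + ab.2 *: sh v].
  move=> /dw cw; have : segment kappa u v (rho w y).
    by rewrite F; split; [exact: orbit_hull | exact: cw].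
  by move=> /(segment_sheet k0) [a [b h]]; exists (a, b).
have {seg} /choice [ab abP] : forall w, exists ab : R * R,
    d w != 0 -> [/\ 0 <= ab.1, 0 <= ab.2 & Y w = ab.1 *: sh u + ab.2 *: sh v].
  move=> w; have [dw0|/seg [ab h]] := eqVneq (d w) 0; first by exists (0, 0).
  by exists ab.
have ge0 w : 0 <= d w * (ab w).1 /\ 0 <= d w * (ab w).2.
  have [->|dn] := eqVneq (d w) 0; first by rewrite !mul0r.
  by have [a0 b0 _] := abP w dn; rewrite !mulr_ge0.
have e2 : sh u = (\sum_w d w * (ab w).1) *: sh u + (\sum_w d w * (ab w).2) *: sh v.
  rewrite {1}e !scaler_suml -big_split; apply: eq_bigr => w _ /=.
  have [->|dn] := eqVneq (d w) 0; first by rewrite !(mul0r, scale0r) addr0.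
  by have [_ _ ->] := abP w dn; rewrite scalerDr !scalerA.
have [|| x1 y0] := sheet_comb_uniq k0 uv _ _ e2.
- by apply: sumr_ge0 => w _; have [] := ge0 w.
- by apply: sumr_ge0 => w _; have [] := ge0 w.
have [w dn] : exists w, d w != 0.
  apply: contrapT => no; move: x1; rewrite big1 => [/eqP|w _].
    by rewrite eq_sym oner_eq0.
  have [->|dn] := eqVneq (d w) 0; first by rewrite mul0r.
  by case: no; exists w.
exists w; have [a0 b0 YE] := abP w dn.
have b00 : (ab w).2 = 0.
  move/eqP: y0; rewrite psumr_eq0 => [|t _]; last by have [] := ge0 t.
  move=> /allP /(_ w (mem_index_enum _)) /=; rewrite mulf_eq0 (negPf dn).
  by move/eqP.
apply/esym/(@sheet_scale _ _ _ k0 (ab w).1).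
by rewrite YE b00 scale0r addr0.
Qed.

Let edge_face u v : edge kappa C u v ->
  exists2 c : EE, forall w, 0 <= dotv c (Y w) & segment kappa u v = C `&` hplane kappa c.
Proof.
move=> [_ [_ [->|[c [_ Cc ->]]]]].
  exists 0 => [w|]; first by rewrite (ip0l dP1).
  apply/seteqP; split=> [p pC|p []//]; split=> //.
  by rewrite /hplane /= (ip0l dP1).
by exists c => // w; apply: Cc; exact: orbit_hull.
Qed.

(** The orbit lies on a sphere, which is strictly convex. *)
Lemma orbit_segment w u v : segment kappa (rho u y) (rho v y) (rho w y) -> w = u \/ w = v.
Proof.
move=> /(segment_sheet k0) [a [b [a0 b0 e]]].
have ab : a + b = 1.
  have t0 : tau (sh y) != 0 by rewrite gt_eqF.
  apply: (mulIf t0); rewrite mulrDl mul1r.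
  by have := tauY w; rewrite e tauD !tauZ !tauY.
have := gYY w; rewrite {2}e (ipDr gP) !(ipZr gP).
have [hu eu] := orbit_dot w u; have [hv ev] := orbit_dot w v.
have [wu|wu] := eqVneq w u; [by left|have [wv|wv] := eqVneq w v; first by right].
have lu : g (Y w) (Y u) < g (sh y) (sh y) by rewrite lt_neqAle hu eu wu.
have lv : g (Y w) (Y v) < g (sh y) (sh y) by rewrite lt_neqAle hv ev wv.
move=> h; exfalso; set N := g (sh y) (sh y) in h lu lv.
have : a * (N - g (Y w) (Y u)) + b * (N - g (Y w) (Y v)) = 0.
  by transitivity ((a + b) * N - (a * g (Y w) (Y u) + b * g (Y w) (Y v)));
    [ring | rewrite ab h; ring].
have h1 : 0 <= a * (N - g (Y w) (Y u)) by rewrite mulr_ge0 // subr_ge0 ltW.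
have h2 : 0 <= b * (N - g (Y w) (Y v)) by rewrite mulr_ge0 // subr_ge0 ltW.
move=> h3; have /eqP : a * (N - g (Y w) (Y u)) = 0 by lra.
have /eqP : b * (N - g (Y w) (Y v)) = 0 by lra.
by rewrite !mulf_eq0 !subr_eq0 (gt_eqF lu) (gt_eqF lv) !orbF => /eqP ? /eqP ?; lra.
Qed.

(** Moving the first endpoint to y, the other one is u y with y - u y a positive
combination of simple roots r s; the linear form of the face is nonpositive on
simple roots, so it vanishes on those that occur, and then on s y as well. *)
Lemma edge_orbit u v : edge kappa C u v ->
  exists w s, [/\ s \in S, u = rho w y & v = rho (w * s)%g y].
Proof.
move=> uvE; have [c c_ge F] := edge_face uvE; have [uv _] := uvE.
have [w uE] := endpoint_orbit uv c_ge F.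
have [w' vE] : exists w', v = rho w' y.
  apply: (@endpoint_orbit c v u) => //; first by move=> h; apply: uv.
  rewrite -F; apply/seteqP; split=> p /(segment_sheet k0) [a [b [a0 b0 e]]];
    by apply/(segment_sheet k0); exists b, a; rewrite addrC.
have [cu cv] : dotv c (Y w) = 0 /\ dotv c (Y w') = 0.
  split; [suff [] : (C `&` hplane kappa c) u by rewrite uE|].
    by rewrite -F; exact: (segment_l k0).
  suff [] : (C `&` hplane kappa c) v by rewrite vE.
  by rewrite -F; exact: (segment_r k0).
have [d d0 e] := dominant_cone gP actP Sy (w^-1 * w')%g (fun t tS => ltW (simple_pos Sy tS)).
have lt t : t \in S -> dotv c (Y (w * t)%g) = - (2 * g (sh y) (r t)) * dotv c (act w (r t)).
  move=> tS; have [_ tx] := simple_refl Sy tS.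
  rewrite rhoM -actS -[sh (rho t y)]actS tx /refl (actB actP) (actZ actP) actS.
  by rewrite (ipBr dP1) (ipZr dP1) cu; ring.
have nonpos t : t \in S -> dotv c (act w (r t)) <= 0.
  move=> tS; have := c_ge (w * t)%g; rewrite lt // mulNr oppr_ge0 pmulr_rle0 //.
  by rewrite mulr_gt0 // (simple_pos Sy).
have sum0 : \sum_(t in S) d t * - dotv c (act w (r t)) = 0.
  have : dotv c (act w (sh y - act (w^-1 * w')%g (sh y))) = 0.
    by rewrite (actB actP) -(actMl actP) mulgA mulgV mul1g !actS (ipBr dP1) cu cv subrr.
  rewrite e (act_sum actP) (ip_sumr dP1) => h.
  move/(congr1 -%R): h; rewrite oppr0 -sumrN => h; rewrite -[RHS]h.
  apply: eq_bigr => t _.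
  by rewrite (actZ actP) (ipZr dP1) mulrN.
have [s sS ds] : exists2 s, s \in S & d s != 0.
  apply: contrapT => no; apply: uv; rewrite uE vE; congr (rho _ y).
  have : act (w^-1 * w')%g (sh y) = sh y.
    apply/esym/eqP; rewrite -subr_eq0 e; apply/eqP; apply: big1 => t tS.
    by have [->|dn] := eqVneq (d t) 0; [rewrite scale0r | case: no; exists t].
  move/(dominant_free gP actP Sy (simple_pos Sy)) => h.
  by rewrite -[w']mul1g -(mulgV w) -mulgA h mulg1.
have cs : dotv c (Y (w * s)%g) = 0.
  rewrite lt //; move/eqP: sum0; rewrite psumr_eq0 => [|t tS]; last first.
    by rewrite mulr_ge0 ?d0 // oppr_ge0 nonpos.
  move=> /allP /(_ s (mem_index_enum _)); rewrite sS /= mulf_eq0 (negPf ds) /=.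
  by rewrite oppr_eq0 => /eqP ->; rewrite mulr0.
exists w, s; split=> //; rewrite vE; congr (rho _ y).
have : segment kappa (rho w y) (rho w' y) (rho (w * s)%g y).
  by rewrite -uE -vE F; split; [exact: orbit_hull | exact: cs].
move/orbit_segment => -[h|//]; exfalso.
apply: (reflects_neq1 gP actP (simple_refl Sy sS)).
by apply: (mulgI w); rewrite mulg1 h.
Qed.

End OrbitHull.

(** * Points in the interior of a chamber *)

Section Chambers.
Variables (R : realType) (n : nat) (kappa : R).
Hypothesis k0 : kappa <= 0.
Let dP1 := @dotv_inner R (1 + n).
Local Notation EE := (matrix R 1 (1 + n)%N).
Local Notation sh := (sheet kappa).

Lemma dotv_continuous m (F G : 'rV[R]_n -> 'rV[R]_m) :
  (forall i, continuous (fun v => F v 0 i)) -> (forall i, continuous (fun v => G v 0 i)) ->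
  continuous (fun v => dotv (F v) (G v)).
Proof.
move=> cF cG; apply: continuous_big => [x|i _ x].
  by apply: cvgD; [apply: cvg_fst | apply: cvg_snd].
by apply: continuousM; [exact: cF | exact: cG].
Qed.

Lemma height_continuous : continuous (height kappa : 'rV[R]_n -> R).
Proof.
move=> v; apply: (@continuous_comp _ _ _ (fun v : 'rV[R]_n => 1 - kappa * dotv v v) Num.sqrt).
  apply: continuousB; first exact: cst_continuous.
  apply: continuousM; first exact: cst_continuous.
  by apply: dotv_continuous => i; apply: coord_continuous.
exact: sqrt_continuous.
Qed.

Lemma sheet_dotv_continuous (a : EE) : continuous (fun v => dotv a (sh v)).
Proof.
have -> : (fun v => dotv a (sh v)) = fun v => cov0 a * height kappa v + dotv (covr a) v.
  by apply: funext => v; rewrite {1}[a]mkcovE sheetE dotv_mkcov.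
move=> v; apply: (@continuousD _ _ _ (fun v => cov0 a * height kappa v) (dotv (covr a))).
  apply: continuousM; [exact: cst_continuous | exact: height_continuous].
apply: dotv_continuous => i; last exact: coord_continuous.
exact: cst_continuous.
Qed.

(** A connected set that avoids a hyperplane lies on one side of it. *)
Lemma connected_side (a : EE) (A : set 'rV[R]_n) p : connected A -> A p ->
  (forall v, A v -> dotv a (sh v) <> 0) -> 0 < dotv a (sh p) ->
  forall v, A v -> 0 < dotv a (sh v).
Proof.
move=> cA Ap off ap v Av; rewrite ltNge; apply/negP => av.
have : connected ((fun v => dotv a (sh v)) @` A).
  apply: connected_continuous_connected => //.
  by apply: continuous_subspaceT => x; apply: sheet_dotv_continuous.
move=> /connected_intervalP ci.
have [w Aw /= w0] : ((fun v => dotv a (sh v)) @` A) 0.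
  apply: (ci (dotv a (sh v)) (dotv a (sh p))); [by exists v | by exists p |].
  by rewrite av ltW.
exact: (off w Aw).
Qed.

Variables (W : finGroupType) (rho : W -> 'rV[R]_n -> 'rV[R]_n).

Lemma off_wallsP v : off_walls kappa rho v <->
  forall w, reflection kappa (rho w) -> rho w v <> v.
Proof.
split=> [off w rw e|h [_ [w rw ->]]]; last exact: h.
by apply: off; exists [set p | rho w p = p] => //; exists w.
Qed.

(** A reflection whose wall contains an interior point of a closed chamber would
exchange the two sides of this wall near the point, although the chamber
approaches the point from one side only. *)
Lemma chamber_interior_off D y : chamber kappa rho D -> (D°)%classic y ->
  off_walls kappa rho y.
Proof.
move=> [p op DE] Dy; apply/off_wallsP => w rw ry; set A := connected_component _ _ in DE.
have [a [ap rE fixE]] := reflection_hrefl k0 rw.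
have qa := proper_qform k0 ap.
have Ap : A p by exact: connected_component_refl.
have offA v : A v -> dotv a (sh v) <> 0.
  move=> /connected_component_sub /off_wallsP /(_ w rw) + h.
  by apply; apply/fixE.
have [b [bE bA]] : exists b : EE, (b = a \/ b = - a) /\ forall v, A v -> 0 < dotv b (sh v).
  have [h|h|h] := ltgtP 0 (dotv a (sh p)).
  - exists a; split; [by left|]; apply: (@connected_side a A p) => //.
    exact: component_connected.
  - exists (- a); split; [by right|]; apply: (@connected_side (- a) A p) => //.
    + exact: component_connected.
    + by move=> v /offA + /eqP; rewrite (ipNl dP1) oppr_eq0 => + /eqP.
    + by rewrite (ipNl dP1) oppr_gt0.
  - by case: (offA p Ap).
have rb v : dotv b (sh (rho w v)) = - dotv b (sh v).
  have ra : dotv a (sh (rho w v)) = - dotv a (sh v).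
    rewrite rE /hrefl (ipBr dP1) (ipZr dP1).
    have -> : dotv a (sharp kappa a) = qform kappa a a.
      by rewrite [a]mkcovE sharp_mkcov dotv_mkcov qform_mkcov; ring.
    by rewrite divfK ?gt_eqF //; ring.
  by case: bE => ->; rewrite ?(ipNl dP1) ra.
have rc : continuous (rho w).
  have -> : rho w = fun v => v - (2 * dotv a (sh v) / qform kappa a a) *: covr a.
    apply: funext => v; have := rE v; rewrite /hrefl [sharp _ _]/sharp !sheetE.
    by rewrite mkcovZ mkcovB => /mkcov_inj [_].
  move=> v; apply: (@continuousB _ _ _ id (fun v => (2 * dotv a (sh v) / qform kappa a a) *: covr a)).
    by move=> U.
  apply: continuousZ; last exact: cst_continuous.
  apply: continuousM; last exact: cst_continuous.
  apply: continuousM; first exact: cst_continuous.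
  exact: sheet_dotv_continuous.
have clo v : closure A v -> 0 <= dotv b (sh v).
  move=> cv; rewrite leNgt; apply/negP => bv.
  have o : nbhs v [set u | dotv b (sh u) < 0].
    exact: (cvgr_lt _ (@sheet_dotv_continuous b v) _ bv).
  have [u [/bA h1 /= h2]] := cv _ o.
  by move: (lt_trans h1 h2); rewrite ltxx.
have nD : nbhs y D by [].
have nrD : nbhs y (rho w @^-1` D) by apply: (rc y); rewrite ry.
have yc : closure A y by rewrite -DE; exact: nbhs_singleton.
have [u [/bA + [uD urD]]] := yc _ (filterI nD nrD).
by have := clo (rho w u); rewrite -DE => /(_ urD); rewrite rb oppr_ge0 => h /lt_geF; rewrite h.
Qed.

End Chambers.

Section OrbitRepresentation.
Variables (R : realType) (n : nat) (kappa : R).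
Hypothesis k0 : kappa <= 0.
Local Notation EE := (matrix R 1 (1 + n)%N).
Local Notation sh := (sheet kappa).
Variables (C : set 'rV[R]_n) (x : 'rV[R]_n) (W : finGroupType) (S : {set W}).
Variables (rho : W -> 'rV[R]_n -> 'rV[R]_n) (y : 'rV[R]_n).
Hypothesis CH : coxeter_orbit_hull kappa C x S rho y.

Let rhoM w w' v : rho (w * w')%g v = rho w (rho w' v).
Proof. by have [_ [_ h _ _] _ _] := CH; rewrite h. Qed.

Let isom w : isometry kappa (rho w).
Proof. by have [_ [h _ _ _] _ _] := CH; case: (h w). Qed.

Let rho1 v : rho 1%g v = v.
Proof. by apply: (bij_inj (isom 1%g).1); rewrite -rhoM mul1g. Qed.

Let rho_faithful w : (forall v, rho w v = v) -> w = 1%g.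
Proof.
move=> h; have [_ [_ _ inj _] _ _] := CH.
by apply: inj; apply: funext => v; rewrite h rho1.
Qed.

Let rho_ext w : exists F, linext kappa (rho w) F.
Proof.
have [[_ gen _] [_ _ _ rS] _ _] := CH.
have [v vS <-] : exists2 v, word_in S v & wprod v = w.
  by apply: gen_word; rewrite gen inE.
elim: v vS => [_|s v IH /= /andP[sS /IH [F FP]]].
  exists id; split=> // v; rewrite wprod0 rho1 //.
have [F' FP'] := linext_reflection k0 (rS s sS).
exists (F' \o F); have [h1 h2] := linext_comp FP' FP; split=> // u.
by rewrite h2 wprod_cons rhoM.
Qed.

(** By rigidity an automorphism of the group turns the given generators into
simple reflections, and the base point can be moved into their chamber; neither
change affects the hull. *)
Lemma orbit_hull_simple :
  exists (act : W -> EE -> EE) (g : EE -> EE -> R) (tau : EE -> R) (al : W -> W)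
         (r : W -> EE) (w0 : W),
  [/\ inner_product g, orthogonal_action g act,
      forall w v, act w (sh v) = sh (rho w v),
      [/\ forall a X Y, tau (a *: X + Y) = a * tau X + tau Y,
          forall w X, tau (act w X) = tau X & forall v, 0 < tau (sh v)] &
      [/\ {morph al : v w / (v * w)%g}, bijective al,
          simple_system g act (al @: S)%SET r (sh (rho w0 y)) &
          C = convex_hull kappa (range (fun w => rho w (rho w0 y)))]].
Proof.
have [act [g [tau [gP actP actS tauP]]]] := representation_action k0 rho1 rhoM rho_faithful rho_ext.
have [cox [fx _ _ rS] [D chD Dy] CE] := CH.
have off := (off_wallsP kappa rho y).1 (chamber_interior_off k0 chD Dy).
have [al [alM al_bij [r [z Sz]]]] := reflection_rigidity gP actP cox
  (fun s sS => reflection_reflects k0 gP actP actS (rS s sS)).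
have [w0 w0P] : exists w0, forall s, s \in (al @: S)%SET -> 0 < g (act w0 (sh y)) (r s).
  apply: (dominant_orbit gP actP Sz) => w s sS.
  rewrite -(actMl actP) !actS => /(sheet_inj) e.
  have [iw fw] := fx (w^-1 * s * w)%g.
  apply: (off (w^-1 * s * w)%g).
    apply: (reflects_reflection rho_faithful gP actP actS iw fw (a := act w^-1%g (r s))).
    have := reflects_conj gP actP w^-1%g (simple_refl Sz sS).
    by rewrite invgK.
  by rewrite -mulgA rhoM e -rhoM mulVg rho1.
exists act, g, tau, al, r, w0; split=> //; split=> //.
- rewrite -actS; case: Sz => h1 h2 h3 _ h5; split=> //.
- rewrite CE; congr convex_hull; apply/seteqP; split=> _ [w _ <-].
    by exists (w * w0^-1)%g => //; rewrite -rhoM mulgKV.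
  by exists (w * w0)%g => //; rewrite rhoM.
Qed.

Lemma hull_isometry w p : C p -> C (rho w p).
Proof.
have [_ _ _ CE] := CH; rewrite CE.
move: p; apply: smallest_sub.
  move=> u v uC vC p up; rewrite /= in uC vC *.
  move=> A AP; have [cA _] := AP.
  apply: (cA (rho w u) (rho w v)); [exact: uC | exact: vC |].
  by rewrite /segment /= !(isom w).2.
by move=> _ [u _ <-] A [_ h]; apply: h; exists (w * u)%g => //; rewrite rhoM.
Qed.

Lemma orbit_hull_even : even_polyhedron kappa C.
Proof.
have [act [g [tau [al [r [w0 [gP actP actS [tl ta tp] [alM alb Sy CE]]]]]]]] := orbit_hull_simple.
have free := orbit_free gP actP actS Sy.
move=> u v uv; have := uv; rewrite {1}CE.
move=> /(edge_orbit k0 rhoM gP actP actS tl ta tp Sy) [w [s [sS uE vE]]].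
pose h := (w * s * w^-1)%g.
have ss := simple_refl Sy sS.
have hr : reflects g act h (act w (r s)) by exact: (reflects_conj gP actP).
have [_ [fx _ _ _] _ _] := CH.
have rr : reflection kappa (rho h).
  have [ih fh] := fx h.
  exact: (reflects_reflection rho_faithful gP actP actS ih fh hr).
have ex : exchanging_reflection kappa u v (rho h).
  split=> //; rewrite uE vE -rhoM /h.
    by rewrite mulgKV.
  by rewrite -!mulgA mulKg (reflectsK gP actP ss) mulg1.
exists (rho h).
  split=> // r' ex'; have [ne _] := uv; exact: (exchanging_uniq k0 ne).
split.
  apply/seteqP; split=> [_ [p pC <-]|p pC]; first exact: hull_isometry.
  exists (rho h p); first exact: hull_isometry.
  by rewrite -rhoM (reflectsK gP actP hr) rho1.
move=> p; rewrite CE => /(vertex_orbit k0) [t ->].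
rewrite -rhoM => /free e; apply: (reflects_neq1 gP actP hr).
by apply: (mulIg t); rewrite mul1g.
Qed.

Lemma orbit_hull_graph :
  graph_isomorphic (vertex kappa C) (edge kappa C) [set: W] (cayley_adj S).
Proof.
have [act [g [tau [al [r [w0 [gP actP actS [tl ta tp] [alM [al' alK al'K] Sy CE]]]]]]]] := orbit_hull_simple.
have free := orbit_free gP actP actS Sy.
have al'M v w : al' (v * w)%g = (al' v * al' w)%g.
  by apply: (can_inj alK); rewrite alM !al'K.
have [f fE] : exists f : 'rV[R]_n -> W, forall w, f (rho w (rho w0 y)) = al' w.
  have /choice [f fP] : forall v, exists w, (exists u, v = rho u (rho w0 y)) -> v = rho (al w) (rho w0 y).
    move=> v; case: (pselect (exists u, v = rho u (rho w0 y))) => [[u ->]|no].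
      by exists (al' u); rewrite al'K.
    by exists 1%g.
  exists f => w; apply: (can_inj alK); rewrite al'K; apply: free.
  by symmetry; apply: fP; exists w.
have vE v : vertex kappa C v <-> exists w, v = rho w (rho w0 y).
  rewrite CE; split; first exact: (vertex_orbit k0).
  by move=> [w ->]; exact: (orbit_vertex k0 gP actP actS tl ta tp Sy).
exists f.
  split=> //.
  - move=> p q; rewrite !inE => /vE [w ->] /vE [u ->]; rewrite !fE => /(can_inj al'K) ->.
    by [].
  - move=> w _; exists (rho (al w) (rho w0 y)); last by rewrite fE alK.
    by apply/vE; exists (al w).
move=> p q /vE [w ->] /vE [u ->]; rewrite !fE; split.
  rewrite {1}CE => /(edge_orbit k0 rhoM gP actP actS tl ta tp Sy) [t [s [sS /free -> /free ->]]].
  have /imsetP [s0 s0S ->] := sS.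
  by exists s0 => //; left; rewrite al'M alK.
have edg t s : s \in S -> edge kappa C (rho t (rho w0 y)) (rho (t * al s)%g (rho w0 y)).
  move=> sS; rewrite CE; apply: (orbit_edge k0 rhoM gP actP actS tl ta tp Sy).
  exact: imset_f.
move=> [s sS [e|e]].
  have -> : u = (w * al s)%g by apply: (can_inj al'K); rewrite al'M alK.
  exact: edg.
have uE : u = (w * al s)%g.
  apply: (can_inj al'K); rewrite al'M alK e -mulgA.
  have ss : (s * s = 1)%g.
    have [[ord _ _] _ _ _] := CH; have := expg_order s; rewrite (ord s sS).
    by rewrite expgS expg1.
  by rewrite ss mulg1.
by rewrite uE; exact: edg.
Qed.

End OrbitRepresentation.

(** * Polytopes *)

(** The last point of a polyhedron in a given direction: the ratio test of the
simplex method. *)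
Lemma blocking (R : realType) m (s : seq 'rV[R]_m) (X D : 'rV[R]_m) :
  (forall a, a \in s -> 0 <= dotv a X) -> (exists2 a, a \in s & dotv a D < 0) ->
  exists t, [/\ 0 <= t, forall a, a \in s -> 0 <= dotv a (X + t *: D) &
    exists a, [/\ a \in s, dotv a D < 0 & dotv a (X + t *: D) = 0]].
Proof.
have dP := @dotv_inner R m; move=> X0 [a as_ aD].
pose F b := dotv b X / - dotv b D.
have [i0 Pi0] : exists i : 'I_(size s), dotv (tnth (in_tuple s) i) D < 0.
  by move: as_; rewrite -index_mem => h; exists (Ordinal h); rewrite (tnth_nth a) nth_index // -index_mem.
have [i Pi mini] : exists2 i : 'I_(size s), dotv (tnth (in_tuple s) i) D < 0 &
    forall j : 'I_(size s), dotv (tnth (in_tuple s) j) D < 0 ->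
      F (tnth (in_tuple s) i) <= F (tnth (in_tuple s) j).
  pose P (i : 'I_(size s)) := dotv (tnth (in_tuple s) i) D < 0.
  have : P i0 by [].
  move=> /(@Order.TotalTheory.arg_minP _ _ _ i0 P (fun i => F (tnth (in_tuple s) i))).
  by case=> i; exists i.
set b := tnth (in_tuple s) i in Pi mini; have bs : b \in s := mem_tnth i (in_tuple s).
have t0 : 0 <= F b by rewrite divr_ge0 ?X0 // oppr_ge0 ltW.
exists (F b); split=> // [c cs|]; last first.
  exists b; split=> //; rewrite (ipDr dP) (ipZr dP) /F.
  by rewrite invrN mulrN mulNr divfK ?lt_eqF // subrr.
rewrite (ipDr dP) (ipZr dP); have [cD|cD] := ltP (dotv c D) 0; last first.
  by rewrite addr_ge0 ?X0 // mulr_ge0.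
have [j jE] : exists j, c = tnth (in_tuple s) j by apply/tnthP.
have := mini j; rewrite -jE => /(_ cD); rewrite [F c]/F.
rewrite ler_pdivlMr ?oppr_gt0 // mulrN => h; lra.
Qed.

Lemma count_lt (T : eqType) (p q : pred T) (s : seq T) x : subpred p q ->
  x \in s -> q x -> ~~ p x -> (count p s < count q s)%N.
Proof.
move=> pq xs qx npx; elim: s xs => // y s IH; rewrite inE => /predU1P[<-|/IH h] /=.
  by rewrite qx (negPf npx) add0n add1n ltnS sub_count.
by rewrite -addnS; apply: leq_add => //; case: (p y) (pq y) => // ->.
Qed.

Section Polytope.
Variables (R : realType) (m : nat) (s : seq 'rV[R]_m) (e : 'rV[R]_m).
Let dP := @dotv_inner R m.
Implicit Types (X Y Z D a : 'rV[R]_m).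

Definition polytope X : Prop :=
  dotv e X = 1 /\ forall a, a \in s -> 0 <= dotv a X.

(** The vertices in the sense of linear programming: the tight constraints leave
no direction of movement. *)
Definition basic X : Prop := polytope X /\
  forall D, dotv e D = 0 -> (forall a, a \in s -> dotv a X = 0 -> dotv a D = 0) -> D = 0.

Hypothesis bounded : forall D, dotv e D = 0 ->
  (forall a, a \in s -> 0 <= dotv a D) -> D = 0.

Lemma unblocked_eq0 D : dotv e D = 0 -> D != 0 -> exists2 a, a \in s & dotv a D < 0.
Proof.
move=> eD /eqP D0; apply: contrapT => no; apply: D0; apply: bounded => // a as_.
by rewrite leNgt; apply/negP => h; apply: no; exists a.
Qed.

Lemma basic_eq X Y : basic X -> polytope Y ->
  (forall a, a \in s -> dotv a X = 0 -> dotv a Y = 0) -> Y = X.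
Proof.
move=> [[eX _] bX] [eY _] h; apply/eqP; rewrite -subr_eq0; apply/eqP/bX.
  by rewrite (ipBr dP) eX eY subrr.
by move=> a as_ aX; rewrite (ipBr dP) h // aX subrr.
Qed.

Let tight X : pred 'rV[R]_m := fun a => dotv a X == 0.

Lemma polytope_move X D : polytope X -> dotv e D = 0 -> D != 0 ->
  (forall a, a \in s -> dotv a X = 0 -> dotv a D = 0) ->
  exists t, [/\ 0 < t, polytope (X + t *: D) &
     (count (tight X) s < count (tight (X + t *: D)) s)%N].
Proof.
move=> [eX X0] eD D0 tD; have [t [t0 tX [a [as_ aD aX]]]] := blocking X0 (unblocked_eq0 eD D0).
have aX0 : dotv a X != 0 by apply/eqP => /(tD a as_) h; move: aD; rewrite h ltxx.
exists t; split.
- rewrite lt0r t0 andbT; apply: contraNneq aX0 => tz.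
  by rewrite -aX tz scale0r addr0.
- by split=> //; rewrite (ipDr dP) (ipZr dP) eD mulr0 addr0.
- rewrite -[X in (_ < X)%N](@eq_in_count _ (predU (tight X) (tight (X + t *: D)))).
    apply: (@count_lt _ _ _ _ a) => //=; first by move=> b /= ->.
    by rewrite /tight aX eqxx orbT.
  move=> b bs /=; apply/orb_idl; rewrite /tight => /eqP bX.
  by rewrite (ipDr dP) (ipZr dP) bX tD // mulr0 addr0.
Qed.

(** A polytope is the convex hull of its basic points: any other point is between
two points with more tight constraints. *)
Lemma polytope_ind (P : 'rV[R]_m -> Prop) : (forall X, basic X -> P X) ->
  (forall X Y Z x y, polytope X -> polytope Y -> polytope Z -> 0 <= x -> 0 <= y ->
    Z = x *: X + y *: Y -> P X -> P Y -> P Z) ->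
  forall X, polytope X -> P X.
Proof.
move=> Pb Pc X; have [k] := ubnP (size s - count (tight X) s).
elim: k X => // k IH X; rewrite ltnS => leX pX.
have [bX|nb] := pselect (basic X); first exact: Pb.
have [D [eD D0 tD]] : exists D, [/\ dotv e D = 0, D != 0 &
    forall a, a \in s -> dotv a X = 0 -> dotv a D = 0].
  apply: contrapT => no; apply: nb; split=> // D eD tD.
  by apply/eqP/negPn/negP => D0; apply: no; exists D.
have step E : dotv e E = 0 -> E != 0 ->
    (forall a, a \in s -> dotv a X = 0 -> dotv a E = 0) ->
    exists t, [/\ 0 < t, polytope (X + t *: E) & P (X + t *: E)].
  move=> eE E0 tE; have [t [t0 pt ct]] := polytope_move pX eE E0 tE.
  exists t; split=> //; apply: IH => //; apply: leq_trans leX.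
  by apply: ltn_sub2l => //; apply: leq_trans ct (count_size _ _).
have [t [t0 pt Pt]] := step D eD D0 tD.
have [||a as_ aX|u [u0 pu Pu]] := step (- D).
- by rewrite (ipNr dP) eD oppr0.
- by rewrite oppr_eq0.
- by rewrite (ipNr dP) tD // oppr0.
have tu : t + u != 0 by rewrite gt_eqF // addr_gt0.
apply: (Pc (X + t *: D) (X + u *: - D) X (u / (t + u)) (t / (t + u))) => //.
- by rewrite divr_ge0 // ltW // addr_gt0.
- by rewrite divr_ge0 // ltW // addr_gt0.
rewrite !scalerDr addrACA -scalerDl !scalerA scalerN.
rewrite (_ : t / (t + u) * u = u / (t + u) * t); last by field.
rewrite subrr addr0 (_ : _ + _ = 1) ?scale1r //.
by field.
Qed.

(** The improvement step of the simplex method: unless a linear form is maximal at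
a vertex, it increases along an edge from this vertex. The edge from X0 to X1 is
the zero set of the linear form l. *)
Lemma improving_edge X0 Y (f : 'rV[R]_m) : basic X0 -> polytope Y ->
  dotv f X0 = 0 -> 0 < dotv f Y ->
  exists X1 l, [/\ polytope X1, 0 < dotv f X1,
    forall Z, polytope Z -> 0 <= dotv l Z &
    forall Z, polytope Z ->
      (dotv l Z = 0 <-> exists x y, [/\ 0 <= x, 0 <= y & Z = x *: X0 + y *: X1])].
Proof.
move=> [[eX sX] bX] [eY sY] fX fY.
pose A := [seq a <- s | dotv a X0 == 0].
have AP a : a \in A -> a \in s /\ dotv a X0 = 0.
  by rewrite mem_filter => /andP[/eqP].
have AI a : a \in s -> dotv a X0 = 0 -> a \in A.
  by move=> as_ aX; rewrite mem_filter aX eqxx.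
pose dir D := [/\ dotv e D = 0, forall a, a \in A -> 0 <= dotv a D & 0 < dotv f D].
(* a feasible direction along which f increases, with as many tight constraints
as possible, is the direction of an edge *)
have [D [eD AD fD] Dmax] : exists2 D, dir D & forall E, dir E ->
    (count (tight E) A <= count (tight D) A)%N.
  have dY : dir (Y - X0).
    split; first by rewrite (ipBr dP) eX eY subrr.
      by move=> a /AP [as_ aX]; rewrite (ipBr dP) aX subr0 sY.
    by rewrite (ipBr dP) fX subr0.
  pose Q k := `[< exists2 D, dir D & count (tight D) A = k >].
  have exQ : exists k, Q k.
    by exists (count (tight (Y - X0)) A); apply/asboolP; exists (Y - X0).
  have Qle k : Q k -> (k <= size A)%N by move=> /asboolP [D _ <-]; apply: count_size.
  case: (ex_maxnP exQ Qle) => k /asboolP [D dD kE] kmax; exists D => // E dE.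
  by rewrite kE; apply: kmax; apply/asboolP; exists E.
have D0 : D != 0 by apply: contraTneq fD => ->; rewrite (ip0r dP) ltxx.
have line E : dotv e E = 0 -> (forall a, a \in A -> dotv a D = 0 -> dotv a E = 0) ->
    E = (dotv f E / dotv f D) *: D.
  move=> eE tE; pose F := E - (dotv f E / dotv f D) *: D; apply/eqP.
  rewrite -subr_eq0 -/F; apply/negPn/negP => F0.
  have fF : dotv f F = 0 by rewrite (ipBr dP) (ipZr dP) divfK ?gt_eqF // subrr.
  have eF : dotv e F = 0 by rewrite (ipBr dP) (ipZr dP) eE eD mulr0 subrr.
  have tF a : a \in A -> dotv a D = 0 -> dotv a F = 0.
    by move=> aA aD; rewrite (ipBr dP) (ipZr dP) tE // aD mulr0 subrr.
  have contra G : dotv f G = 0 -> dotv e G = 0 ->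
      (forall a, a \in A -> dotv a D = 0 -> dotv a G = 0) ->
      (exists2 a, a \in A & dotv a G < 0) -> False.
    move=> fG eG tG ex; have [t [t0 At [a [aA aG aE]]]] := blocking AD ex.
    have : dir (D + t *: G).
      split=> //; first by rewrite (ipDr dP) (ipZr dP) eD eG mulr0 addr0.
      by rewrite (ipDr dP) (ipZr dP) fG mulr0 addr0.
    move/Dmax; apply/negP; rewrite -ltnNge.
    rewrite -[X in (_ < X)%N](@eq_in_count _ (predU (tight D) (tight (D + t *: G)))).
      apply: (@count_lt _ _ _ _ a) => //=; first by move=> b /= ->.
        by rewrite /tight aE eqxx orbT.
      by apply/eqP => /(tG a aA) h; move: aG; rewrite h ltxx.
    move=> b bA /=; apply/orb_idl; rewrite /tight => /eqP bD.
    by rewrite (ipDr dP) (ipZr dP) bD tG // mulr0 addr0.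
  have [a aA aF] : exists2 a, a \in A & dotv a F != 0.
    apply: contrapT => no; apply: (elimN eqP F0); apply: bX => // a as_ aX.
    by apply/eqP/negPn/negP => h; apply: no; exists a; rewrite ?AI.
  have [aF0|aF0] := ltP (dotv a F) 0; first by apply: (contra F) => //; exists a.
  apply: (contra (- F)); rewrite ?(ipNr dP) ?fF ?eF ?oppr0 //.
    by move=> b bA bD; rewrite (ipNr dP) tF // oppr0.
  by exists a; rewrite // (ipNr dP) oppr_lt0 lt0r aF.
have [t [t0 pt [b [bs bD bt]]]] := blocking sX (unblocked_eq0 eD D0).
have bX0 : 0 < dotv b X0.
  rewrite lt0r sX // andbT; apply/eqP => h.
  by have := AD b (AI b bs h); rewrite leNgt bD.
have tp : 0 < t.
  rewrite lt0r t0 andbT; apply/eqP => tz; move: bt.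
  by rewrite tz scale0r addr0 => h; move: bX0; rewrite h ltxx.
have pX1 : polytope (X0 + t *: D).
  by split=> //; rewrite (ipDr dP) (ipZr dP) eD mulr0 addr0.
pose l := \sum_(a <- A | dotv a D == 0) a.
have lE Z : dotv l Z = \sum_(a <- A | dotv a D == 0) dotv a Z.
  rewrite /l; elim/big_rec2: _ => [|a x y _ <-]; first by rewrite (ip0l dP).
  by rewrite (ipDl dP).
have l0 Z : polytope Z -> forall a, a \in A -> 0 <= dotv a Z.
  by move=> [_ sZ] a /AP [/sZ].
exists (X0 + t *: D), l; split=> //.
- by rewrite (ipDr dP) (ipZr dP) fX add0r mulr_gt0.
- move=> Z pZ; rewrite lE big_seq_cond; apply: sumr_ge0 => a /andP[aA _].
  exact: l0 aA.
move=> Z pZ; split; last first.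
  move=> [x [y [_ _ ->]]]; rewrite lE big_seq_cond big1 // => a /andP[/AP [_ aX] /eqP aD].
  by rewrite (ipDr dP) !(ipZr dP) (ipDr dP) (ipZr dP) aX aD !(mulr0, addr0).
rewrite lE big_seq_cond => /eqP; rewrite psumr_eq0; last first.
  by move=> a /andP[aA _]; exact: l0 aA.
move=> /allP h; have [eZ sZ] := pZ.
have [c ZE] : exists c, Z = X0 + c *: D.
  exists (dotv f (Z - X0) / dotv f D); rewrite -line ?subrKC //.
    by rewrite (ipBr dP) eZ eX subrr.
  move=> a aA aD; have [as_ aX] := AP a aA; rewrite (ipBr dP) aX subr0.
  by have := h a aA; rewrite aA aD eqxx /= => /eqP.
have c0 : 0 <= c.
  have [a aA aD] : exists2 a, a \in A & dotv a D != 0.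
    apply: contrapT => no; apply: (elimN eqP D0); apply: bX => // a as_ aX.
    by apply/eqP/negPn/negP => h'; apply: no; exists a; rewrite ?AI.
  have ap : 0 < dotv a D by rewrite lt0r aD AD.
  have [as_ aX] := AP a aA; have := sZ a as_.
  by rewrite ZE (ipDr dP) (ipZr dP) aX add0r pmulr_lge0.
have ct : c <= t.
  have := sZ b bs; rewrite ZE; move: bt; rewrite !(ipDr dP) !(ipZr dP) => h1 h2.
  by rewrite -(ler_nM2r bD); lra.
exists (1 - c / t), (c / t); split.
- by rewrite subr_ge0 ler_pdivrMr // mul1r.
- by rewrite divr_ge0.
by rewrite scalerDr addrA -scalerDl subrK scale1r scalerA divfK ?gt_eqF.
Qed.

End Polytope.

(** * Compact convex polyhedra *)

Section Polyhedron.
Variables (R : realType) (n : nat) (kappa : R).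
Hypothesis k0 : kappa <= 0.
Let dP := @dotv_inner R n.
Let dP1 := @dotv_inner R (1 + n).
Local Notation EE := (matrix R 1 (1 + n)%N).
Local Notation ht := (height kappa).
Local Notation sh := (sheet kappa).
Variables (C : set 'rV[R]_n) (s : seq EE).
Hypothesis C0 : C !=set0.
Hypothesis cC : compact C.
Hypothesis CE : C = [set v | forall a, a \in s -> halfspace kappa a v].
Implicit Types (u v p q : 'rV[R]_n).

Let e : EE := mkcov 1 0.
Let eE (X : EE) : dotv e X = cov0 X.
Proof. by rewrite [X]mkcovE dotv_mkcov mul1r (ip0l dP) addr0 mkcov_l. Qed.

(** The projective model: the point of the affine hyperplane of height one on the
line spanned by a point of the sheet. *)
Definition klein v : EE := (ht v)^-1 *: sh v.

Let h0 v : ht v != 0. Proof. by rewrite gt_eqF // height_gt0. Qed.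

Lemma sheet_klein v : sh v = ht v *: klein v.
Proof. by rewrite /klein scalerA mulfV // scale1r. Qed.

Lemma klein_inj u v : klein u = klein v -> u = v.
Proof.
move=> h; apply: (@sheet_scale _ _ _ k0 (ht u / ht v)).
by rewrite [LHS]sheet_klein [sh v]sheet_klein scalerA divfK // h.
Qed.

Let dotv_klein a v : dotv a (klein v) = (ht v)^-1 * dotv a (sh v).
Proof. by rewrite /klein (ipZr dP1). Qed.

Lemma klein_polytope v : polytope s e (klein v) <-> C v.
Proof.
have hv : 0 < (ht v)^-1 by rewrite invr_gt0 height_gt0.
split=> [[_ h]|Cv].
  by rewrite CE => a as_; have := h a as_; rewrite dotv_klein pmulr_rge0.
split; first by rewrite eE /klein sheetE mkcovZ mkcov_l mulVf.
by move=> a as_; rewrite dotv_klein pmulr_rge0 //; move: Cv; rewrite CE; apply.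
Qed.

Lemma polyhedron_convex : geodesically_convex kappa C.
Proof.
move=> u v uC vC p up; rewrite CE => a as_.
by apply: (halfspace_convex k0 _ _ up); [move: uC | move: vC]; rewrite CE; apply.
Qed.

Let klein_mkcov v : klein v = mkcov 1 ((ht v)^-1 *: v).
Proof. by rewrite /klein sheetE mkcovZ mulVf. Qed.

Let line_sq (z w : 'rV[R]_n) t : dotv (z + t *: w) (z + t *: w) =
  dotv z z + 2 * t * dotv z w + t ^+ 2 * dotv w w.
Proof. by rewrite !(ipE dP) (ipC dP w z); ring. Qed.

(** A segment of the projective section that leaves the region of the projective
model would contain points of this region that are arbitrarily close to its
boundary, contradicting compactness. *)
Lemma klein_bounded : exists2 be, 0 < 1 + kappa * be & forall z : 'rV[R]_n,
  (forall a, a \in s -> 0 <= dotv a (mkcov 1 z)) -> dotv z z <= be.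
Proof.
have [M0 CM0 M0max] : exists2 c, c \in C & forall t, t \in C -> dotv t t <= dotv c c.
  apply: (@EVT_max_rV R n (fun v => dotv v v)) => //.
  apply: continuous_subspaceT => v; apply: dotv_continuous => i; exact: coord_continuous.
pose M := dotv M0 M0; have CM v : C v -> dotv v v <= M by move=> h; apply: M0max; rewrite inE.
have M_ge0 : 0 <= M := ip_ge0 dP M0.
have kM : 0 < 1 - kappa * M by apply: (lt_le_trans ltr01); rewrite lerDl oppr_ge0 mulr_le0_ge0.
pose be := M / (1 - kappa * M).
have beE : be * (1 - kappa * M) = M by rewrite divfK // gt_eqF.
have kbe : 0 < 1 + kappa * be.
  by rewrite -(pmulr_lgt0 _ kM) mulrDl -mulrA beE; rewrite mul1r subrK.
have be0 : 0 <= be by rewrite divr_ge0 // ltW.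
clearbody be.
have small v : C v -> dotv ((ht v)^-1 *: v) ((ht v)^-1 *: v) <= be.
  move=> /CM vM; rewrite (ipZl dP) (ipZr dP) mulrA -expr2 exprVn height_sqr //.
  have kv : 0 < 1 - kappa * dotv v v.
    by apply: (lt_le_trans ltr01); rewrite lerDl oppr_ge0 mulr_le0_ge0 // (ip_ge0 dP).
  rewrite mulrC ler_pdivrMr // mulrBr mulr1 lerBrDr.
  have : dotv v v * (1 + kappa * be) <= M * (1 + kappa * be) by rewrite ler_wpM2r // ltW.
  by move: beE; lra.
exists be => // z zs; rewrite leNgt; apply/negP => bez.
have [p pC] := C0; pose zp := (ht p)^-1 *: p.
have zps a : a \in s -> 0 <= dotv a (mkcov 1 zp).
  move=> as_; rewrite -klein_mkcov; have [_] := (klein_polytope p).2 pC; exact.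
have zpb : dotv zp zp <= be := small p pC.
have [c bc [cz kc]] : exists2 c, be < c & c < dotv z z /\ 0 < 1 + kappa * c.
  pose de := Num.min ((dotv z z - be) / 2) ((1 + kappa * be) / (1 - kappa)).
  have k1 : 0 < 1 - kappa by rewrite subr_gt0 (le_lt_trans k0).
  have [d1 d2] : de <= (dotv z z - be) / 2 /\ de <= (1 + kappa * be) / (1 - kappa).
    by rewrite !ge_min !lexx orbT.
  have d0 : 0 < de by rewrite lt_min !divr_gt0 // subr_gt0.
  exists (be + de); first by rewrite ltrDl.
  split; first by lra.
  by move: d2; rewrite ler_pdivlMr // mulrBr mulr1 mulrDr; lra.
have [w wE] : exists w, w = z - zp by eexists.
have pE t : dotv (zp + t *: w) (zp + t *: w) = dotv zp zp + 2 * t * dotv zp w + t ^+ 2 * dotv w w.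
  exact: line_sq.
pose P : {poly R} := (dotv zp zp - c)%:P + (2 * dotv zp w) *: 'X + dotv w w *: 'X^2.
have PE t : P.[t] = dotv (zp + t *: w) (zp + t *: w) - c.
  by rewrite /P pE !hornerE /=; ring.
have [t /andP[t0 t1] /eqP rt] : exists2 t, 0 <= t <= 1 & root P t.
  apply: poly_ivt => //; rewrite !PE scale0r addr0 scale1r wE subrKC; apply/andP; split; lra.
have Nc : dotv (zp + t *: w) (zp + t *: w) = c by move: rt; rewrite PE; lra.
have ks a : a \in s -> 0 <= dotv a (mkcov 1 (zp + t *: w)).
  move=> as_; have -> : mkcov 1 (zp + t *: w) = (1 - t) *: mkcov 1 zp + t *: mkcov 1 z.
    rewrite !mkcovZ mkcovD; congr mkcov; first by ring.
    by rewrite wE scalerBl scalerBr scale1r addrAC addrA.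
  by rewrite (ipDr dP1) !(ipZr dP1) addr_ge0 // mulr_ge0 ?zps ?zs // subr_ge0.
have inc : incone kappa (mkcov 1 (zp + t *: w)).
  by rewrite /incone mkcov_l mkcov_r Nc expr1n.
have [q [v [q0 vE]]] := incone_sheet k0 inc.
have vC : C v.
  by rewrite CE => a /ks; rewrite vE (ipZr dP1) pmulr_rge0.
move: vE; rewrite sheetE mkcovZ => /mkcov_inj [e1 e2].
have := small v vC; rewrite (_ : (ht v)^-1 = q) -?e2 ?Nc; first by rewrite leNgt bc.
by rewrite -[LHS]mul1r e1 mulfK.
Qed.

Lemma polytope_klein X : polytope s e X -> exists2 v, C v & X = klein v.
Proof.
move=> pX; have [eX sX] := pX; rewrite eE in eX.
have XE : X = mkcov 1 (covr X) by rewrite -eX -mkcovE.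
have [be kbe bound] := klein_bounded.
have zb : dotv (covr X) (covr X) <= be by apply: bound; rewrite -XE.
have inc : incone kappa X.
  rewrite /incone eX expr1n; split=> //; apply: (lt_le_trans kbe).
  by rewrite lerD2l ler_wnM2l.
have [q [v [q0 vE]]] := incone_sheet k0 inc.
have qh : q = (ht v)^-1.
  move: vE; rewrite XE sheetE mkcovZ => /mkcov_inj [e1 _].
  by rewrite -[RHS]mul1r e1 mulfK.
have XK : X = klein v by rewrite vE qh.
by exists v => //; apply/klein_polytope; rewrite -XK.
Qed.

Let bounded D : dotv e D = 0 -> (forall a, a \in s -> 0 <= dotv a D) -> D = 0.
Proof.
move=> eD sD; rewrite eE in eD; have [be _ bound] := klein_bounded; have [p pC] := C0.
pose z := (ht p)^-1 *: p; set w := covr D.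
have DE : D = mkcov 0 w by rewrite -eD -mkcovE.
suff -> : D = mkcov 0 0 by rewrite /mkcov raddf0 row_mx0.
rewrite DE; congr mkcov; apply/eqP/negPn/negP => w0.
have ww : 0 < dotv w w by case: dP => _ _; apply.
have le_be t : 0 <= t -> dotv z z + 2 * t * dotv z w + t ^+ 2 * dotv w w <= be.
  move=> t0; have -> : dotv z z + 2 * t * dotv z w + t ^+ 2 * dotv w w =
      dotv (z + t *: w) (z + t *: w) by rewrite line_sq.
  apply: bound => a as_; have -> : mkcov 1 (z + t *: w) = klein p + t *: D.
    by rewrite klein_mkcov DE mkcovZ mkcovD mulr0 addr0.
  rewrite (ipDr dP1) (ipZr dP1 t); apply: addr_ge0; last by apply: mulr_ge0 => //; apply: sD.
  have [_] := (klein_polytope p).2 pC; exact.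
have zz := ip_ge0 dP z; have be0 : 0 <= be by have := le_be 0 (lexx _); lra.
have nb : - `|dotv z w| <= dotv z w by rewrite lerNl -normrN ler_norm.
have nb0 : 0 <= `|dotv z w| by rewrite normr_ge0.
pose t := (be + 1 + 2 * `|dotv z w|) / dotv w w + 1.
have tw : t * dotv w w = be + 1 + 2 * `|dotv z w| + dotv w w.
  by rewrite /t mulrDl divfK ?gt_eqF // mul1r.
have t1 : 1 <= t by rewrite /t lerDr divr_ge0 ?(ltW ww) //; lra.
have := le_be t (le_trans ler01 t1).
have -> : t ^+ 2 * dotv w w = t * (t * dotv w w) by ring.
rewrite tw; nra.
Qed.

Definition vert v : Prop := C v /\ basic s e (klein v).

Lemma segment_klein u v p x y : 0 <= x -> 0 <= y ->
  klein p = x *: klein u + y *: klein v -> segment kappa u v p.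
Proof.
move=> x0 y0 h; apply/(segment_sheet k0); exists (ht p * x / ht u), (ht p * y / ht v).
have hp w := ltW (height_gt0 k0 w).
split; [by rewrite !mulr_ge0 ?invr_ge0 | by rewrite !mulr_ge0 ?invr_ge0 |].
by rewrite sheet_klein h scalerDr !scalerA.
Qed.

Lemma klein_segment u v p : segment kappa u v p ->
  exists x y, [/\ 0 <= x, 0 <= y & klein p = x *: klein u + y *: klein v].
Proof.
move=> /(segment_sheet k0) [x [y [x0 y0 h]]].
have hp w := ltW (height_gt0 k0 w).
exists ((ht p)^-1 * x * ht u), ((ht p)^-1 * y * ht v).
split; [by rewrite !mulr_ge0 ?invr_ge0 | by rewrite !mulr_ge0 ?invr_ge0 |].
rewrite -!scalerA -!sheet_klein /klein h scalerDr //.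
Qed.

Lemma polyhedron_ind (P : 'rV[R]_n -> Prop) : (forall v, vert v -> P v) ->
  (forall u v p, C u -> C v -> C p -> segment kappa u v p -> P u -> P v -> P p) ->
  forall p, C p -> P p.
Proof.
move=> Pv Ps p pC.
apply: (@polytope_ind R _ s e bounded (fun X => forall p, X = klein p -> P p) _ _ (klein p)) => //.
- move=> X bX q qE; apply: Pv; rewrite qE in bX; split=> //.
  by apply/klein_polytope; case: bX.
- move=> X Y Z x y /polytope_klein [u uC uE] /polytope_klein [v vC vE] pZ x0 y0 ZE Pu Pv' q qE.
  apply: (Ps u v) => //.
  + by apply/klein_polytope; rewrite -qE.
  + by apply: (segment_klein x0 y0); rewrite -qE ZE uE vE.
  + exact: Pu.
  + exact: Pv'.
- by apply/klein_polytope.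
Qed.

Lemma vert_exists : exists v, vert v.
Proof.
apply: contrapT => no; have [p pC] := C0; apply: (polyhedron_ind _ _ pC) => // v vv.
by case: no; exists v.
Qed.

(** Unlike basic points, extreme points are defined by the metric alone, so that
they are preserved by isometries. *)
Definition extreme v : Prop := C v /\
  forall p q, C p -> C q -> segment kappa p q v -> p = v \/ q = v.

Lemma vert_extreme v : vert v <-> extreme v.
Proof.
split=> [[vC bv]|[vC ev]].
  split=> // p q pC qC /klein_segment [x [y [x0 y0 h]]].
  have P u : C u -> polytope s e (klein u) by move/klein_polytope.
  have main u w x' y' : C u -> C w -> 0 < x' -> 0 <= y' ->
      klein v = x' *: klein u + y' *: klein w -> u = v.
    move=> uC wC x'0 y'0 h'; apply: klein_inj; apply: (basic_eq bv (P u uC)) => a as_.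
    rewrite h' (ipDr dP1) (ipZr dP1 x') (ipZr dP1 y') => /eqP.
    have au : 0 <= dotv a (klein u) by case: (P u uC) => _; apply.
    have aw : 0 <= dotv a (klein w) by case: (P w wC) => _; apply.
    rewrite paddr_eq0 ?mulr_ge0 ?(ltW x'0) // => /andP[+ _].
    by rewrite mulf_eq0 (gt_eqF x'0) => /eqP.
  have [xp|] := ltP 0 x; first by left; apply: (main p q x y).
  move=> xle; have xz : x = 0 by apply/eqP; rewrite eq_le xle.
  right; apply: (main q p y x) => //; last by rewrite addrC.
  rewrite lt0r y0 andbT; apply/eqP => yz.
  have [+ _] := P v vC; rewrite h xz yz !scale0r addr0 (ip0r dP1) => /eqP.
  by rewrite eq_sym oner_eq0.
have pv : polytope s e (klein v) by apply/klein_polytope.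
split=> //; split=> // D eD tD; apply/eqP/negPn/negP => D0.
have [t [t0 pt _]] := polytope_move bounded pv eD D0 tD.
have [||a as_ aX|u [u0 pu _]] := polytope_move bounded pv (D := - D).
- by rewrite (ipNr dP1) eD oppr0.
- by rewrite oppr_eq0.
- by rewrite (ipNr dP1) tD // oppr0.
have [p pC pE] := polytope_klein pt; have [q qC qE] := polytope_klein pu.
have tu0 : 0 < t + u by rewrite addr_gt0.
have tu : t + u != 0 by rewrite gt_eqF.
have ne (c : R) E : 0 < c -> E != 0 -> klein v + c *: E = klein v -> False.
  move=> c0 E0 /eqP; rewrite -subr_eq0 addrAC subrr add0r scaler_eq0 (gt_eqF c0).
  by rewrite (negPf E0).
case: (ev p q pC qC).
- apply: (@segment_klein _ _ _ (u / (t + u)) (t / (t + u))).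
  + by rewrite divr_ge0 // ltW.
  + by rewrite divr_ge0 // ltW.
  rewrite -pE -qE; move: (klein v) => K; rewrite !scalerDr addrACA -scalerDl !scalerA scalerN.
  rewrite (_ : t / (t + u) * u = u / (t + u) * t); last by field.
  rewrite subrr addr0 (_ : _ + _ = 1) ?scale1r //.
  by field.
- by move=> h; apply: (ne t D t0 D0); rewrite pE h.
- by move=> h; apply: (ne u (- D) u0); rewrite ?oppr_eq0 // qE h.
Qed.

Let face_of (l : EE) v : (forall p, C p -> 0 <= dotv l (sh p)) -> C v ->
  dotv l (sh v) = 0 -> face kappa C (C `&` hplane kappa l).
Proof.
move=> lC vC lv; split; first by exists v.
have [l0|ln] := eqVneq l 0.
  left; apply/seteqP; split=> [p []//|p pC]; split=> //.
  by rewrite /hplane /= l0 (ip0l dP1).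
right; exists l; split=> //; first by split=> //; exists v.
Qed.

(** The sum of the tight constraints exposes a vertex. *)
Lemma vert_vertex v : vert v -> vertex kappa C v.
Proof.
move=> [vC bv]; pose l := \sum_(a <- s | dotv a (klein v) == 0) a.
have lE Z : dotv l Z = \sum_(a <- s | dotv a (klein v) == 0) dotv a Z.
  rewrite /l; elim/big_rec2: _ => [|a x y _ <-]; first by rewrite (ip0l dP1).
  by rewrite (ipDl dP1).
have sC p a : C p -> a \in s -> 0 <= dotv a (sh p) by rewrite CE => h /h.
have lv : dotv l (sh v) = 0.
  rewrite lE big1 // => a /eqP av; by rewrite sheet_klein (ipZr dP1) av mulr0.
have lC p : C p -> 0 <= dotv l (sh p).
  move=> pC; rewrite lE big_seq_cond; apply: sumr_ge0 => a /andP[as_ _]; exact: sC.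
rewrite /vertex (_ : [set v] = C `&` hplane kappa l); first exact: (face_of lC vC).
apply/seteqP; split=> [_ -> //|p [pC]]; rewrite /hplane /= lE big_seq_cond.
move=> /eqP; rewrite psumr_eq0; last by move=> a /andP[as_ _]; exact: sC.
move=> /allP h; apply: klein_inj; apply: (basic_eq bv); first exact/klein_polytope.
move=> a as_ av; have := h a as_; rewrite as_ av eqxx /= => /eqP ap.
by rewrite dotv_klein ap mulr0.
Qed.

Lemma polyhedron_edge v0 p (f : EE) : vert v0 -> C p -> dotv f (sh v0) = 0 ->
  0 < dotv f (sh p) -> exists u, [/\ edge kappa C v0 u, C u & 0 < dotv f (sh u)].
Proof.
move=> [vC bv] pC fv fp.
have kv : dotv f (klein v0) = 0 by rewrite dotv_klein fv mulr0.
have kp : 0 < dotv f (klein p) by rewrite dotv_klein mulr_gt0 // invr_gt0 height_gt0.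
have [X1 [l [pX fX lp lE]]] := improving_edge bounded bv ((klein_polytope p).2 pC) kv kp.
have [u uC uE] := polytope_klein pX.
have fu : 0 < dotv f (sh u).
  by move: fX; rewrite uE dotv_klein pmulr_rgt0 // invr_gt0 height_gt0.
have lh q : dotv l (sh q) = ht q * dotv l (klein q).
  by rewrite {1}sheet_klein (ipZr dP1).
have lC q : C q -> 0 <= dotv l (sh q).
  move=> qC; rewrite lh mulr_ge0 // ?(ltW (height_gt0 k0 q)) //.
  exact/lp/klein_polytope.
exists u; split=> //; split; first by move=> h; move: fu; rewrite -h fv ltxx.
rewrite (_ : segment kappa v0 u = C `&` hplane kappa l).
  apply: (face_of lC vC); rewrite lh (lE _ ((klein_polytope v0).2 vC)).2 ?mulr0 //.
  by exists 1, 0; rewrite scale1r scale0r addr0.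
apply/seteqP; split=> q.
  move=> qs; have qC := polyhedron_convex vC uC qs; split=> //.
  rewrite /hplane /= lh (lE _ ((klein_polytope q).2 qC)).2 ?mulr0 // uE.
  exact: klein_segment.
move=> [qC]; rewrite /hplane /= lh => /eqP; rewrite mulf_eq0 (negPf (h0 q)) => /eqP.
move/(lE _ ((klein_polytope q).2 qC)) => [x [y [x0 y0 h]]].
by apply: (segment_klein x0 y0); rewrite h uE.
Qed.

(** A vertex is determined by its set of tight constraints. *)
Lemma vert_finite : exists vs : seq 'rV[R]_n, forall v, v \in vs <-> vert v.
Proof.
pose tight v := [set i : 'I_(size s) | dotv (tnth (in_tuple s) i) (klein v) == 0]%SET.
have [f fP] : exists f : {set 'I_(size s)} -> 'rV[R]_n,
    forall v, vert v -> vert (f (tight v)) /\ tight (f (tight v)) = tight v.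
  have /choice [f fP] : forall A, exists w, (exists2 v, vert v & tight v = A) -> vert w /\ tight w = A.
    move=> A; case: (pselect (exists2 v, vert v & tight v = A)) => [[v vv vA]|no].
      by exists v.
    by exists 0.
  by exists f => v vv; apply: fP; exists v.
exists [seq v <- [seq f A | A <- enum [set: {set 'I_(size s)}]%SET] | `[< vert v >]] => v.
rewrite mem_filter; split=> [/andP[/asboolP] // | vv].
apply/andP; split; first exact/asboolP.
apply/mapP; exists (tight v); first by rewrite mem_enum inE.
have [fv te] := fP v vv; apply/klein_inj; case: (fv) => fC bf.
apply: (basic_eq bf); first exact/klein_polytope/vv.1.
move=> a as_ af; have [i iE] : exists i, a = tnth (in_tuple s) i by apply/tnthP.
have : i \in tight (f (tight v)) by rewrite inE -iE af.
by rewrite te inE -iE => /eqP.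
Qed.

End Polyhedron.

(** * The group generated by the reflections in the edges *)

(** A monoid of injections that preserves a finite set, and whose elements are
determined by their restrictions to this set, is a finite group. *)
Lemma finite_motions (D : choiceType) (M : (D -> D) -> Prop) (vs : seq D) :
  M id -> (forall f h, M f -> M h -> M (f \o h)) ->
  (forall f v, M f -> v \in vs -> f v \in vs) -> (forall f, M f -> injective f) ->
  (forall f h, M f -> M h -> {in vs, f =1 h} -> f = h) ->
  exists (W : finGroupType) (rho : W -> D -> D),
    [/\ forall w, M (rho w), forall f, M f -> exists w, rho w = f,
        forall w w' v, rho (w * w')%g v = rho w (rho w' v) & injective rho].
Proof.
move=> M1 MM Mvs Minj Muniq; pose T := seq_sub vs.
pose acts (f : D -> D) (p : {perm T}) := forall v : T, f (val v) = val (p v).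
have ex_perm f : M f -> exists p, acts f p.
  move=> Mf; pose h (v : T) : T := SeqSub (Mvs f (val v) Mf (valP v)).
  have hi : injective h by move=> u v /(congr1 val) /= e; apply/val_inj/(Minj f Mf).
  by exists (perm hi) => v; rewrite permE.
pose G := [set p : {perm T} | `[< exists2 f, M f & acts f p >]]%SET.
have gG : group_set G.
  have GP p : p \in G <-> exists2 f, M f & acts f p.
    by rewrite finset.in_set; split=> /asboolP.
  apply/group_setP; split=> [|p q].
    by apply/GP; exists id => // v; rewrite perm1.
  move=> /GP [f Mf fp] /GP [h Mh hq]; apply/GP.
  by exists (h \o f); [exact: MM | move=> v; rewrite /= fp hq permM].
pose GG := Group gG; pose W : finGroupType := subg_of GG.
have /choice [ff ffP] : forall w : W, exists f, M f /\ acts f (sgval w).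
  move=> w; have := subgP w; rewrite inE => /asboolP [f Mf fp]; by exists f.
have sM (x y : W) (u : T) : sgval (x * y)%g u = sgval y (sgval x u).
  by rewrite -permM.
exists W, (fun w => ff w^-1%g); split.
- by move=> w; case: (ffP w^-1%g).
- move=> f Mf; have [p fp] := ex_perm f Mf.
  have pG : p \in GG by rewrite inE; apply/asboolP; exists f.
  exists (subg GG p)^-1%g; rewrite invgK; have [Mw aw] := ffP (subg GG p).
  apply: Muniq => // v vv; have := aw (SeqSub vv); rewrite subgK //= => ->.
  by have := fp (SeqSub vv).
- move=> w w' v; have [Mw aw] := ffP w^-1%g; have [Mw' aw'] := ffP w'^-1%g.
  have [Mww aww] := ffP (w * w')^-1%g.
  suff -> : ff (w * w')^-1%g = ff w^-1%g \o ff w'^-1%g by [].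
  apply: Muniq; [by [] | exact: MM | move=> u uv].
  by have := aww (SeqSub uv); rewrite invMg sM -aw -aw'.
- move=> w w' e; apply: invg_inj; apply/val_inj/permP => v; apply: val_inj.
  by have [_ <-] := ffP w^-1%g; have [_ <-] := ffP w'^-1%g; rewrite e.
Qed.

Lemma inconeD (R : realType) (n : nat) (kappa : R) (X Y : 'rV[R]_(1 + n)) :
  kappa <= 0 -> incone kappa X -> incone kappa Y -> incone kappa (X + Y).
Proof.
move=> k0 iX iY; have [a [u [a0 uE]]] := incone_sheet k0 iX.
have [b [v [b0 vE]]] := incone_sheet k0 iY.
have uv := sheet_form_ge1 k0 u v.
have xy : 0 <= cov0 X * cov0 Y + kappa * dotv (covr X) (covr Y).
  rewrite uE vE; move: uv; rewrite /sheet_form !sheetE !mkcovZ !mkcov_l !mkcov_r.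
  rewrite (ipZl (@dotv_inner R n)) (ipZr (@dotv_inner R n)) => uv.
  have -> : a * height kappa u * (b * height kappa v) + kappa * (a * (b * dotv u v)) =
    a * b * (height kappa u * height kappa v + kappa * dotv u v) by ring.
  by rewrite mulr_ge0 ?mulr_ge0 ?(ltW a0) ?(ltW b0) // (le_trans ler01).
have XY : X + Y = mkcov (cov0 X + cov0 Y) (covr X + covr Y) by rewrite -mkcovD -!mkcovE.
move: iX iY xy; rewrite /incone XY mkcov_l mkcov_r.
move: (cov0 X) (cov0 Y) (covr X) (covr Y) => x y w z [x0 xw] [y0 yz] xy {XY}.
split; first exact: addr_gt0.
have -> : (x + y) ^+ 2 + kappa * dotv (w + z) (w + z) =
    (x ^+ 2 + kappa * dotv w w) + (y ^+ 2 + kappa * dotv z z) +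
    2 * (x * y + kappa * dotv w z).
  rewrite !(ipE (@dotv_inner R n)) (ipC (@dotv_inner R n) z w); ring.
by apply: ltr_wpDr; [rewrite mulr_ge0 | rewrite addr_gt0].
Qed.

Section EvenPolyhedron.
Variables (R : realType) (n : nat) (kappa : R).
Hypothesis k0 : kappa <= 0.
Let dP1 := @dotv_inner R (1 + n).
Local Notation EE := (matrix R 1 (1 + n)%N).
Local Notation sh := (sheet kappa).
Variables (C : set 'rV[R]_n) (s : seq EE).
Hypothesis C0 : C !=set0.
Hypothesis cC : compact C.
Hypothesis CE : C = [set v | forall a, a \in s -> halfspace kappa a v].
Hypothesis evenC : even_polyhedron kappa C.
Implicit Types (u v p q : 'rV[R]_n).
Local Notation vert := (vert kappa C s).
Local Notation extreme := (extreme kappa C).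

Let vertP v : vert v <-> extreme v.
Proof. exact: vert_extreme. Qed.

Definition edge_reflection (f : 'rV[R]_n -> 'rV[R]_n) : Prop :=
  exists u v, edge kappa C u v /\ exchanging_reflection kappa u v f.

(** A priori only a monoid; it is a group by finite_motions. *)
Inductive motion : ('rV[R]_n -> 'rV[R]_n) -> Prop :=
| motion_id : motion id
| motion_cons f h : edge_reflection f -> motion h -> motion (f \o h).

Lemma motion_comp f h : motion f -> motion h -> motion (f \o h).
Proof. by move=> mf mh; elim: mf => // f' h' ef _ IH; apply: (motion_cons ef IH). Qed.

Let motion_edge f : edge_reflection f -> motion f.
Proof. by move=> ef; apply: (motion_cons ef motion_id). Qed.

Lemma edge_reflection_even f : edge_reflection f ->
  f @` C = C /\ forall p, vertex kappa C p -> f p <> p.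
Proof.
by move=> [u [v [uv ef]]]; have [h [_ hu] hP] := evenC uv; rewrite -(hu f ef).
Qed.

Lemma edge_mem u v : edge kappa C u v -> C u /\ C v.
Proof.
move=> [_ [_ uv]]; suff sub : segment kappa u v `<=` C.
  by split; apply: sub; [exact: (segment_l k0) | exact: (segment_r k0)].
by case: uv => [-> //|[a [_ _ ->]] p []].
Qed.

Lemma motion_isometry f : motion f -> isometry kappa f.
Proof.
elim=> [|f' h [u [v [_ [[[bf df] _ _] _ _]]]] _ [bh dh]].
  by split=> //; exists id.
by split=> [|p q]; [exact: bij_comp | rewrite /= df dh].
Qed.

Lemma motion_C f p : motion f -> C (f p) <-> C p.
Proof.
move=> mf; elim: mf p => // f' h ef _ IH p; rewrite -(IH p) /=.
have [fC _] := edge_reflection_even ef; split=> [|hC]; last by rewrite -fC; exists (h p).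
rewrite -{1}fC => -[q qC /(bij_inj (motion_isometry (motion_edge ef)).1) <-] //.
Qed.

Lemma motion_linext f : motion f -> exists F, linext kappa f F.
Proof.
elim=> [|f' h [u [v [_ [rf _ _]]]] _ [H HP]]; first by exists id; split.
have [F FP] := linext_reflection k0 rf.
by exists (F \o H); exact: linext_comp.
Qed.

Lemma motion_vert f v : motion f -> vert (f v) <-> vert v.
Proof.
move=> mf; have [[f' fK f'K] df] := motion_isometry mf.
rewrite !vertP; split=> -[vC ev]; split; first by apply/(motion_C v mf).
- move=> p q pC qC seg.
  have fp : C (f p) by apply/(motion_C p mf).
  have fq : C (f q) by apply/(motion_C q mf).
  have fseg : segment kappa (f p) (f q) (f v) by rewrite /segment /= !df.
  case: (ev _ _ fp fq fseg) => e; [left | right]; exact: (can_inj fK e).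
- by apply/(motion_C v mf).
- move=> p q; rewrite -[p]f'K -[q]f'K => pC qC seg.
  have fp : C (f' p) by apply/(motion_C _ mf).
  have fq : C (f' q) by apply/(motion_C _ mf).
  have fseg : segment kappa (f' p) (f' q) v by move: seg; rewrite /segment /= !df.
  by case: (ev _ _ fp fq fseg) => e; rewrite e; [left | right].
Qed.

Let kill_C (c : EE) : (forall v, vert v -> dotv c (sh v) = 0) ->
  forall p, C p -> dotv c (sh p) = 0.
Proof.
move=> cv; apply: (polyhedron_ind k0 C0 cC CE) => // u v p _ _ _.
by move=> /(segment_sheet k0) [x [y [_ _ ->]]]; rewrite (ipDr dP1) !(ipZr dP1) => -> ->;
  rewrite !mulr0 addr0.
Qed.

(** A motion displaces the points of the sheet in the span of the vertices: the
reflection exchanging u and v moves them along sh u - sh v. *)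
Let motion_kill (c : EE) f p : (forall v, vert v -> dotv c (sh v) = 0) -> motion f ->
  dotv c (sh (f p)) = dotv c (sh p).
Proof.
move=> cv; elim=> // f' h [u [v [uv ef]]] _ IH; have [uC vC] := edge_mem uv.
have [ne _] := uv; rewrite /= (exchanging_hrefl k0 ne ef) /hrefl (ipBr dP1) (ipZr dP1).
have -> : sharp kappa (qlift kappa u - qlift kappa v) = sh u - sh v.
  by rewrite !(sheet_lift k0) sharpB opprD addrACA subrr add0r.
by rewrite (ipBr dP1) (kill_C cv uC) (kill_C cv vC) subrr mulr0 subr0 IH.
Qed.

(** Two motions with the same effect on the vertices agree: the images of a point
are equidistant from all vertices, and differ by an element of their span. *)
Lemma motion_uniq f h : motion f -> motion h -> (forall v, vert v -> f v = h v) -> f = h.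
Proof.
move=> mf mh fh; apply: funext => p; apply: (chord_eq0 k0).
pose c := qlift kappa (f p) - qlift kappa (h p).
have ff := isometry_chord k0 (motion_isometry mf).
have hh := isometry_chord k0 (motion_isometry mh).
have cv v : vert v -> dotv c (sh v) = 0.
  have [[f' _ f'K] _] := motion_isometry mf; rewrite -[v]f'K.
  move=> /(motion_vert _ mf) vv; have := chord_bisector k0 (f p) (h p) (f (f' v)).
  by rewrite ff fh // hh subrr => /esym /eqP; rewrite mulf_eq0 oppr_eq0 pnatr_eq0 /= => /eqP.
have : dotv c (sharp kappa c) = 0.
  have -> : sharp kappa c = sh (f p) - sh (h p).
    by rewrite !(sheet_lift k0) sharpB opprD addrACA subrr add0r.
  by rewrite (ipBr dP1) !motion_kill // subrr.
have -> // : dotv c (sharp kappa c) = chord kappa (f p) (h p).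
by rewrite /chord -/c [c]mkcovE sharp_mkcov dotv_mkcov qform_mkcov; ring.
Qed.

Lemma motion_group : exists (W : finGroupType) (rho : W -> 'rV[R]_n -> 'rV[R]_n),
  [/\ forall w, motion (rho w), forall f, motion f -> exists w, rho w = f,
      forall w w' v, rho (w * w')%g v = rho w (rho w' v) & injective rho].
Proof.
have [vs vsP] := vert_finite k0 CE.
apply: (@finite_motions _ motion vs).
- exact: motion_id.
- exact: motion_comp.
- by move=> f v mf /vsP vv; apply/vsP/(motion_vert v mf).
- by move=> f mf; exact: (bij_inj (motion_isometry mf).1).
- by move=> f h mf mh fh; apply: motion_uniq => // v /vsP /fh.
Qed.

(** The sum of the vertices in the ambient space is fixed by the linear extensions
of the motions; its projection to the sheet is the fixed point. *)
Lemma motion_fixed : exists x, forall f, motion f -> f x = x.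
Proof.
have [vs0 vs0P] := vert_finite k0 CE; pose vs := undup vs0.
have vsP v : v \in vs <-> vert v by rewrite mem_undup; exact: vs0P.
have [v0 vv0] := vert_exists k0 C0 cC CE.
have inc : incone kappa (\sum_(v <- vs) sh v).
  have : vs != [::] by apply: contraTneq ((vsP v0).2 vv0) => ->.
  elim: (vs) => // v l IH _; rewrite big_cons.
  have [->|/IH] := eqVneq l [::]; first by rewrite big_nil addr0; exact: sheet_incone.
  by apply: inconeD => //; exact: sheet_incone.
have [q [x [q0 xE]]] := incone_sheet k0 inc.
exists x => f mf; have [F FP] := motion_linext mf; have [Fl Fs] := FP.
have F0 : F 0 = 0.
  by apply: (addIr (F 0)); have := Fl 1 0 0; rewrite !scale1r addr0 add0r => <-.
have FD X Y : F (X + Y) = F X + F Y by have := Fl 1 X Y; rewrite !scale1r.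
have FZ k X : F (k *: X) = k *: F X by have := Fl k X 0; rewrite F0 !addr0.
apply: (@sheet_inj _ _ kappa); apply: (scalerI (lt0r_neq0 q0)).
rewrite -Fs -FZ -xE (big_morph F FD F0).
under eq_bigr do rewrite Fs.
rewrite -(big_map f predT (fun v => sh v)); apply: perm_big.
have finj := bij_inj (motion_isometry mf).1.
apply: uniq_perm; rewrite ?(map_inj_uniq finj) ?undup_uniq //.
have [[f' fK f'K] _] := motion_isometry mf.
move=> v; rewrite -[v]f'K (mem_map finj); apply/idP/idP => /vsP h; apply/vsP.
  exact/(motion_vert _ mf).
exact/(motion_vert _ mf).
Qed.

Section Orbit.
Variables (W : finGroupType) (rho : W -> 'rV[R]_n -> 'rV[R]_n).
Hypothesis rho_motion : forall w, motion (rho w).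
Hypothesis rho_surj : forall f, motion f -> exists w, rho w = f.
Hypothesis rhoM : forall w w' v, rho (w * w')%g v = rho w (rho w' v).
Hypothesis rho_inj : injective rho.
Variables (act : W -> EE -> EE) (g : EE -> EE -> R) (tau : EE -> R).
Hypotheses (gP : inner_product g) (actP : orthogonal_action g act).
Hypothesis actS : forall w v, act w (sh v) = sh (rho w v).
Hypothesis tau_lin : forall a X Y, tau (a *: X + Y) = a * tau X + tau Y.
Hypothesis tau_act : forall w X, tau (act w X) = tau X.
Hypothesis tau_gt0 : forall v, 0 < tau (sh v).

(** Each edge from u leads to an image of u under the group, and tau is the same
at both ends. Hence, if u maximises the product with q on its orbit, no edge
from u increases the form g (sh q) - m * tau vanishing at u, and neither does
any point of the polyhedron. *)
Lemma closest_vertex u q : vert u ->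
  (forall b, g (sh q) (sh (rho b u)) <= g (sh q) (sh u)) ->
  forall p, C p -> g (sh q) (sh p) * tau (sh u) <= g (sh q) (sh u) * tau (sh p).
Proof.
move=> vu umax p pC.
have [c cE] : exists c, forall X,
    g (sh q) X * tau (sh u) - g (sh q) (sh u) * tau X = dotv c X.
  by apply: functional_dotv => a X Y; rewrite tau_lin (ipDr gP) (ipZr gP); ring.
rewrite -subr_le0 cE leNgt; apply/negP => cp.
have cu : dotv c (sh u) = 0 by rewrite -cE subrr.
have [v [uv vC]] := polyhedron_edge k0 C0 cC CE vu pC cu cp.
have [r [er _] _] := evenC uv.
have [b bE] : exists b, rho b = r.
  by apply: rho_surj; apply: motion_edge; exists u, v.
have vE : v = rho b u by rewrite bE; case: er.
rewrite -cE vE -actS tau_act actS -mulrBl pmulr_lgt0 // subr_gt0.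
by rewrite ltNge umax.
Qed.

(** Let q be the point of the orbit of v with the largest product with u. Then u is
optimal for q and q is optimal for u, and after normalisation by tau the two
inequalities give |q - u| ^ 2 <= 0. *)
Lemma vert_transitive u v : vert u -> vert v -> exists w, v = rho w u.
Proof.
move=> vu vv.
pose w0 := [arg max_(w > 1%g | true) g (sh (rho w v)) (sh u)]%O.
have hmax w : g (sh (rho w v)) (sh u) <= g (sh (rho w0 v)) (sh u).
  by rewrite /w0; case: Order.TotalTheory.arg_maxP => // t _; apply.
set q := rho w0 v in hmax; have vq : vert q by apply/(motion_vert v (rho_motion w0)).
have m1 : g (sh q) (sh q) * tau (sh u) <= g (sh q) (sh u) * tau (sh q).
  apply: (closest_vertex vu) => [b|]; last by case: vq.
  have := hmax (b^-1 * w0)%g; rewrite rhoM -/q -[sh (rho b^-1%g q)]actS => h.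
  by rewrite -actS -(act_ip actP b^-1%g) (actK gP actP).
have m2 : g (sh u) (sh u) * tau (sh q) <= g (sh u) (sh q) * tau (sh u).
  apply: (closest_vertex vq) => [b|]; last by case: vu.
  by rewrite ![g (sh u) _](ipC gP) -rhoM hmax.
have tu := tau_gt0 u; have tq := tau_gt0 q.
suff e : q = u.
  exists w0^-1%g; apply: (sheet_inj (kappa := kappa)).
  by rewrite -actS -e /q -actS (actK gP actP).
have z0 : tau (sh u) *: sh q - tau (sh q) *: sh u = 0.
  apply: (ip_eq0 gP); apply/eqP; rewrite eq_le (ip_ge0 gP) andbT.
  rewrite (ipC gP (sh u)) in m2.
  rewrite (ipBl gP) !(ipBr gP) !(ipZl gP) !(ipZr gP) (ipC gP (sh u) (sh q)).
  have h1 : tau (sh u) * (g (sh q) (sh q) * tau (sh u)) <=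
     tau (sh u) * (g (sh q) (sh u) * tau (sh q)) by rewrite ler_wpM2l // ltW.
  have h2 : tau (sh q) * (g (sh u) (sh u) * tau (sh q)) <=
     tau (sh q) * (g (sh q) (sh u) * tau (sh u)) by rewrite ler_wpM2l // ltW.
  lra.
apply: (@sheet_scale _ _ _ k0 (tau (sh q) / tau (sh u))).
apply: (scalerI (lt0r_neq0 tu)); rewrite scalerA mulrC divfK ?lt0r_neq0 //.
by apply/eqP; rewrite -subr_eq0 z0.
Qed.

Lemma vert_hull u : vert u -> C = convex_hull kappa (range (fun w => rho w u)).
Proof.
move=> vu; apply/seteqP; split=> p.
  move: p; apply: (polyhedron_ind k0 C0 cC CE).
    move=> v /(vert_transitive vu) [w ->] A [_ h]; apply: h.
    by exists w.
  move=> v v' p _ _ _ seg hv hv' A AP; have [cA _] := AP.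
  by apply: (cA v v'); [exact: hv | exact: hv' |].
apply; split; first exact: (polyhedron_convex k0 CE).
by move=> _ [w _ <-]; apply/(motion_C u (rho_motion w)); case: vu.
Qed.

End Orbit.

(** Only finitely many walls have to be avoided, so that a ball around the point
avoids them, and balls are connected. *)
Lemma off_walls_chamber (W : finGroupType) (rho : W -> 'rV[R]_n -> 'rV[R]_n) v :
  off_walls kappa rho v -> exists2 D, chamber kappa rho D & (D°)%classic v.
Proof.
move=> ov; exists (closure (connected_component (off_walls kappa rho) v)); first by exists v.
have : nbhs v (off_walls kappa rho).
  have near w : nbhs v [set p | reflection kappa (rho w) -> rho w p <> p].
    case: (pselect (reflection kappa (rho w))) => [rw|nr]; last first.
      by apply: filterE => p /nr.
    have [a [_ _ fixE]] := reflection_hrefl k0 rw.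
    have av : dotv a (sh v) != 0.
      by apply/eqP => /fixE; exact: ((off_wallsP kappa rho v).1 ov w rw).
    have := @sheet_dotv_continuous _ _ kappa a v.
    move/cvgr_neq0 => /(_ av); apply: filterS => p ap _ /fixE h.
    by move: ap; rewrite h eqxx.
  apply: filterS (filter_forall (nbhs_filter v) near) => p h.
  by apply/off_wallsP => w; exact: h.
rewrite /interior /= => /nbhs_ballP [e /= e0 sub]; apply/nbhs_ballP; exists e => //= p vp.
apply: subset_closure.
pose f (t : R) := v + t *: (p - v).
have cf : continuous f.
  move=> t0; apply: (@continuousD _ _ _ (fun=> v) (fun t : R => t *: (p - v))).
    exact: cst_continuous.
  by apply: continuousZr_tmp => U.
have cB : connected (f @` `[0, 1]%classic).
  apply: connected_continuous_connected; first exact: segment_connected.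
  exact: continuous_subspaceT.
apply: (@connected_component_max _ _ (f @` `[0, 1]%classic)) => //.
- by exists 0; rewrite /= ?in_itv /= ?lexx ?ler01 // /f scale0r addr0.
- move=> _ [t tI <-]; have /andP[t0 t1] : 0 <= t <= 1 by move: tI; rewrite /= in_itv.
  apply: sub.
  move: vp; rewrite -!ball_normE /= /f opprD addrA subrr add0r normrN normrZ.
  rewrite -normrN opprB => h; apply: le_lt_trans h.
  by rewrite ger0_norm // ler_piMl.
- by exists 1; rewrite /= ?in_itv /= ?lexx ?ler01 // /f scale1r subrKC.
Qed.

(** Since edge reflections fix no vertex, a vertex v0 lies on no mirror of their
conjugates, which therefore have a simple system based at v0. *)
Theorem even_orbit_hull : exists (x : 'rV[R]_n) (W : finGroupType) (S : {set W})
  (rho : W -> 'rV[R]_n -> 'rV[R]_n) (y : 'rV[R]_n), coxeter_orbit_hull kappa C x S rho y.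
Proof.
have [W [rho [rho_motion rho_surj rhoM rho_inj]]] := motion_group.
have [x xfix] := motion_fixed.
have [v0 vv0] := vert_exists k0 C0 cC CE.
have isom w := motion_isometry (rho_motion w).
have rho1 v : rho 1%g v = v by apply: (bij_inj (isom 1%g).1); rewrite -rhoM mul1g.
have rho_faithful w : (forall v, rho w v = v) -> w = 1%g.
  by move=> h; apply: rho_inj; apply: funext => v; rewrite h rho1.
have [act [g [tau [gP actP actS [tl ta tp]]]]] :=
  representation_action k0 rho1 rhoM rho_faithful (fun w => motion_linext (rho_motion w)).
pose T := [set t : W | `[< exists w b, edge_reflection (rho b) /\ t = (w * b * w^-1)%g >]]%SET.
have TP t : t \in T <-> exists w b, edge_reflection (rho b) /\ t = (w * b * w^-1)%g.
  by rewrite inE; split=> [/asboolP|h]; last exact/asboolP.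
have TJ w t : t \in T -> (w * t * w^-1)%g \in T.
  move=> /TP [u [b [eb ->]]]; apply/TP; exists (w * u)%g, b; split=> //.
  by rewrite invMg !mulgA.
have TG w : w \in <<T>>%g.
  have gen f : motion f -> exists2 u, u \in <<T>>%g & rho u = f.
    elim=> [|f' h ef _ [u uT uE]].
      by exists 1%g; [exact: group1 | apply: funext => v; rewrite rho1].
    have [b bE] := rho_surj f' (motion_edge ef).
    exists (b * u)%g; last by apply: funext => v; rewrite rhoM bE uE.
    rewrite groupM // mem_gen //; apply/TP; exists 1%g, b; split; first by rewrite bE.
    by rewrite mul1g invg1 mulg1.
  by have [u uT /rho_inj <-] := gen _ (rho_motion w).
have reflT t : t \in T -> exists a, reflects g act t a.
  move=> /TP [w [b [[u [v [_ [rb _ _]]]] ->]]].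
  have [a ab] := reflection_reflects k0 gP actP actS rb.
  by exists (act w a); exact: (reflects_conj gP actP).
have [r rT] : exists r : W -> EE, forall t, t \in T -> reflects g act t (r t).
  have /choice [r rP] : forall t, exists a, t \in T -> reflects g act t a.
    by move=> t; case tT : (t \in T); [have [a h] := reflT t tT; exists a | exists 0].
  by exists r.
have freeT t v : t \in T -> vert v -> rho t v <> v.
  move=> /TP [w [b [eb ->]]] vv; rewrite !rhoM => h.
  have [_ nofix] := edge_reflection_even eb.
  apply: (nofix (rho w^-1%g v)).
    by apply: (vert_vertex k0 CE); apply/(motion_vert v (rho_motion w^-1%g)).
  by rewrite -[in RHS]h -(rhoM w^-1%g w) mulVg rho1.
have ty t : t \in T -> act t (sh v0) <> sh v0.
  by move=> tT; rewrite actS => /sheet_inj; exact: freeT.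
have [D [r' [DT Sz]]] := base_simple gP actP TJ TG rT ty.
have reflW t : t \in T -> reflection kappa (rho t).
  move=> tT; apply: (reflects_reflection rho_faithful gP actP actS (isom t) _ (rT t tT)).
  exact: xfix.
exists x, W, D, rho, v0; split.
- exact: (simple_coxeter gP actP Sz).
- split=> //.
  + by move=> w; split; [exact: isom | exact: xfix].
  + by move=> w w'; apply: funext => v; rewrite rhoM.
  + by move=> t tD; apply: reflW; apply: (fintype.subsetP DT).
- apply: off_walls_chamber; apply/off_wallsP => w rw.
  have [a aw] := reflection_reflects k0 gP actP actS rw.
  by apply: freeT => //; exact: (reflection_mem gP actP TJ TG rT aw).
- exact: (vert_hull rho_motion rho_surj rhoM gP actP actS tl ta tp).
Qed.

End EvenPolyhedron.

Theorem proposition4p1 (R : realType) (n : nat) (kappa : R)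
    (kappa_le0 : kappa <= 0) (C : set 'rV[R]_n)
    (polyC : compact_convex_polyhedron kappa C) :
  (even_polyhedron kappa C <->
   exists (x : 'rV[R]_n) (W : finGroupType) (S : {set W})
          (rho : W -> 'rV[R]_n -> 'rV[R]_n) (y : 'rV[R]_n),
     coxeter_orbit_hull kappa C x S rho y) /\
  (forall (x : 'rV[R]_n) (W : finGroupType) (S : {set W})
          (rho : W -> 'rV[R]_n -> 'rV[R]_n) (y : 'rV[R]_n),
     coxeter_orbit_hull kappa C x S rho y ->
     graph_isomorphic (vertex kappa C) (edge kappa C)
                      [set: W] (cayley_adj S)).
Proof.
have [C0 cC [s _ CE]] := polyC; split; last first.
  by move=> x W S rho y; exact: (orbit_hull_graph kappa_le0).
split=> [evenC|[x [W [S [rho [y CH]]]]]].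
  exact: (even_orbit_hull kappa_le0 C0 cC CE evenC).
exact: (orbit_hull_even kappa_le0 CH).
Qed.
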